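(* Let $(\mathcal T,\mathbf r)$ be a reduced T-mesh with a smoothness distribution constant along each maximal segment, and let $m,m'\ge0$ be integers. If $\operatorname{CNDC}_{m,m'}^{\mathbf r}(\mathcal T)=\varnothing$, then for every $(\mathcal T',\mathbf r')\in[\mathcal T,\mathbf r]_{\mathrm I}^{+}$, $$\dim\mathcal S_{m,m'}^{\mathbf r'}(\mathcal T')=\chi\bigl(\mathcal Q_{m,m'}^{\mathbf r'}((\mathcal T')^\circ)\bigr).$$ Hence $(\mathcal T,\mathbf r)$ is dimensionally stable (for the ordered bi-degree $(m,m')$).
   Context: **T-meshes.** Coordinates on $\mathbb R^2$ are $(s,t)$, with $s$ horizontal and $t$ vertical. Let $\Omega\subset\mathbb R^2$ be a finite union of closed axis-aligned rectangles with pairwise disjoint interiors, with $\Omega$ simply connected and $\Omega^\circ$ connected. A T-mesh on $\Omega$ is a triple $\mathcal T=(\mathcal T_2,\mathcal T_1,\mathcal T_0)$: $\mathcal T_2$ is the finite set of these closed rectangles (cells); $\mathcal T_1=\mathcal T_1^h\cup\mathcal T_1^v$ is a finite set of closed horizontal and vertical segments (edges) contained in $\bigcup_{\sigma\in\mathcal T_2}\partial\sigma$; $\mathcal T_0$ is the set of endpoints of edges (vertices); each $\partial\sigma$ is a finite union of edges; distinct cells $\sigma,\sigma'$ satisfy $\sigma\cap\sigma'=\partial\sigma\cap\partial\sigma'$, a finite union of edges and vertices; distinct edges meet only in vertices. Interior edges $\mathcal T_1^\circ$ are the edges meeting $\Omega^\circ$; the other edges are boundary edges. Interior vertices $\mathcal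 T_0^\circ$ are the vertices in $\Omega^\circ$. (Different T-meshes may live on different domains $\Omega$.) **Maximal segments.** A segment is a connected union of edges lying on one straight line. $\operatorname{MS}(\mathcal T)$ is the set of maximal segments consisting of interior edges. Such a segment is a cross-cut if both endpoints lie on $\partial\Omega$, a ray if exactly one does, and a maximal interior segment (MIS) if it does not meet $\partial\Omega$; these sets are $\operatorname{CC}(\mathcal T)$, $\operatorname{Ray}(\mathcal T)$, $\operatorname{MIS}(\mathcal T)$. A boundary maximal segment is a maximal connected union of boundary edges on one line; their set is $\operatorname{BMS}(\mathcal T)$. $\widehat{\operatorname{MS}}(\mathcal T)$ is the disjoint union of these four sets. $\mathcal T$ is reduced if no vertex is inserted merely to divide a straight edge into two collinear edges, every vertex lies on exactly one horizontal and exactly one vertical member of $\widehat{\operatorname{MS}}(\mathcal T)$, and the edges are exactly the closed subsegments between consecutive vertices on these members (so an interior and a boundary maximal segment of the same direction never meet collinearly at a common endpoint). **Smoothness.** A smoothness distribution is a map $\mathbf r:\mathcal T_1\to\{-1,0,1,\dots\}$ equal to $-1$ on boundary edges. It is constant along each maximal segment if for every $\rho\in\operatorname{MS}(\mathcal T)$ all edges $\tau\subset\rho$ have the same value $\mathbf r(\tau)=:r(\rho)$. For $\gamma\in\mathcal T_0^\circ$ with horizontal and vertical maximal segments $\rho_h(\gamma),\rho_v(\gamma)$ through it, $r_h(\gamma):=r(\rho_v(\gamma))$ and $r_v(\gamma):=r(\rho_h(\gamma))$. **Structural isomorphism and structural class.** For $\rho\in\widehat{\operatorname{MS}}(\mathcal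 T)$ let $\operatorname{cor}(\rho)$ be its constant $t$-coordinate if horizontal, its constant $s$-coordinate if vertical. For reduced T-meshes, a bijection $\alpha:\widehat{\operatorname{MS}}(\mathcal T)\to\widehat{\operatorname{MS}}(\mathcal T')$ is a structural isomorphism if (i) it maps $\operatorname{CC},\operatorname{Ray},\operatorname{MIS},\operatorname{BMS}$ of $\mathcal T$ onto those of $\mathcal T'$; (ii) for distinct $\rho,\eta$: $\rho\cap\eta\ne\varnothing\iff\alpha(\rho)\cap\alpha(\eta)\neq\varnothing$ (nonempty intersections are vertices, and $\alpha_0(\rho\cap\eta):=\alpha(\rho)\cap\alpha(\eta)$); (iii) $\rho\parallel\eta\iff\alpha(\rho)\parallel\alpha(\eta)$, and for parallel segments $\operatorname{cor}(\rho)<\operatorname{cor}(\eta)\iff\operatorname{cor}(\alpha(\rho))<\operatorname{cor}(\alpha(\eta))$. It is direction-preserving if it maps horizontal segments to horizontal ones and vertical to vertical ones. It induces bijections $\alpha_0$ of vertices, $\alpha_1$ of edges (the edge between consecutive vertices $\gamma,\gamma'$ of $\rho$ goes to the edge of $\alpha(\rho)$ between $\alpha_0(\gamma),\alpha_0(\gamma')$) and of cells. The structural class $[\mathcal T,\mathbf r]_{\mathrm I}^{+}$ is the set of pairs $(\mathcal T',\mathbf r')$ (reduced T-mesh with smoothness distribution) for which there is a direction-preserving structural isomorphism $\alpha$ from $\mathcal T$ to $\mathcal T'$ with $\mathbf r'(\alpha_1(\tau))=\mathbf r(\tau)$ for every $\tau\in\mathcal T_1^\circ$. **Spline space, Euler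 characteristic, stability.** $R_{m,m'}=\operatorname{span}_{\mathbb R}\{s^it^j:0\le i\le m,\,0\le j\le m'\}$. $\mathcal S_{m,m'}^{\mathbf r}(\mathcal T)$ is the space of piecewise polynomial functions $f$ on $\Omega$ with $f|_\sigma\in R_{m,m'}$ for every cell $\sigma$ and $f$ of class $C^{\mathbf r(\tau)}$ across every interior edge $\tau$; $C^{-1}$ means no matching condition, so $f$ is regarded as a family of polynomials $(f_\sigma)_{\sigma\in\mathcal T_2}$. ($C^r$ across $\tau=$ common edge of $\sigma,\sigma'$ means $f_\sigma-f_{\sigma'}$ is divisible by $\ell_\tau^{r+1}$, where $\ell_\tau$ is a nonzero affine linear polynomial vanishing on the line of $\tau$.) Put $I_\tau^{\mathbf r}=\langle\ell_\tau^{\mathbf r(\tau)+1}\rangle\cap R_{m,m'}$ for $\tau\in\mathcal T_1^\circ$ and $I_\gamma^{\mathbf r}=\sum_{\tau\ni\gamma,\tau\in\mathcal T_1^\circ}I_\tau^{\mathbf r}$ for $\gamma\in\mathcal T_0^\circ$. $\mathcal Q_{m,m'}^{\mathbf r}(\mathcal T^\circ)$ is the complex $0\to\bigoplus_{\sigma\in\mathcal T_2}[\sigma]R_{m,m'}\to\bigoplus_{\tau\in\mathcal T_1^\circ}[\tau]R_{m,m'}/I_\tau^{\mathbf r}\to\bigoplus_{\gamma\in\mathcal T_0^\circ}[\gamma]R_{m,m'}/I_\gamma^{\mathbf r}\to0$ with maps induced by the cellular boundary maps relative to $\partial\Omega$; its Euler characteristic is $\chi(\mathcal Q_{m,m'}^{\mathbf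 r}(\mathcal T^\circ))=\sum_{\sigma\in\mathcal T_2}\dim R_{m,m'}-\sum_{\tau\in\mathcal T_1^\circ}\dim(R_{m,m'}/I_\tau^{\mathbf r})+\sum_{\gamma\in\mathcal T_0^\circ}\dim(R_{m,m'}/I_\gamma^{\mathbf r})$. $(\mathcal T,\mathbf r)$ is dimensionally stable (for $(m,m')$) if $\dim\mathcal S_{m,m'}^{\mathbf r'}(\mathcal T')=\dim\mathcal S_{m,m'}^{\mathbf r}(\mathcal T)$ for every $(\mathcal T',\mathbf r')\in[\mathcal T,\mathbf r]_{\mathrm I}^{+}$. **Absolute weights.** A deletion state is a pair $(\mathcal A,\mathcal B)$ with $\mathcal A\cap\mathcal B=\varnothing$, $\mathcal A\cup\mathcal B=\operatorname{MIS}(\mathcal T)$. For $\rho\in\mathcal A$, $\operatorname{Mono}_{(\mathcal A,\mathcal B)}(\rho)$ is the set of vertices on $\rho$ lying on no MIS in $\mathcal A\setminus\{\rho\}$. With $(a)_+=\max\{a,0\}$, $\mu_h(\gamma)=(m-r_h(\gamma))_+$, $\mu_v(\gamma)=(m'-r_v(\gamma))_+$. The absolute weight $\Omega_{(\mathcal A,\mathcal B)}(\rho)$ is $\sum_{\gamma\in\operatorname{Mono}_{(\mathcal A,\mathcal B)}(\rho)}\mu_h(\gamma)$ for $\rho$ horizontal and $\sum_{\gamma\in\operatorname{Mono}_{(\mathcal A,\mathcal B)}(\rho)}\mu_v(\gamma)$ for $\rho$ vertical. The threshold is $\theta(\rho)=m+1$ for $\rho$ horizontal, $m'+1$ for $\rho$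 vertical. An MIS $\rho\in\mathcal A$ is diagonalizable at $(\mathcal A,\mathcal B)$ if $\Omega_{(\mathcal A,\mathcal B)}(\rho)\ge\theta(\rho)$. **Deletion algorithm and weighted CNDC.** Start with $\mathcal A=\operatorname{MIS}(\mathcal T)$, $\mathcal B=\varnothing$. In each pass let $\mathcal Z$ be the set of all $\rho\in\mathcal A$ diagonalizable at $(\mathcal A,\mathcal B)$, and replace $\mathcal A$ by $\mathcal A\setminus\mathcal Z$ and $\mathcal B$ by $\mathcal B\cup\mathcal Z$; repeat until a pass has $\mathcal Z=\varnothing$. The final $\mathcal A$ is the weighted CNDC $\operatorname{CNDC}_{m,m'}^{\mathbf r}(\mathcal T)$. *)

(* Defs.v *)
From HB Require Import structures.
From mathcomp Require Import all_boot all_order all_algebra finmap zify.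
From mathcomp Require Import all_classical all_reals topology normedtype.
Import Order.TTheory GRing.Theory Num.Theory numFieldNormedType.Exports.

Set Implicit Arguments.
Unset Strict Implicit.
Unset Printing Implicit Defensive.

Local Open Scope classical_set_scope.
Local Open Scope ring_scope.

(* The subspace of [vT] whose set of vectors is [P]; it is a junk value unless
   [P] is closed under linear combinations, see [mem_vspace_of]. *)
Definition vspace_of (K : fieldType) (vT : vectType K) (P : set vT) :
    {vspace vT} :=
  xget 0%VS [set V | forall v, v \in V <-> P v].

Lemma mem_vspace_of (K : fieldType) (vT : vectType K) (P : set vT) :
  P 0 -> (forall a u v, P u -> P v -> P (a *: u + v)) ->
  forall v, v \in vspace_of P <-> P v.
Proof.
move=> P0 PD.
suff exV : exists V : {vspace vT}, forall v, v \in V <-> P v.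
  exact: (xgetPex (0%VS : {vspace vT}) exV).
have grow n : (n <= \dim {:vT})%N ->
    (exists V : {vspace vT}, forall v, v \in V <-> P v) \/
    (exists V : {vspace vT}, (forall v, v \in V -> P v) /\ \dim V = n).
  elim: n => [|n IH] len.
    right; exists 0%VS; split; last by rewrite dimv0.
    by move=> v; rewrite memv0 => /eqP ->.
  case: (IH (ltnW len)) => [|[V [VP dV]]]; first by left.
  have [VE|/existsNP[v]] := pselect (forall v, P v -> v \in V).
    by left; exists V => v; split; [exact: VP | exact: VE].
  move=> /not_implyP[Pv /negP vV]; right; exists (<[v]> + V)%VS; split.
    move=> w /memv_addP[_ /vlineP[a ->] [u uV ->]].
    by apply: PD => //; exact: VP.
  have v0 : v != 0 by apply: contraNneq vV => ->; rewrite mem0v.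
  rewrite dimv_disjoint_sum ?dim_vline ?v0 ?dV //.
  apply/eqP; rewrite -subv0; apply/subvP => w.
  rewrite memv_cap => /andP[/vlineP[a ->] avV]; rewrite memv0 scaler_eq0.
  have [//|a0] := eqVneq a 0; rewrite (negbTE v0).
  by move: vV; rewrite -(scalerK a0 v) memvZ.
case: (grow _ (leqnn _)) => // -[V [VP dV]].
exists V => v; split; first exact: VP.
have -> : V = fullv by apply/eqP; rewrite eqEdim subvf dV leqnn.
by rewrite memvf.
Qed.

Section Plane.
Variable R : realType.

(* Points of the plane are pairs [(s, t)], with [s] horizontal. *)

Definition boundary (A : set (R * R)) : set (R * R) := closure A `\` A^°.

(* A loop [g] in [A], on the parameter interval [0, 1], contracts in [A] to its
   base point by a homotopy that keeps the base point fixed. *)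
Definition null_homotopic (A : set (R * R)) (g : R -> R * R) : Prop :=
  exists H : R * R -> R * R,
    [/\ {within `[0, 1] `*` `[0, 1], continuous H},
        H @` (`[0, 1] `*` `[0, 1]) `<=` A,
        forall x : R, x \in `[0, 1] -> H (x, 0) = g x /\ H (x, 1) = g 0 &
        forall u : R, u \in `[0, 1] -> H (0, u) = g 0 /\ H (1, u) = g 0].

Definition path_connected (A : set (R * R)) : Prop :=
  A !=set0 /\
  forall p q, A p -> A q ->
    exists g : R -> R * R,
      [/\ {within `[0, 1], continuous g}, g @` `[0, 1] `<=` A,
          g 0 = p & g 1 = q].

Definition simply_connected (A : set (R * R)) : Prop :=
  path_connected A /\
  forall g : R -> R * R,
    {within `[0, 1], continuous g} -> g @` `[0, 1] `<=` A -> g 0 = g 1 ->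
    null_homotopic A g.

Record rect := Rect { smin : R; smax : R; tmin : R; tmax : R }.

(* A closed axis-parallel segment: horizontal segments lie on the line
   [t = cor], vertical ones on [s = cor]; the other coordinate ranges over
   [[lo, hi]]. *)
Record segm := Segm { horiz : bool; cor : R; lo : R; hi : R }.

Definition rect_tuple (c : rect) := (smin c, smax c, tmin c, tmax c).
Definition tuple_rect (x : R * R * R * R) :=
  let: (a, b, c, d) := x in Rect a b c d.
Lemma rect_tupleK : cancel rect_tuple tuple_rect. Proof. by case. Qed.
HB.instance Definition _ := Choice.copy rect (can_type rect_tupleK).

Definition segm_tuple (e : segm) := (horiz e, cor e, lo e, hi e).
Definition tuple_segm (x : bool * R * R * R) :=
  let: (a, b, c, d) := x in Segm a b c d.
Lemma segm_tupleK : cancel segm_tuple tuple_segm. Proof. by case. Qed.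
HB.instance Definition _ := Choice.copy segm (can_type segm_tupleK).

Implicit Types (c : rect) (e p q : segm) (v : R * R).

Definition rect_set (c : rect) : set (R * R) :=
  `[smin c, smax c] `*` `[tmin c, tmax c].

Definition seg_pt (e : segm) (x : R) : R * R :=
  if horiz e then (x, cor e) else (cor e, x).

Definition seg_set (e : segm) : set (R * R) := seg_pt e @` `[lo e, hi e].

Definition seg_start (e : segm) := seg_pt e (lo e).
Definition seg_end (e : segm) := seg_pt e (hi e).

(* [p] is a segment made of edges in [E]: since a connected union of finitely
   many horizontal and vertical edges on one line is a nondegenerate closed
   axis-parallel segment, segments are encoded by elements of [segm]. *)
Definition is_segment (E : {fset segm}) (p : segm) : Prop :=
  lo p < hi p /\
  exists F : {fset segm},
    {subset F <= E} /\ seg_set p = \bigcup_(e in [set` F]) seg_set e.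

Definition is_max_segment (E : {fset segm}) (p : segm) : Prop :=
  is_segment E p /\
  forall q, is_segment E q -> seg_set p `<=` seg_set q -> q = p.

(* All segments made of edges in [E] are among these, see [mem_max_segments]. *)
Definition candidates (E : {fset segm}) : {fset segm} :=
  [fset Segm (horiz e) (cor e) (lo e) (hi e') | e in E, e' in E]%fset.

Definition max_segments (E : {fset segm}) : {fset segm} :=
  [fset p in candidates E | `[< is_max_segment E p >]]%fset.

Lemma seg_setE e (p : R * R) : seg_set e p <->
  if horiz e then lo e <= p.1 <= hi e /\ p.2 = cor e
  else lo e <= p.2 <= hi e /\ p.1 = cor e.
Proof.
rewrite /seg_set /seg_pt; case: (horiz e); case: p => a b /=; split.
- by move=> [x /= + [<- <-]]; rewrite in_itv.
- by move=> [ab ->]; exists a; rewrite //= in_itv.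
- by move=> [x /= + [<- <-]]; rewrite in_itv.
- by move=> [ab ->]; exists b; rewrite //= in_itv.
Qed.

Lemma mem_max_segments (E : {fset segm}) :
  (forall e, e \in E -> lo e < hi e) ->
  forall p, p \in max_segments E <-> is_max_segment E p.
Proof.
move=> Ewf p; rewrite /max_segments !inE /=; split.
  by move=> /andP[_ /asboolP].
move=> pmax; apply/andP; split; last exact/asboolP.
have [[lp [F [FE pF]]] _] := pmax.
have sub e : e \in F -> seg_set e `<=` seg_set p.
  by move=> eF; rewrite pF => y ey; exists e.
have par e : e \in F ->
    [/\ horiz e = horiz p, cor e = cor p, lo p <= lo e & hi e <= hi p].
  move=> eF; have le := Ewf _ (FE _ eF).
  have hs x : lo e <= x <= hi e -> seg_set e (seg_pt e x) by exists x.
  have /hs/(sub _ eF) : lo e <= lo e <= hi e by rewrite lexx ltW.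
  have /hs/(sub _ eF) : lo e <= hi e <= hi e by rewrite lexx ltW.
  rewrite !seg_setE /seg_pt; case: (horiz e); case: (horiz p) => /=.
  - by move=> [/andP[_ ->] ->] [/andP[-> _] _].
  - by move=> [_ h] [_ h']; move: le; rewrite h h' ltxx.
  - by move=> [_ h] [_ h']; move: le; rewrite h h' ltxx.
  - by move=> [/andP[_ ->] ->] [/andP[-> _] _].
have inF x : lo p <= x <= hi p ->
    exists2 e, e \in F & lo e <= x <= hi e.
  move=> xp; have : seg_set p (seg_pt p x) by exists x.
  rewrite {1}pF => -[e /= eF ex]; exists e => //.
  have [h _ _ _] := par _ eF.
  by move: ex; rewrite seg_setE /seg_pt h; case: (horiz p) => -[].
have [|e eF /andP[elo _]] := inF (lo p); first by rewrite lexx ltW.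
have [|e' e'F /andP[_ ehi]] := inF (hi p); first by rewrite lexx ltW.
have [h1 c1 l1 _] := par _ eF; have [_ _ _ r1] := par _ e'F.
apply/imfset2P; exists e; first exact: FE.
exists e'; first exact: FE.
rewrite h1 c1; have -> : lo e = lo p by apply/le_anti; rewrite elo l1.
have -> : hi e' = hi p by apply/le_anti; rewrite ehi r1.
by case: (p).
Qed.

Record mesh := Mesh { cells : {fset rect}; edges : {fset segm} }.

Implicit Types (T : mesh) (A : {fset segm}) (r : segm -> int).

Definition domain T : set (R * R) :=
  \bigcup_(c in [set` cells T]) rect_set c.

Definition vertices T : {fset (R * R)} :=
  ([fset seg_start e | e in edges T] `|` [fset seg_end e | e in edges T])%fset.

Definition interior_edges T : {fset segm} :=
  [fset e in edges T | `[< seg_set e `&` (domain T)^° !=set0 >]]%fset.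

Definition boundary_edges T : {fset segm} :=
  (edges T `\` interior_edges T)%fset.

Definition interior_vertices T : {fset (R * R)} :=
  [fset v in vertices T | `[< (domain T)^° v >]]%fset.

Record is_tmesh T : Prop := {
  cells_nondegenerate :
    forall c, c \in cells T -> smin c < smax c /\ tmin c < tmax c;
  cells_disjoint :
    forall c c', c \in cells T -> c' \in cells T -> c <> c' ->
      (rect_set c)^° `&` (rect_set c')^° = set0;
  domain_simply_connected : simply_connected (domain T);
  domain_interior_connected : connected (domain T)^°;
  edges_nondegenerate : forall e, e \in edges T -> lo e < hi e;
  edges_in_boundaries :
    forall e, e \in edges T ->
      seg_set e `<=` \bigcup_(c in [set` cells T]) boundary (rect_set c);
  cell_boundary :
    forall c, c \in cells T ->
      exists F : {fset segm}, {subset F <= edges T} /\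
        boundary (rect_set c) = \bigcup_(e in [set` F]) seg_set e;
  cells_meet :
    forall c c', c \in cells T -> c' \in cells T -> c <> c' ->
      rect_set c `&` rect_set c' =
        boundary (rect_set c) `&` boundary (rect_set c') /\
      exists (F : {fset segm}) (V : {fset (R * R)}),
        [/\ {subset F <= edges T}, {subset V <= vertices T} &
            rect_set c `&` rect_set c' =
              (\bigcup_(e in [set` F]) seg_set e) `|` [set` V]];
  edges_meet :
    forall e e', e \in edges T -> e' \in edges T -> e <> e' ->
      seg_set e `&` seg_set e' `<=` [set` vertices T]
}.

Definition MS T := max_segments (interior_edges T).
Definition BMS T := max_segments (boundary_edges T).

Definition CC T : {fset segm} :=
  [fset p in MS T | `[< boundary (domain T) (seg_start p) /\
                        boundary (domain T) (seg_end p) >]]%fset.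

Definition Ray T : {fset segm} :=
  [fset p in MS T |
    `[< boundary (domain T) (seg_start p) /\
          ~ boundary (domain T) (seg_end p) \/
        ~ boundary (domain T) (seg_start p) /\
          boundary (domain T) (seg_end p) >]]%fset.

Definition MIS T : {fset segm} :=
  [fset p in MS T | `[< (seg_set p `&` boundary (domain T) = set0)%classic >]]%fset.

Definition MShat T : {fset segm} :=
  (CC T `|` Ray T `|` MIS T `|` BMS T)%fset.

Definition consecutive T (p e : segm) : Prop :=
  [/\ horiz e = horiz p /\ lo e < hi e,
      seg_set e `<=` seg_set p,
      seg_start e \in vertices T /\ seg_end e \in vertices T &
      forall x, lo e < x < hi e -> seg_pt e x \notin vertices T].

Record reduced T : Prop := {
  reduced_is_tmesh : is_tmesh T;
  no_dividing_vertex :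
    forall v, v \in vertices T ->
      ~ exists e e', [/\ e \in edges T /\ e' \in edges T,
          e <> e', horiz e = horiz e', seg_set e v /\ seg_set e' v &
          forall f : segm, f \in edges T -> seg_set f v -> f = e \/ f = e'];
  vertex_on_unique_segments :
    forall v b, v \in vertices T ->
      exists! p, [/\ p \in MShat T, horiz p = b & seg_set p v];
  edges_consecutive :
    forall e, e \in edges T <-> exists2 p, p \in MShat T & consecutive T p e
}.

(* Smoothness distributions are total functions on segments of which only the
   values on [edges T] matter. *)
Record smoothness T r : Prop := {
  smoothness_ge : forall e, e \in edges T -> -1 <= r e;
  smoothness_boundary : forall e, e \in boundary_edges T -> r e = -1
}.

Definition constant_along T r : Prop :=
  forall p, p \in MS T -> forall e e', e \in edges T -> e' \in edges T ->
    seg_set e `<=` seg_set p -> seg_set e' `<=` seg_set p -> r e = r e'.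

(* Meaningful when [r] satisfies [constant_along T]. *)
Definition seg_smoothness T r (p : segm) : int :=
  xget (-1) [set z | exists e, [/\ e \in edges T, seg_set e `<=` seg_set p &
                                   z = r e]].

(* The horizontal ([b = true]) or vertical ([b = false]) segment through [v];
   it exists and is unique if [T] is reduced and [v] is an interior vertex. *)
Definition seg_through T (b : bool) (v : R * R) : segm :=
  xget (Segm b 0 0 0)
    [set p | [/\ p \in MS T, horiz p = b & seg_set p v]].

Definition r_h T r v := seg_smoothness T r (seg_through T false v).
Definition r_v T r v := seg_smoothness T r (seg_through T true v).

Record structural_iso T T' (a : segm -> segm) : Prop := {
  iso_bij : set_bij [set` MShat T] [set` MShat T'] a;
  iso_CC : a @` [set` CC T] = [set` CC T'];
  iso_Ray : a @` [set` Ray T] = [set` Ray T'];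
  iso_MIS : a @` [set` MIS T] = [set` MIS T'];
  iso_BMS : a @` [set` BMS T] = [set` BMS T'];
  iso_meet :
    forall p q, p \in MShat T -> q \in MShat T -> p <> q ->
      (seg_set p `&` seg_set q !=set0 <->
       seg_set (a p) `&` seg_set (a q) !=set0);
  iso_parallel :
    forall p q, p \in MShat T -> q \in MShat T ->
      (horiz p = horiz q <-> horiz (a p) = horiz (a q));
  iso_cor :
    forall p q, p \in MShat T -> q \in MShat T -> horiz p = horiz q ->
      (cor p < cor q <-> cor (a p) < cor (a q))
}.

Definition direction_preserving T (a : segm -> segm) : Prop :=
  forall p, p \in MShat T -> horiz (a p) = horiz p.

(* [vertex_image] and [edge_image] are the graphs of the bijections of vertices
   and of edges induced by a structural isomorphism. *)
Definition vertex_image T (a : segm -> segm) (v v' : R * R) : Prop :=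
  exists p q, [/\ p \in MShat T, q \in MShat T, p <> q,
    seg_set p `&` seg_set q = [set v] &
    seg_set (a p) `&` seg_set (a q) = [set v']].

Definition edge_image T T' (a : segm -> segm) (e e' : segm) : Prop :=
  exists p v (w : R * R),
    [/\ p \in MShat T /\ seg_set e `<=` seg_set p,
        e' \in edges T' /\ seg_set e' `<=` seg_set (a p),
        vertex_image T a (seg_start e) v,
        vertex_image T a (seg_end e) w &
        [set seg_start e'; seg_end e'] = [set v; w]].

Definition structural_class T r T' r' : Prop :=
  [/\ reduced T', smoothness T' r' &
    exists a : segm -> segm,
      [/\ structural_iso T T' a, direction_preserving T a &
          forall e, e \in interior_edges T ->
            exists2 e', edge_image T T' a e e' & r' e' = r e]].

Section Splines.
Variables m m' : nat.

(* A matrix [P] stands for the polynomial whose coefficient at [s^i t^j] is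
   [P i j]. *)
Local Notation Rmm := 'M[R]_(m.+1, m'.+1).

(* In [{poly {poly R}}] the outer variable ['X] is [s] and the inner one
   ['X%:P] is [t]. *)
Definition bipoly (P : Rmm) : {poly {poly R}} :=
  \sum_(i < m.+1) \sum_(j < m'.+1) (P i j)%:P%:P * 'X^i * ('X^j)%:P.

Definition line_poly (e : segm) : {poly {poly R}} :=
  if horiz e then ('X - (cor e)%:P)%:P else 'X - (cor e)%:P%:P.

(* Not the divisibility of [polydiv], which is taken up to a scalar factor from
   the coefficient ring [{poly R}]. *)
Definition bidvd (d P : {poly {poly R}}) : Prop := exists Q, P = Q * d.

Definition line_power r (e : segm) : {poly {poly R}} :=
  line_poly e ^+ `|(r e + 1)%R|%N.

Definition edge_ideal r (e : segm) : {vspace Rmm} :=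
  vspace_of [set P | bidvd (line_power r e) (bipoly P)].

Definition vertex_ideal T r (v : R * R) : {vspace Rmm} :=
  (\sum_(e <- interior_edges T | `[< seg_set e v >]) edge_ideal r e)%VS.

Definition is_spline T r (f : {ffun cells T -> Rmm}) : Prop :=
  forall (e : segm) (c c' : cells T), e \in interior_edges T -> c <> c' ->
    seg_set e `<=` rect_set (val c) -> seg_set e `<=` rect_set (val c') ->
    bidvd (line_power r e) (bipoly (f c) - bipoly (f c')).

Definition spline_space T r : {vspace {ffun cells T -> Rmm}} :=
  vspace_of [set f | is_spline r f].

Lemma bipolyP (x : R) (P Q : Rmm) :
  bipoly (x *: P + Q) = x%:P%:P * bipoly P + bipoly Q.
Proof.
rewrite /bipoly mulr_sumr -big_split; apply: eq_bigr => i _ /=.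
rewrite mulr_sumr -big_split; apply: eq_bigr => j _ /=.
by rewrite !mxE !polyCD !polyCM !mulrDl !mulrA.
Qed.

Lemma bipoly0 : bipoly 0 = 0.
Proof.
by rewrite /bipoly big1 // => i _; rewrite big1 // => j _;
  rewrite mxE !mul0r.
Qed.

Lemma mem_edge_ideal r e P :
  P \in edge_ideal r e <-> bidvd (line_power r e) (bipoly P).
Proof.
rewrite mem_vspace_of //=; first by exists 0; rewrite bipoly0 mul0r.
move=> x u v [Q Qu] [S Sv]; exists (x%:P%:P * Q + S).
by rewrite bipolyP Qu Sv mulrDl mulrA.
Qed.

Lemma mem_spline_space T r f : f \in spline_space T r <-> is_spline r f.
Proof.
rewrite mem_vspace_of //=.
  by move=> e c c' _ _ _ _; exists 0; rewrite !ffunE subrr mul0r.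
move=> x f1 f2 H1 H2 e c c' ei cc ec ec'.
have [Q Qu] := H1 _ _ _ ei cc ec ec'; have [S Sv] := H2 _ _ _ ei cc ec ec'.
exists (x%:P%:P * Q + S); rewrite !ffunE !bipolyP mulrDl -mulrA -Qu -Sv.
by rewrite mulrBr opprD addrACA.
Qed.

Definition quotient_dim (I : {vspace Rmm}) : int :=
  (\dim {: Rmm})%:Z - (\dim I)%:Z.

Definition euler_char T r : int :=
  \sum_(c <- cells T) (\dim {: Rmm})%:Z
  - \sum_(e <- interior_edges T) quotient_dim (edge_ideal r e)
  + \sum_(v <- interior_vertices T) quotient_dim (vertex_ideal T r v).

Definition dimensionally_stable T r : Prop :=
  forall T' r', structural_class T r T' r' ->
    \dim (spline_space T' r') = \dim (spline_space T r).

Definition mu_h T r v : int := Num.max (m%:Z - r_h T r v) 0.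
Definition mu_v T r v : int := Num.max (m'%:Z - r_v T r v) 0.

(* A deletion state is given by its first component [A], the second one being
   [MIS T `\` A]. *)
Definition mono T A (p : segm) : {fset (R * R)} :=
  [fset v in vertices T |
    `[< seg_set p v /\
        forall q, q \in MIS T -> q \in A -> q <> p -> ~ seg_set q v >]]%fset.

Definition weight T r A (p : segm) : int :=
  \sum_(v <- mono T A p) (if horiz p then mu_h T r v else mu_v T r v).

Definition threshold (p : segm) : int := if horiz p then m.+1 else m'.+1.

Definition diagonalizable T r A (p : segm) : bool :=
  threshold p <= weight T r A p.

Definition deletion_pass T r A : {fset segm} :=
  (A `\` [fset p in A | diagonalizable T r A p])%fset.

(* Every pass but the last one removes a segment, so that the process has
   stopped after [#|` MIS T|] passes, see [deletion_pass_CNDC]. *)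
Definition CNDC T r : {fset segm} :=
  iter #|` MIS T| (deletion_pass T r) (MIS T).

Lemma deletion_pass_CNDC T r : deletion_pass T r (CNDC T r) = CNDC T r.
Proof.
have sub A : (deletion_pass T r A `<=` A)%fset by exact: fsubsetDl.
have key n : deletion_pass T r (iter n (deletion_pass T r) (MIS T)) =
    iter n (deletion_pass T r) (MIS T) \/
    (#|` iter n (deletion_pass T r) (MIS T)| + n <= #|` MIS T|)%N.
  elim: n => [|n [IH|IH]]; first by right; rewrite addn0.
    by left; rewrite iterS !IH.
  set B := iter n _ _ in IH *; rewrite iterS -/B.
  have [E|NE] := eqVneq (deletion_pass T r B) B; first by left; rewrite !E.
  right; rewrite addnS; apply: leq_trans IH; rewrite ltn_add2r.
  by apply: fproper_ltn_card; rewrite fproperEneq NE sub.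
case: (key #|` MIS T|) => // H.
have /eqP E : #|` CNDC T r| == 0%N by rewrite /CNDC; move: H; lia.
by move/cardfs0_eq: E => ->; rewrite /deletion_pass fset0D.
Qed.

End Splines.
End Plane.

(* Main.v *)
(* A spline is a family of polynomials, one for each cell, whose jump across each
   interior edge lies in the ideal of that edge. The complex of constant
   coefficients from cells to interior edges to interior vertices is exact, so
   that the difference of the dimension and of the Euler characteristic is the
   dimension of the cokernel of the map from the ideals of the edges to those of
   the vertices. The exactness is seen as follows. A reentrant corner of the
   domain would be a common end of an interior and of a boundary maximal segment,
   so a reduced T-mesh has none; hence the interior of the domain is stable under
   moving to the left and downwards as long as the smallest abscissa and ordinate
   are not reached, and the domain has only one lower left corner. Counting cells
   at their lower left corner and edges at their start then gives Euler's formula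
   F - E + V = 1, which together with the connectedness of the interior and the
   surjectivity onto the vertices gives exactness by a dimension count.

   A functional vanishing on the image of the ideals of the edges is constant
   along each maximal segment, on the ideal of this segment. So it vanishes there
   if the segment reaches the boundary of the domain, or if the transversal
   segments through some of its vertices have already been dealt with and
   their ideals cover its own. By apolarity of univariate polynomials, the latter
   is what the diagonalizability of the segment means. If the weighted CNDC is
   empty, all the segments are reached in this way and the cokernel is zero. The
   deletion order and all the dimensions are preserved by structural
   isomorphisms, because the dimensions of ideals are invariant by translation. *)
From HB Require Import structures.
Require Import Defs.
From mathcomp Require Import all_boot all_order all_algebra finmap zify.
From mathcomp Require Import all_classical all_reals topology normedtype.
Import Order.TTheory GRing.Theory Num.Theory numFieldNormedType.Exports.

Set Implicit Arguments.
Unset Strict Implicit.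
Unset Printing Implicit Defensive.

Local Open Scope classical_set_scope.
Local Open Scope ring_scope.

(** * Dimension count in an exact complex *)

Section Products.
Variables (K : fieldType) (vT : vectType K) (I : finType).

Definition single (i : I) (P : vT) : {ffun I -> vT} := [ffun j => if j == i then P else 0].

Fact single_is_linear i : linear (single i).
Proof.
move=> a P Q; apply/ffunP => j; rewrite !ffunE.
by case: ifP => // _; rewrite scaler0 addr0.
Qed.
HB.instance Definition _ i := GRing.isLinear.Build K vT {ffun I -> vT} _ (single i)
  (single_is_linear i).

Lemma single_sum (z : {ffun I -> vT}) : z = \sum_i single i (z i).
Proof.
apply/ffunP => j; rewrite sum_ffunE (bigD1 j) //= big1 ?addr0 => [|i ne].
  by rewrite ffunE eqxx.
by rewrite ffunE eq_sym (negPf ne).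
Qed.

Definition prodv (A : I -> {vspace vT}) : {vspace {ffun I -> vT}} :=
  vspace_of [set z : {ffun I -> vT} | forall i, z i \in A i].

Lemma mem_prodv (A : I -> {vspace vT}) z : z \in prodv A <-> forall i, z i \in A i.
Proof.
rewrite mem_vspace_of //=; first by move=> i; rewrite ffunE mem0v.
by move=> a u v Hu Hv i; rewrite !ffunE memvD // memvZ.
Qed.

Lemma single_prodv (A : I -> {vspace vT}) i P : P \in A i -> single i P \in prodv A.
Proof.
move=> PA; apply/mem_prodv => j; rewrite ffunE.
by case: eqVneq => [->|_] //; rewrite mem0v.
Qed.

Lemma dim_prodv (A : I -> {vspace vT}) : \dim (prodv A) = (\sum_i \dim (A i))%N.
Proof.
have lin i P : linfun (single i) P = single i P by rewrite lfunE.
have -> : prodv A = (\sum_i (linfun (single i) @: A i))%VS.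
  apply/vspaceP => z; apply/idP/idP => [/mem_prodv H|/memv_sumP[y yA ->]].
    rewrite [z]single_sum; apply: memv_suml => i _.
    by rewrite (subvP (sumv_sup i _ (subvv _))) // -lin memv_img.
  apply: memv_suml => i _; have /memv_imgP[P PA ->] := yA i isT.
  by rewrite lin single_prodv.
have D : directv (\sum_i (linfun (single i) @: A i)).
  apply/directv_sum_independent => u uA E i _.
  have /fin_all_exists2[P PA uP] j : exists2 P, P \in A j & u j = single j P.
    by have /memv_imgP[P PA ->] := uA j isT; exists P; rewrite ?lin.
  rewrite uP; have := congr1 (fun z : {ffun I -> vT} => z i) E.
  rewrite sum_ffunE (bigD1 i) //= big1 ?addr0 => [|j ne].
    by rewrite uP !ffunE eqxx => ->; exact: linear0.
  by rewrite uP ffunE eq_sym (negPf ne).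
rewrite (directvP D) /=; apply: eq_bigr => i _; apply: limg_dim_eq.
apply/eqP; rewrite -subv0; apply/subvP => P /memv_capP[_].
rewrite memv_ker lin memv0 => /eqP/ffunP/(_ i).
by rewrite !ffunE eqxx => ->.
Qed.

Lemma prodv_full : prodv (fun=> fullv) = fullv.
Proof. by apply/vspaceP => z; rewrite memvf; apply/mem_prodv => i; rewrite memvf. Qed.

Lemma dim_ffun : \dim {: {ffun I -> vT}} = (#|I| * \dim {: vT})%N.
Proof. by rewrite -prodv_full dim_prodv sum_nat_const. Qed.

End Products.

(** * The complex with constant coefficients, for abstract finite sets of cells, edges and
    vertices *)

Section Complex.
Variables (K : fieldType) (vT : vectType K) (C E V : finType).
Variables (up dn : E -> C) (d : V -> E -> K).

Definition jump_map (f : {ffun C -> vT}) : {ffun E -> vT} :=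
  [ffun e => f (up e) - f (dn e)].

Fact jump_map_is_linear : linear jump_map.
Proof.
by move=> a f g; apply/ffunP => e; rewrite !ffunE scalerBr opprD addrACA.
Qed.
HB.instance Definition _ := GRing.isLinear.Build K {ffun C -> vT} {ffun E -> vT} _
  jump_map jump_map_is_linear.

Definition bd_map (z : {ffun E -> vT}) : {ffun V -> vT} :=
  [ffun v => \sum_e d v e *: z e].

Fact bd_map_is_linear : linear bd_map.
Proof.
move=> a f g; apply/ffunP => v; rewrite !ffunE scaler_sumr -big_split.
by apply: eq_bigr => e _; rewrite !ffunE scalerDr !scalerA [d v e * a]mulrC.
Qed.
HB.instance Definition _ := GRing.isLinear.Build K {ffun E -> vT} {ffun V -> vT} _
  bd_map bd_map_is_linear.

Definition eval_at (c : C) (f : {ffun C -> vT}) : vT := f c.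

Fact eval_at_is_linear c : linear (eval_at c).
Proof. by move=> a f g; rewrite /eval_at !ffunE. Qed.
HB.instance Definition _ c := GRing.isLinear.Build K {ffun C -> vT} vT _
  (eval_at c) (eval_at_is_linear c).

Let J := linfun jump_map.
Let D := linfun bd_map.

Lemma bd_single e (P : vT) : bd_map (single e P) = \sum_v single v (d v e *: P).
Proof.
rewrite [LHS]single_sum; apply: eq_bigr => v _; congr (single v _); rewrite ffunE.
rewrite (bigD1 e) //= big1 ?addr0 => [|e' ne]; first by rewrite ffunE eqxx.
by rewrite ffunE (negPf ne) scaler0.
Qed.

(** The coordinates of [u - projv X u] are functionals of [u] that vanish on [X]; by hypothesis they
    vanish at [u], which therefore equals its projection. *)
Lemma functional_sub (vV : vectType K) (U X : {vspace vV}) :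
  (forall l : vV -> K, (forall a u v, l (a *: u + v) = a * l u + l v) ->
     (forall x, x \in X -> l x = 0) -> forall u, u \in U -> l u = 0) ->
  (U <= X)%VS.
Proof.
move=> H; apply/subvP => u uU.
suff /eqP : u - projv X u = 0 by rewrite subr_eq0 => /eqP ->; exact: memv_proj.
rewrite (coord_vbasis (memvf (u - projv X u))) big1 // => i _.
rewrite (H (fun w => coord (vbasis fullv) i (w - projv X w))) ?scale0r //.
  move=> a v w; rewrite linearP /= -[in RHS](linearP (coord (vbasis fullv) i)) /=.
  by rewrite scalerBr opprD addrACA.
by move=> x xX; rewrite projv_id // subrr linear0.
Qed.

(** Dual criterion: a functional on the families is a collection [l v] of functionals on [vT], and
    testing it on the images of the generators [single e P] gives the sum condition. *)
Lemma bd_map_surj (I : E -> {vspace vT}) (W : V -> {vspace vT}) :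
  (forall e P, P \in I e -> forall v, d v e *: P \in W v) ->
  (forall l : V -> vT -> K, (forall v a P Q, l v (a *: P + Q) = a * l v P + l v Q) ->
     (forall e P, P \in I e -> \sum_v d v e * l v P = 0) ->
     forall v P, P \in W v -> l v P = 0) ->
  (D @: prodv I)%VS = prodv W.
Proof.
move=> IW H; apply: subv_anti; apply/andP; split.
  apply/subvP => _ /memv_imgP[z zI ->]; rewrite lfunE; apply/mem_prodv => v /=.
  by rewrite ffunE memv_suml // => e _; apply: IW; move/mem_prodv: zI; apply.
apply: functional_sub => l linl lX z zW.
have l0 : l 0 = 0 by have := linl (-1) 0 0; rewrite scaler0 addr0 mulN1r addNr.
have lsum (A : finType) (G : A -> {ffun V -> vT}) : l (\sum_i G i) = \sum_i l (G i).
  apply: (big_morph l) => // x y; have := linl 1 x y.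
  by rewrite scale1r mul1r.
have lZ a x : l (a *: x) = a * l x by have := linl a x 0; rewrite !addr0 l0 addr0.
rewrite [z]single_sum lsum big1 // => v _.
apply: (H (fun v P => l (single v P))); last by move/mem_prodv: zW; apply.
  by move=> w a P Q; rewrite linearP linl.
move=> e P PI; have := lX (bd_map (single e P)).
rewrite bd_single lsum => {2}<-.
  by apply: eq_bigr => w _; rewrite linearZ lZ.
by rewrite -bd_single -[bd_map _](lfunE bd_map) memv_img // single_prodv.
Qed.

(** The count of cells, edges and vertices forces exactness in the middle. Splines are then the
    preimages under [J] of the cycles with coefficients in the [I e], and rank-nullity for [J] and
    [D] gives the formula. *)
Lemma dim_splines (I : E -> {vspace vT}) (W : V -> {vspace vT})
    (S : {vspace {ffun C -> vT}}) :
  (#|C| > 0)%N -> (#|C| + #|V| = #|E| + 1)%N ->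
  (forall f : {ffun C -> vT}, (forall e, f (up e) = f (dn e)) -> forall c c', f c = f c') ->
  (forall f : {ffun C -> vT}, bd_map (jump_map f) = 0) ->
  (D @: fullv)%VS = fullv -> (D @: prodv I)%VS = prodv W ->
  (forall f, f \in S <-> forall e, f (up e) - f (dn e) \in I e) ->
  (\dim S + \sum_v \dim (W v) = \dim {: vT} + \sum_e \dim (I e))%N.
Proof.
move=> C0 eul conn DJ D1 DI SP; set N := \dim {: vT}.
have /card_gt0P[c0 _] := C0.
have JE f : J f = jump_map f by rewrite lfunE.
have DE z : D z = bd_map z by rewrite lfunE.
(* Evaluation at [c0] is an isomorphism from the kernel of [J], the constant families, onto [vT]. *)
have kerJ : \dim (lker J) = N.
  have hE f : linfun (eval_at c0) f = f c0 by rewrite lfunE.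
  rewrite -(@limg_dim_eq _ _ _ (linfun (eval_at c0)) (lker J)).
    congr (\dim _); apply/vspaceP => P; rewrite memvf; apply/memv_imgP.
    exists [ffun=> P]; last by rewrite hE ffunE.
    by rewrite memv_ker JE; apply/eqP/ffunP => e; rewrite !ffunE subrr.
  apply/eqP; rewrite -subv0; apply/subvP => f /memv_capP[].
  rewrite !memv_ker JE hE memv0 => /eqP Jf /eqP f0; apply/eqP/ffunP => c.
  rewrite (conn f _ c c0) ?f0 ?ffunE // => e.
  have := congr1 (fun z : {ffun E -> vT} => z e) Jf.
  by rewrite !ffunE => /eqP; rewrite subr_eq0 => /eqP.
have imJ : limg J = lker D.
  apply/eqP; rewrite eqEdim; apply/andP; split.
    by apply/subvP => _ /memv_imgP[f _ ->]; rewrite memv_ker DE JE DJ.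
  (* Both dimensions are [#|C| * N - N = #|E| * N - #|V| * N]. *)
  have := limg_ker_dim J fullv; have := limg_ker_dim D fullv.
  rewrite !capfv D1 kerJ !dim_ffun -/N; have := congr1 (muln^~ N) eul.
  by rewrite /= !mulnDl mul1n; lia.
have := limg_ker_dim J S; have := limg_ker_dim D (prodv I); rewrite DI !dim_prodv.
have -> : (S :&: lker J)%VS = lker J.
  apply/capv_idPr/subvP => f; rewrite memv_ker JE => /eqP/ffunP H; apply/SP => e.
  by have := H e; rewrite !ffunE => ->; exact: mem0v.
(* Exactness provides a preimage under [J] of each cycle in the ideals; it is a spline by [SP]. *)
have -> : (J @: S)%VS = (prodv I :&: lker D)%VS.
  apply/vspaceP => z; apply/memv_imgP/memv_capP.
    move=> [f /SP fS ->]; split; last by rewrite -imJ memv_img ?memvf.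
    by apply/mem_prodv => e; rewrite JE ffunE.
  move=> [/mem_prodv zI]; rewrite -imJ => /memv_imgP[f _ E']; exists f => //.
  by apply/SP => e; have := zI e; rewrite E' JE ffunE.
by move=> <- <-; rewrite kerJ addnA.
Qed.

End Complex.

(** * Apolarity and ideals of lines *)

Section Apolar.
Variables (F : numFieldType) (L : {poly F} -> F) (m : nat).
Hypothesis linL : forall a p q, L (a *: p + q) = a * L p + L q.

Lemma functional0 : L 0 = 0.
Proof. by have := linL (-1) 0 0; rewrite scaler0 addr0 mulN1r addNr. Qed.

Lemma functionalZ a p : L (a *: p) = a * L p.
Proof. by have := linL a p 0; rewrite !addr0 functional0 addr0. Qed.

Lemma functional_sum (I : Type) (s : seq I) (G : I -> {poly F}) :
  L (\sum_(i <- s) G i) = \sum_(i <- s) L (G i).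
Proof.
apply: (big_morph L); last exact: functional0.
by move=> p q; have := linL 1 p q; rewrite scale1r mul1r.
Qed.

(* The polynomial [L ((X - Y) ^ m)] in [Y], where [L] acts on the variable [X]. *)
Definition apolar : {poly F} := map_poly L (('X%:P - 'X) ^+ m).

(** Binomial expansion of [(X - Y) ^ m] written as [((X - x) - (Y - x)) ^ m]. *)
Lemma apolarE x : apolar = \sum_(i < m.+1)
  ((-1) ^+ i * L (('X - x%:P) ^+ (m - i)) *+ 'C(m, i)) *: ('X - x%:P) ^+ i.
Proof.
have E : ('X%:P - 'X : {poly {poly F}}) = ('X - x%:P)%:P - map_poly polyC ('X - x%:P).
  by rewrite map_polyXsubC polyCB opprB addrA subrK.
rewrite /apolar E; apply/polyP => j.
rewrite coef_map_id0 ?functional0 // exprBn !coef_sum functional_sum.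
apply: eq_bigr => i _; rewrite -polyC_exp -rmorphXn /= coefMn coefZ.
have sg (K : nzRingType) : (-1) ^+ i = ((-1) ^+ i)%:P :> {poly K}.
  by rewrite polyC_exp polyCN.
rewrite sg -polyCM coefCM coef_map /= sg -!mulrnAl -mulrA mulrnAl -mulrA.
rewrite [_ ^+ _ * _%:P]mulrC !mul_polyC scalerA scalerMnl functionalZ.
by rewrite -mulrnAl -mulrA [L _ * _]mulrC.
Qed.

(** In the expansion at [x], the coefficient of [(Y - x) ^ i] contains [L ((X - x) ^ (m - i))],
    which is zero when [k <= m - i]. *)
Lemma apolar_dvdp (x : F) k :
  (forall p : {poly F}, (size p <= m.+1)%N -> ('X - x%:P) ^+ k %| p -> L p = 0) ->
  ('X - x%:P) ^+ (m.+1 - k) %| apolar.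
Proof.
move=> Lk; rewrite (apolarE x); apply: (big_ind (fun p => _ %| p)).
- exact: dvdp0.
- by move=> p q; exact: dvdp_add.
move=> i _; have [le|lt] := leqP k (m - i).
  rewrite Lk ?mulr0 ?mul0rn ?scale0r ?dvdp0 //; last exact: dvdp_exp2l.
  by rewrite size_exp_XsubC ltnS leq_subr.
by rewrite -mul_polyC; apply/dvdp_mull/dvdp_exp2l; have := ltn_ord i; lia.
Qed.

Lemma size_apolar : (size apolar <= m.+1)%N.
Proof.
apply/leq_sizeP => j lt; rewrite (apolarE 0) coef_sum big1 // => i _.
by rewrite polyC0 subr0 coefZ coefXn gtn_eqF ?mulr0 // (leq_trans (ltn_ord i)).
Qed.

(** In characteristic zero the binomial coefficients are invertible, so the coefficients of [apolar]
    determine [L] on the monomials of degree at most [m]. *)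
Lemma apolar0 (p : {poly F}) : apolar = 0 -> (size p <= m.+1)%N -> L p = 0.
Proof.
move=> q0 sp.
have LX j : (j <= m)%N -> L 'X^j = 0.
  move=> jm; have lt : (m - j < m.+1)%N by rewrite ltnS leq_subr.
  have := coef0 F (m - j); rewrite -q0 (apolarE 0) coef_sum.
  rewrite (bigD1 (Ordinal lt)) //= big1 ?addr0 => [|i].
    rewrite coefZ polyC0 subr0 coefXn eqxx mulr1 subKn // => /eqP.
    rewrite mulrn_eq0 mulf_eq0 signr_eq0 /= => /orP[|/eqP //].
    by rewrite -leqn0 leqNgt bin_gt0 leq_subr.
  rewrite -val_eqE /= => ne.
  by rewrite coefZ polyC0 subr0 coefXn eq_sym (negPf ne) mulr0.
rewrite -(coefK p) poly_def functional_sum big1 // => i _.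
by rewrite functionalZ LX ?mulr0 // -ltnS (leq_trans (ltn_ord i)).
Qed.

Lemma XsubC_prod_dvdp (s : seq (F * nat)) (a : F * nat -> nat) (q : {poly F}) :
  uniq [seq xk.1 | xk <- s] ->
  (forall xk, xk \in s -> ('X - xk.1%:P) ^+ a xk %| q) ->
  \prod_(xk <- s) ('X - xk.1%:P) ^+ a xk %| q.
Proof.
elim: s => [|z s IH] /=; first by rewrite big_nil dvd1p.
move=> /andP[zs us] H; rewrite big_cons Gauss_dvdp.
  rewrite H ?mem_head //=; apply: IH => // w ws; apply: H; by rewrite inE ws orbT.
apply: coprimep_expl; rewrite coprimep_sym coprimep_XsubC rootE horner_prod.
rewrite prodf_seq_neq0; apply/allP => w ws /=; rewrite hornerE expf_neq0 //.
rewrite !hornerE subr_eq0; apply: contraNneq zs => ->; exact: map_f.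
Qed.

(* By apolarity, functionals vanishing on the polynomials with given zeros
   correspond to polynomials [apolar] with zeros of the dual multiplicity. *)
Lemma functional_eq0 (s : seq (F * nat)) :
  uniq [seq xk.1 | xk <- s] ->
  (forall xk, xk \in s -> forall p : {poly F}, (size p <= m.+1)%N ->
     ('X - xk.1%:P) ^+ xk.2 %| p -> L p = 0) ->
  (m.+1 <= \sum_(xk <- s) (m.+1 - xk.2))%N ->
  forall p : {poly F}, (size p <= m.+1)%N -> L p = 0.
Proof.
move=> us Ls le p sp; apply: apolar0 sp; apply/eqP; apply: contraLR le => q0.
(* A nonzero [apolar] has degree at most [m], which bounds the degree of the product dividing it. *)
rewrite -ltnNge ltnS; have D : \prod_(xk <- s) ('X - xk.1%:P) ^+ (m.+1 - xk.2) %| apolar.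
  by apply: XsubC_prod_dvdp us _ => xk /Ls; exact: apolar_dvdp.
have := leq_trans (dvdp_leq q0 D) size_apolar.
rewrite size_prod_seq; last by move=> xk _; rewrite expf_neq0 // polyXsubC_eq0.
have -> : (\sum_(xk <- s) size (('X - xk.1%:P) ^+ (m.+1 - xk.2)) =
    size s + \sum_(xk <- s) (m.+1 - xk.2))%N.
  by rewrite -sum1_size -big_split; apply: eq_bigr => xk _; rewrite size_exp_XsubC.
by rewrite -addnS addKn ltnS.
Qed.

End Apolar.

(** * Ideals generated by powers of axis-parallel lines *)

Section Ideals.
Variable R : realType.
Implicit Types (m n k : nat) (b : bool) (x y a : R).

Lemma rVpoly_sum n (v : 'rV[R]_n) : rVpoly v = \sum_(i < n) v 0 i *: 'X^i.
Proof. by rewrite [LHS]poly_def; apply: eq_bigr => i _; rewrite valK. Qed.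

Lemma bipolyE m m' (P : 'M[R]_(m.+1, m'.+1)) :
  bipoly P = \sum_(i < m.+1) (rVpoly (row i P))%:P * 'X^i.
Proof.
apply: eq_bigr => i _; rewrite rVpoly_sum rmorph_sum mulr_suml.
apply: eq_bigr => j _; rewrite mxE -mul_polyC rmorphM /= -!mulrA; congr (_ * _).
exact: mulrC.
Qed.

Lemma coef_bipoly m m' (P : 'M[R]_(m.+1, m'.+1)) (i : 'I_m.+1) :
  (bipoly P)`_i = rVpoly (row i P).
Proof.
rewrite bipolyE coef_sum (bigD1 i) //= big1 ?addr0 => [|j ne].
  by rewrite coefCM coefXn eqxx mulr1.
by rewrite coefCM coefXn eq_sym val_eqE (negPf ne) mulr0.
Qed.

Lemma swapXY_bipoly m m' (P : 'M[R]_(m.+1, m'.+1)) : swapXY (bipoly P) = bipoly P^T.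
Proof.
rewrite /bipoly raddf_sum exchange_big; apply: eq_bigr => i _ /=.
rewrite raddf_sum; apply: eq_bigr => j _.
rewrite -[LHS]/(swapXY (_ * _ * _)) !rmorphM /= rmorphXn /= swapXY_X !swapXY_polyC map_polyC map_polyXn mxE.
by rewrite mulrAC polyC_exp.
Qed.

Lemma bidvd_swap (d P : {poly {poly R}}) : bidvd d P <-> bidvd (swapXY d) (swapXY P).
Proof.
split=> -[Q E]; exists (swapXY Q); first by rewrite E rmorphM.
by rewrite -[P]swapXYK E rmorphM /= swapXYK.
Qed.

(** [edge_ideal] depends only on the direction, the line and the exponent: the smoothness [k - 1]
    yields the exponent [k], and the extent [0 0] of the segment is a dummy. *)
Definition line_ideal m m' b x k : {vspace 'M[R]_(m.+1, m'.+1)} :=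
  edge_ideal m m' (fun=> k%:Z - 1) (Segm b x 0 0).

Lemma edge_idealE m m' (r : segm R -> int) (e : segm R) :
  edge_ideal m m' r e = line_ideal m m' (horiz e) (cor e) `|(r e + 1)%R|%N.
Proof. by rewrite /line_ideal /edge_ideal /line_power subrK. Qed.

(** The polynomial [t - y] is a constant for the outer variable [s], so divisibility is tested on
    each coefficient in [s], that is on each row. *)
Lemma mem_line_idealT m m' y k (P : 'M[R]_(m.+1, m'.+1)) :
  P \in line_ideal m m' true y k <->
  forall i, ('X - y%:P) ^+ k %| rVpoly (row i P).
Proof.
rewrite mem_edge_ideal /line_power subrK /line_poly /= -polyC_exp; split.
  move=> [Q E] i; apply/dvdpP; exists Q`_i.
  by rewrite -coef_bipoly E coefMC.
move=> H; have /fin_all_exists[q qP] i : exists q, rVpoly (row i P) = q * ('X - y%:P) ^+ k.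
  exact/dvdpP.
exists (\sum_(i < m.+1) (q i)%:P * 'X^i); rewrite bipolyE mulr_suml.
by apply: eq_bigr => i _; rewrite qP polyCM mulrAC.
Qed.

Lemma mem_line_idealF m m' x k (P : 'M[R]_(m.+1, m'.+1)) :
  P \in line_ideal m m' false x k <->
  forall j, ('X - x%:P) ^+ k %| rVpoly (row j P^T).
Proof.
rewrite -mem_line_idealT !mem_edge_ideal bidvd_swap swapXY_bipoly.
suff -> : swapXY (line_power (fun=> k%:Z - 1) (Segm false x 0 0)) =
  line_power (fun=> k%:Z - 1) (Segm true x 0 0) by [].
rewrite /line_power /line_poly rmorphXn /= rmorphB /= swapXY_X swapXY_polyC.
by rewrite map_polyC polyCB.
Qed.

Lemma rVpoly_mul n p (u : 'rV[R]_n) (B : 'M_(n, p)) :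
  rVpoly (u *m B) = \sum_i u 0 i *: rVpoly (row i B).
Proof.
by rewrite mulmx_sum_row linear_sum; apply: eq_bigr => i _; rewrite linearZ.
Qed.

Lemma mulmx_line_ideal m m' y k (A : 'M[R]_m.+1) (P : 'M[R]_(m.+1, m'.+1)) :
  P \in line_ideal m m' true y k -> A *m P \in line_ideal m m' true y k.
Proof.
move=> /mem_line_idealT H; apply/mem_line_idealT => i; rewrite row_mul rVpoly_mul.
apply: (big_ind (fun p => _ %| p)); first exact: dvdp0.
  by move=> p q; exact: dvdp_add.
by move=> j _; rewrite -mul_polyC dvdp_mull.
Qed.

Definition shift_mx n a : 'M[R]_n := \matrix_(i < n) poly_rV (('X + a%:P) ^+ i).

Lemma rVpoly_shift n a (v : 'rV[R]_n) :
  rVpoly (v *m shift_mx n a) = rVpoly v \Po ('X + a%:P).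
Proof.
rewrite rVpoly_mul rVpoly_sum raddf_sum; apply: eq_bigr => i _ /=.
rewrite linearZ /= comp_Xn_poly rowK poly_rV_K // -[a]opprK polyCN.
by rewrite size_exp_XsubC.
Qed.

Lemma shift_mx_inj n a p (P : 'M[R]_(p, n)) : P *m shift_mx n a = 0 -> P = 0.
Proof.
move=> E; apply/row_matrixP => i; apply: (can_inj (@rVpolyK R n)).
have : rVpoly (row i P *m shift_mx n a) = 0 by rewrite -row_mul E row0 linear0.
rewrite rVpoly_shift row0 linear0 => /eqP.
by rewrite comp_poly2_eq0 ?size_XaddC // => /eqP.
Qed.

Lemma shift_mx_ideal m m' y k a (P : 'M[R]_(m.+1, m'.+1)) :
  P \in line_ideal m m' true y k ->
  P *m shift_mx m'.+1 a \in line_ideal m m' true (y - a) k.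
Proof.
move=> /mem_line_idealT H; apply/mem_line_idealT => i.
rewrite row_mul rVpoly_shift; have /dvdpP[q ->] := H i.
rewrite comp_polyM rmorphXn /= comp_polyB comp_polyX comp_polyC dvdp_mull //.
by rewrite polyCB opprB addrA.
Qed.

Lemma trmx_line_ideal m m' b y k (P : 'M[R]_(m.+1, m'.+1)) :
  P \in line_ideal m m' b y k -> P^T \in line_ideal m' m (~~ b) y k.
Proof.
case: b => H /=; last exact/mem_line_idealT/mem_line_idealF.
by apply/mem_line_idealF; rewrite trmxK; exact/mem_line_idealT.
Qed.

(** Coefficient matrix of the polynomial [P (s + x, t + y)]. *)
Definition translate m m' x y (P : 'M[R]_(m.+1, m'.+1)) : 'M[R]_(m.+1, m'.+1) :=
  (shift_mx m.+1 x)^T *m P *m shift_mx m'.+1 y.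

Lemma translateD m m' x y (P Q : 'M[R]_(m.+1, m'.+1)) :
  translate x y (P + Q) = translate x y P + translate x y Q.
Proof. by rewrite /translate mulmxDr mulmxDl. Qed.

Lemma translate_inj m m' x y (P : 'M[R]_(m.+1, m'.+1)) : translate x y P = 0 -> P = 0.
Proof.
move=> /shift_mx_inj /(congr1 trmx); rewrite trmx_mul trmxK trmx0 => /shift_mx_inj.
by move=> /(congr1 trmx); rewrite trmxK trmx0.
Qed.

Lemma translate_ideal m m' b x y z k (P : 'M[R]_(m.+1, m'.+1)) :
  P \in line_ideal m m' b z k ->
  translate x y P \in line_ideal m m' b (z - if b then y else x) k.
Proof.
case: b => H /=; first by apply: shift_mx_ideal; exact: mulmx_line_ideal.
rewrite -[translate x y P]trmxK; apply: (@trmx_line_ideal _ _ true).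
rewrite trmx_mul; apply: mulmx_line_ideal; rewrite trmx_mul trmxK.
by apply: shift_mx_ideal; exact: trmx_line_ideal H.
Qed.

Lemma dim_translate m m' x y (U V : {vspace 'M[R]_(m.+1, m'.+1)}) :
  (forall P, P \in U -> translate x y P \in V) -> (\dim U <= \dim V)%N.
Proof.
move=> UV; pose f := linfun (mulmxr (shift_mx m'.+1 y) \o mulmx (shift_mx m.+1 x)^T).
have fE P : f P = translate x y P by rewrite lfunE.
have f0 : lker f == 0%VS.
  rewrite -subv0; apply/subvP => P; rewrite memv_ker fE memv0 => /eqP.
  by move=> /translate_inj ->.
rewrite -(@limg_dim_eq _ _ _ f) ?(eqP f0) ?capv0 //; apply: dimvS.
by apply/subvP => _ /memv_imgP[P PU ->]; rewrite fE; exact: UV.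
Qed.

(** Translations are injective and carry the ideal of a line into that of any parallel line. *)
Lemma dim_line_ideal m m' b x x' k :
  \dim (line_ideal m m' b x k) = \dim (line_ideal m m' b x' k).
Proof.
suff H z z' : (\dim (line_ideal m m' b z k) <= \dim (line_ideal m m' b z' k))%N.
  by apply/eqP; rewrite eqn_leq; apply/andP; split; exact: H.
apply: (@dim_translate m m' (z - z') (z - z')) => P Pz.
have := translate_ideal (z - z') (z - z') Pz.
by rewrite if_same subKr.
Qed.

(** A single translation moves both lines, the horizontal one by its shift in [t] and the vertical
    one by its shift in [s]. *)
Lemma dim_line_idealD m m' x x' y y' k k' :
  \dim (line_ideal m m' true y k + line_ideal m m' false x k') =
  \dim (line_ideal m m' true y' k + line_ideal m m' false x' k').
Proof.
suff H z z' w w' : (\dim (line_ideal m m' true z k + line_ideal m m' false w k') <=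
    \dim (line_ideal m m' true z' k + line_ideal m m' false w' k'))%N.
  by apply/eqP; rewrite eqn_leq; apply/andP; split; exact: H.
apply: (@dim_translate m m' (w - w') (z - z')) => _ /memv_addP[P Pz [Q Qw ->]].
have P1 := translate_ideal (w - w') (z - z') Pz.
have Q1 := translate_ideal (w - w') (z - z') Qw.
rewrite /= subKr in P1; rewrite /= subKr in Q1.
rewrite translateD; exact: memv_add P1 Q1.
Qed.

Lemma tensor_line_ideal m m' b x k (u : 'rV[R]_m.+1) (w : 'rV[R]_m'.+1) :
  ('X - x%:P) ^+ k %| (if b then rVpoly w else rVpoly u) ->
  u^T *m w \in line_ideal m m' b x k.
Proof.
have K n n' (v : 'rV[R]_n.+1) (v' : 'rV[R]_n'.+1) : ('X - x%:P) ^+ k %| rVpoly v' ->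
    v^T *m v' \in line_ideal n n' true x k.
  move=> D; apply/mem_line_idealT => i; rewrite row_mul rVpoly_mul big_ord1.
  by rewrite -mul_polyC dvdp_mull // row_id.
case: b; first exact: K.
by move=> /K H; rewrite -[_ *m _]trmxK trmx_mul trmxK; apply: (@trmx_line_ideal _ _ true).
Qed.

End Ideals.

(** * Covering the ideal of a line by the ideals of transversal lines *)

Section Cover.
Variable R : realType.

(** [P] is a sum of products of a power of [s] and a row [w] in [t]. For fixed [w], [l] becomes a
    univariate functional of the factor in [s], which vanishes on the multiples of the listed
    powers, and apolarity applies. *)
Lemma ideal_cover (m m' : nat) (b : bool) (x : R) (k : nat) (s : seq (R * nat))
    (l : 'M[R]_(m.+1, m'.+1) -> R) :
  (forall a P Q, l (a *: P + Q) = a * l P + l Q) ->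
  uniq [seq xk.1 | xk <- s] ->
  ((if b then m else m').+1 <= \sum_(xk <- s) ((if b then m else m').+1 - xk.2))%N ->
  (forall xk P, xk \in s -> P \in line_ideal m m' b x k ->
     P \in line_ideal m m' (~~ b) xk.1 xk.2 -> l P = 0) ->
  forall P, P \in line_ideal m m' b x k -> l P = 0.
Proof.
(* Transposition exchanges the two variables. *)
wlog -> : b m m' l / b = true => [wl|].
  case: b; first exact: (wl true m m' l erefl).
  move=> linl us le ls P PI; rewrite -[P]trmxK.
  apply: (wl true m' m (fun P => l P^T) erefl _ us le).
  - by move=> a Q Q'; rewrite linearP linl.
  - move=> xk Q ss Q1 Q2; apply: (ls xk) => //; first exact: (trmx_line_ideal Q1).
    exact: (trmx_line_ideal Q2).
  - exact: (trmx_line_ideal PI).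
move=> linl us le ls P /[dup] PI /mem_line_idealT PT.
have l0 : l 0 = 0 by have := linl (-1) 0 0; rewrite scaler0 addr0 mulN1r addNr.
have -> : P = \sum_i (delta_mx 0 i : 'rV_m.+1)^T *m row i P.
  apply/matrixP => i j; rewrite summxE (bigD1 i) //= big1 ?addr0 => [|i' ne].
    by rewrite mxE big_ord1 !mxE !eqxx mul1r.
  by rewrite mxE big_ord1 !mxE [i == _]eq_sym (negPf ne) andbF mul0r.
rewrite (big_morph l (id1 := 0) (op1 := +%R)) //; last first.
  by move=> Q Q'; have := linl 1 Q Q'; rewrite scale1r mul1r.
apply: big1 => i _; set w := row i P.
pose L p := l ((poly_rV p : 'rV_m.+1)^T *m w).
rewrite -[delta_mx 0 i]rVpolyK -/(L _).
apply: (@functional_eq0 _ L m _ s us _ le); last exact: size_poly.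
  by move=> a p q; rewrite /L linearP /= linearP /= mulmxDl -scalemxAl linl.
move=> xk xs p sp D; apply: (ls xk) => //; apply: tensor_line_ideal => /=; first exact: PT.
by rewrite poly_rV_K.
Qed.

End Cover.

(** * Germs of cells *)

(** These tactics chain the inequalities of the context from the left end, clearing each link used;
    [order] also proves equalities by antisymmetry and exploits contradictory hypotheses. *)
Ltac order_le :=
  match goal with
  | H : is_true (?a <= ?b) |- is_true (?a <= ?b) => exact H
  | H : is_true (?a < ?b) |- is_true (?a <= ?b) => exact (ltW H)
  | |- is_true (?a <= ?a) => exact (lexx a)
  | |- is_true (?a <= _) =>
      match goal with
      | H : is_true (a <= _) |- _ => apply (le_trans H); clear H; order_le
      | H : is_true (a < _) |- _ => apply (le_trans (ltW H)); clear H; order_le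
      end
  end.
Ltac order_lt :=
  match goal with
  | H : is_true (?a < ?b) |- is_true (?a < ?b) => exact H
  | |- is_true (?a < _) =>
      match goal with
      | H : is_true (a < _) |- _ => apply (lt_le_trans H); clear H; order_le
      | H : is_true (a <= _) |- _ => apply (le_lt_trans H); clear H; order_lt
      end
  end.
Ltac order_absurd :=
  match goal with
  | H : is_true (?a < ?b) |- _ =>
      exfalso; cut (is_true (b <= a)); [by rewrite leNgt H | clear H; order_le]
  end.
Ltac split_bounds :=
  repeat match goal with
  | H : is_true (_ && _) |- _ =>
      let H1 := fresh H in let H2 := fresh H in move/andP: H => [H1 H2]
  end.
Ltac order :=
  repeat match goal with |- is_true _ -> _ => let H := fresh in intro H end;
  split_bounds;
  try (match goal with H : ?x = ?y |- _ => is_var y; subst y || (is_var x; subst x) end);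
  repeat match goal with |- is_true (_ && _) => apply/andP; split end;
  match goal with
  | |- is_true (_ <= _) => first [order_le | order_absurd]
  | |- is_true (_ < _) => first [order_lt | order_absurd]
  | |- @eq _ _ _ => apply: le_anti; apply/andP; split; first [order_le | order_absurd]
  | |- _ => order_absurd
  end.

Section Germs.
Variable R : realType.
Implicit Types (b x y : bool) (c : rect R) (e : segm R) (p q : R * R).

(** The boolean [b] selects an axis, so that arguments symmetric in [s] and [t] are made once.
    [coord (horiz e)] varies along the segment [e], and [coord (~~ horiz e)] is constant on it. *)
Definition coord b p : R := if b then p.1 else p.2.
Definition mkpt b (u w : R) : R * R := if b then (u, w) else (w, u).
Definition clo b c : R := if b then smin c else tmin c.
Definition chi b c : R := if b then smax c else tmax c.

Lemma coord_mkpt b u w : coord b (mkpt b u w) = u.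
Proof. by case: b. Qed.

Lemma coordN_mkpt b u w : coord (~~ b) (mkpt b u w) = w.
Proof. by case: b. Qed.

Lemma mkptK b p : mkpt b (coord b p) (coord (~~ b) p) = p.
Proof. by case: b p => -[]. Qed.

Lemma coord_inj b p q :
  coord b p = coord b q -> coord (~~ b) p = coord (~~ b) q -> p = q.
Proof. by move=> h h'; rewrite -(mkptK b p) h h' mkptK. Qed.

Lemma seg_setP e p : seg_set e p <->
  lo e <= coord (horiz e) p <= hi e /\ coord (~~ horiz e) p = cor e.
Proof. by rewrite seg_setE /coord; case: (horiz e). Qed.

Lemma seg_ptE e u : seg_pt e u = mkpt (horiz e) u (cor e).
Proof. by rewrite /seg_pt /mkpt; case: ifP. Qed.

Lemma rect_setP b c p : rect_set c p <->
  clo b c <= coord b p <= chi b c /\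
  clo (~~ b) c <= coord (~~ b) p <= chi (~~ b) c.
Proof.
rewrite /rect_set /= /setX /= !in_itv /=; case: b => //=.
by split=> -[].
Qed.

Lemma rect_setPb c p :
  rect_set c p <-> forall b, clo b c <= coord b p <= chi b c.
Proof. by rewrite (rect_setP true); split=> [[? ?] []|H]; last by split. Qed.

Definition box (l h : R * R) : set (R * R) :=
  [set q | forall b, coord b l < coord b q < coord b h].

Lemma nbhs_box (A : set (R * R)) p :
  nbhs p A <-> exists l h, box l h p /\ box l h `<=` A.
Proof.
split.
  move=> /nbhs_ballP[eps /= e0 H].
  exists (p.1 - eps, p.2 - eps), (p.1 + eps, p.2 + eps); split.
    by move=> b; rewrite /coord; case: b; rewrite /= ltrBlDr !ltrDl !e0.
  have K (z w : R) : z - eps < w < z + eps -> `|z - w| < eps.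
    rewrite distrC ltr_norml => /andP[h1 h2].
    by rewrite ltrBrDr addrC h1 ltrBlDr addrC h2.
  by move=> q qb; apply: H; split; rewrite /ball /= K //; [exact: (qb true)|exact: (qb false)].
move=> [l [h [pb H]]]; have := pb true; have := pb false; rewrite /coord /=.
move=> /andP[h1 h2] /andP[h3 h4]; apply: filterS H _.
pose d := Num.min (Num.min (p.1 - l.1) (h.1 - p.1)) (Num.min (p.2 - l.2) (h.2 - p.2)).
apply/nbhs_ballP; exists d; first by rewrite /= !lt_min !subr_gt0 h1 h2 h3 h4.
have d1 : d <= p.1 - l.1 by rewrite !ge_min lexx.
have d2 : d <= h.1 - p.1 by rewrite !ge_min lexx !orbT.
have d3 : d <= p.2 - l.2 by rewrite !ge_min lexx !orbT.
have d4 : d <= h.2 - p.2 by rewrite !ge_min lexx !orbT.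
have K (z w g k : R) : d <= z - g -> d <= k - z -> `|z - w| < d -> g < w < k.
  move=> k1 k2; rewrite ltr_norml ltrNl opprB => /andP[h5 h6].
  have := lt_le_trans h6 k1; rewrite ltrD2l ltrN2 => ->.
  by have := lt_le_trans h5 k2; rewrite ltrD2r => ->.
move=> q [/= q1 q2] b; rewrite /coord; case: b.
  exact: K d1 d2 q1.
exact: K d3 d4 q2.
Qed.

Lemma interior_box (A : set (R * R)) p :
  A° p <-> exists l h, box l h p /\ box l h `<=` A.
Proof. exact: nbhs_box. Qed.

Lemma closure_box (A : set (R * R)) p :
  closure A p <-> forall l h, box l h p -> exists q, A q /\ box l h q.
Proof.
split=> [H l h bp|H B /nbhs_box[l [h [bp HB]]]].
  have [|q [Aq bq]] := H (box l h); last by exists q.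
  by apply/nbhs_box; exists l, h; split.
by have [q [Aq bq]] := H _ _ bp; exists q; split => //; exact: HB.
Qed.

Lemma between (u v : R) : u < v -> exists w, u < w < v.
Proof. by move=> /midf_lt[h1 h2]; exists ((u + v) / 2); rewrite h1 h2. Qed.

Lemma rect_int c p : (rect_set c)° p <-> forall b, clo b c < coord b p < chi b c.
Proof.
rewrite interior_box; split=> [[l [h [pb H]]] b|H].
  have /andP[/between[u u1] /between[v v1]] := pb b; have vb := pb (~~ b).
  have K w : coord b l < w < coord b h ->
      clo b c <= w <= chi b c.
    move=> hw; have /H/(rect_setP b)[] : box l h (mkpt b w (coord (~~ b) p)).
      by move=> b'; case: b' b hw {pb u1 v1} vb => -[] //=.
    by rewrite coord_mkpt.
  have hu : coord b l < u < coord b h by order.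
  have hv : coord b l < v < coord b h by order.
  by move: (K _ hu) (K _ hv) => ku kv; order.
exists (mkpt true (smin c) (tmin c)), (mkpt true (smax c) (tmax c)); split.
  by move=> b; have := H b; case: b.
move=> q qb; apply/rect_setPb => b; have := qb b.
by case: b => /andP[h1 h2]; rewrite /clo /chi (ltW h1) (ltW h2).
Qed.

Lemma closure_rect c : closure (rect_set c) = rect_set c.
Proof.
apply/seteqP; split; last exact: subset_closure.
move=> p /closure_box H; apply/rect_setPb => b.
have N1 : coord (~~ b) p - 1 < coord (~~ b) p < coord (~~ b) p + 1.
  by rewrite ltrBlDr !ltrDl ltr01.
have K u v : u < coord b p < v -> exists q, rect_set c q /\ u < coord b q < v.
  move=> uv; have [|q [cq bq]] := H (mkpt b u (coord (~~ b) p - 1)) (mkpt b v (coord (~~ b) p + 1)).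
    by move=> b'; case: b' b {H} N1 uv => -[].
  by exists q; split => //; have := bq b; rewrite !coord_mkpt.
have [v1 v2] : exists v, coord b p < v by exists (coord b p + 1); rewrite ltrDl ltr01.
have [u1 u2] : exists v, v < coord b p by exists (coord b p - 1); rewrite ltrBlDr ltrDl ltr01.
apply/andP; split; rewrite leNgt; apply/negP => h.
  by have [|q [/rect_setPb/(_ b) cq qq]] := K u1 (clo b c); order.
by have [|q [/rect_setPb/(_ b) cq qq]] := K (chi b c) v1; order.
Qed.

Lemma boundary_rect c p :
  boundary (rect_set c) p <-> rect_set c p /\
    ~ (forall b, clo b c < coord b p < chi b c).
Proof.
by rewrite /boundary closure_rect /setD /=; split=> -[? h]; split=> // /rect_int.
Qed.

(* [side x l h u]: the interval [[l, h]] contains the germ at [u] of the half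
   line going to the right ([x = true]) or to the left ([x = false]). *)
Definition side x (l h u : R) := if x then l <= u < h else l < u <= h.

(* The cell [c] contains the germ at [p] of the quadrant in direction [x] along
   the coordinate [b] and in direction [y] along the other coordinate. *)
Definition quad b x y c p := side x (clo b c) (chi b c) (coord b p) &&
  side y (clo (~~ b) c) (chi (~~ b) c) (coord (~~ b) p).

Lemma quadC b x y c p : quad (~~ b) x y c p = quad b y x c p.
Proof. by rewrite /quad negbK andbC. Qed.

Lemma side_le x (l h u : R) : side x l h u -> l <= u <= h.
Proof. by case: x => /= H; order. Qed.

Lemma quad_rect b x y c p : quad b x y c p -> rect_set c p.
Proof. by move=> /andP[/side_le h1 /side_le h2]; apply/(rect_setP b). Qed.

Lemma rect_quad b c p : (forall b, clo b c < chi b c) -> rect_set c p ->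
  exists x y, quad b x y c p.
Proof.
move=> nd /(rect_setP b)[].
have K b' : clo b' c <= coord b' p <= chi b' c ->
    exists x, side x (clo b' c) (chi b' c) (coord b' p).
  move=> /andP[h1 h2]; have := nd b' => h.
  have [h3|h3] := ltP (coord b' p) (chi b' c); first by exists true; rewrite /side h1 h3.
  by exists false; rewrite /side; order.
by move=> /K[x hx] /K[y hy]; exists x, y; rewrite /quad hx hy.
Qed.

Lemma side_neq x (l h u : R) : side x l h u -> ~~ side (~~ x) l h u ->
  u = if x then l else h.
Proof.
by case: x => /= /andP[h1 h2]; rewrite ?h1 ?(ltW h1) ?h2 ?(ltW h2) ?andbT -leNgt /= => h3; order.
Qed.

Definition ahead x (g u h v : R) := if x then u < v < h else g < v < u.

Lemma ahead_ex x (g u h : R) : g < u < h -> exists v, ahead x g u h v.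
Proof. by move=> /andP[h1 h2]; case: x => /=; apply: between. Qed.

(** Each end of the interval is at [u] or outside the window from [g] to [k], so none separates [v]
    from [u]: both germs at [v] behave like the germ at [u] pointing towards [v]. *)
Lemma side_ahead x x' (l h g u k v : R) :
  (g < l < k -> l = u) -> (g < h < k -> h = u) -> g < u < k ->
  ahead x g u k v -> side x' l h v = side x l h u.
Proof.
have K z : (g < z < k -> z = u) -> [\/ z = u, z <= g | k <= z].
  move=> Hz; have [h1|] := ltP g z; last by constructor 2.
  have [h2|] := ltP z k; last by constructor 3.
  by constructor 1; apply: Hz; rewrite h1.
move=> /K Hl /K Hh gk; move: Hl Hh; case: x; case: x' => /= -[El|El|El] [Eh|Eh|Eh] H;
  apply/idP/idP => H'; try subst l; try subst h; order.
Qed.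

Lemma gap (L : seq R) (u : R) : exists g h, g < u < h /\
  forall z, z \in L -> g < z < h -> z = u.
Proof.
elim: L => [|a L [g [h [gh IH]]]].
  by exists (u - 1), (u + 1); rewrite ltrBlDr !ltrDl ltr01.
have [lt|lt|->] := ltgtP a u.
- exists (Num.max a g), h; split; first by rewrite gt_max lt.
  move=> z; rewrite inE gt_max => /orP[/eqP ->|zL /andP[/andP[_ h1] h2]].
    by rewrite ltxx.
  by apply: IH; rewrite ?h1.
- exists g, (Num.min a h); split; first by rewrite lt_min lt andbCA gh.
  move=> z; rewrite inE lt_min => /orP[/eqP ->|zL /andP[h1 /andP[_ h2]]].
    by rewrite ltxx andbF.
  by apply: IH; rewrite ?h1.
- by exists g, h; split => // z; rewrite inE => /orP[/eqP ->|/IH].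
Qed.

End Germs.

Lemma in_fset_cond (K : choiceType) (A : {fset K}) (P : pred K) i :
  (i \in [fset j in A | P j]%fset) = (i \in A) && P i.
Proof. by rewrite !inE. Qed.

(** * Cells of a mesh near a point *)

Section Mesh.
Variables (R : realType) (T : mesh R).
Implicit Types (b x y : bool) (c : rect R) (e : segm R) (p q : R * R).

Definition grid : seq R :=
  [seq smin c | c <- cells T] ++ [seq smax c | c <- cells T] ++
  [seq tmin c | c <- cells T] ++ [seq tmax c | c <- cells T] ++
  [seq lo e | e <- edges T] ++ [seq hi e | e <- edges T] ++
  [seq cor e | e <- edges T].

Lemma grid_clo b c : c \in cells T -> clo b c \in grid.
Proof. by move=> cT; rewrite /grid !mem_cat; case: b; rewrite map_f ?orbT. Qed.

Lemma grid_chi b c : c \in cells T -> chi b c \in grid.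
Proof. by move=> cT; rewrite /grid !mem_cat; case: b; rewrite map_f ?orbT. Qed.

Lemma grid_edge e : e \in edges T -> [/\ lo e \in grid, hi e \in grid & cor e \in grid].
Proof.
by move=> eT; split; rewrite /grid !mem_cat map_f ?orbT.
Qed.

(** The ends of cells and edges falling in a window are aligned with [p], so that what a nearby
    point meets depends only on the direction in which it lies from [p]. *)
Definition window p (l h : R * R) := box l h p /\
  forall z b, z \in grid -> coord b l < z < coord b h -> z = coord b p.

Lemma window_nbhs p (A : set (R * R)) : nbhs p A ->
  exists l h, window p l h /\ box l h `<=` A.
Proof.
move=> /nbhs_box[l [h [pb bA]]].
have [g1 [k1 [gk1 H1]]] := gap grid p.1; have [g2 [k2 [gk2 H2]]] := gap grid p.2.
exists (Num.max g1 l.1, Num.max g2 l.2), (Num.min k1 h.1, Num.min k2 h.2); split.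
  split=> [b|z b zG].
    have := pb true; have := pb false; rewrite /coord /= => B2 B1.
    by case: b; rewrite /= gt_max lt_min; split_bounds; apply/andP; split; apply/andP.
  case: b; rewrite /coord /= gt_max lt_min => /andP[/andP[h1 _] /andP[h2 _]].
    by apply: H1 => //; rewrite h1.
  by apply: H2 => //; rewrite h1.
move=> q qb; apply: bA => b; have := qb b.
by case: b; rewrite /coord /= gt_max lt_min => /andP[/andP[_ ->] /andP[_ ->]].
Qed.

Lemma window_ex p : exists l h, window p l h.
Proof.
by have [|l [h [w _]]] := @window_nbhs p setT; [exact: filterT | exists l, h].
Qed.

Definition aheadb b x p l h q :=
  ahead x (coord b l) (coord b p) (coord b h) (coord b q).

Lemma sideb_move b x x' c p q l h : window p l h -> c \in cells T ->
  aheadb b x p l h q ->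
  side x' (clo b c) (chi b c) (coord b q) = side x (clo b c) (chi b c) (coord b p).
Proof.
move=> [pb W] cT; apply: side_ahead (pb b).
  by apply: W; exact: grid_clo.
by apply: W; exact: grid_chi.
Qed.

Lemma quad_move b x x' y c p q l h : window p l h -> c \in cells T ->
  aheadb b x p l h q -> coord (~~ b) q = coord (~~ b) p ->
  quad b x' y c q = quad b x y c p.
Proof. by move=> W cT qx qy; rewrite /quad (sideb_move _ W cT qx) qy. Qed.

Lemma quad_move2 b x x' y y' c p q l h : window p l h -> c \in cells T ->
  aheadb b x p l h q -> aheadb (~~ b) y p l h q ->
  quad b x' y' c q = quad b x y c p.
Proof.
by move=> W cT qx qy; rewrite /quad (sideb_move _ W cT qx) (sideb_move _ W cT qy).
Qed.

Lemma ahead_in_box b x p l h u : box l h p ->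
  ahead x (coord b l) (coord b p) (coord b h) u -> coord b l < u < coord b h.
Proof. by move=> /(_ b); case: x => /= *; order. Qed.

Lemma move_ex b x p l h : box l h p -> exists q,
  [/\ box l h q, aheadb b x p l h q & coord (~~ b) q = coord (~~ b) p].
Proof.
move=> pb; have [u ux] := ahead_ex x (pb b).
exists (mkpt b u (coord (~~ b) p)); rewrite /aheadb coordN_mkpt coord_mkpt; split => //.
by move=> b'; have := ahead_in_box pb ux; have := pb (~~ b); case: b b' {ux} => -[].
Qed.

Lemma move2_ex b x y p l h : box l h p -> exists q,
  [/\ box l h q, aheadb b x p l h q & aheadb (~~ b) y p l h q].
Proof.
move=> pb; have [u ux] := ahead_ex x (pb b); have [w wy] := ahead_ex y (pb (~~ b)).
exists (mkpt b u w); rewrite /aheadb coordN_mkpt coord_mkpt; split => //.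
move=> b'; have := ahead_in_box pb ux; have := ahead_in_box pb wy.
by case: b b' {ux wy} => -[].
Qed.

Definition filled b x y p := exists2 c, c \in cells T & quad b x y c p.

Lemma filledC b x y p : filled (~~ b) x y p <-> filled b y x p.
Proof. by split=> -[c cT]; rewrite ?quadC => h; exists c => //; rewrite quadC. Qed.

Hypothesis tT : is_tmesh T.

Lemma cell_lt c b : c \in cells T -> clo b c < chi b c.
Proof. by move=> /(cells_nondegenerate tT)[h1 h2]; case: b. Qed.

Lemma quad_int b c q : (forall x y, quad b x y c q) ->
  forall b', clo b' c < coord b' q < chi b' c.
Proof.
move=> H; have := H true true; have := H false false.
rewrite /quad /side => /andP[h1 h2] /andP[h3 h4] b'.
have [->|/negPf nb] := eqVneq b' b; first by order.
have -> : b' = ~~ b by case: b' b nb {H h1 h2 h3 h4} => -[].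
by order.
Qed.

(** A point moved from [p] into the quadrant is interior to both cells, whose interiors would be
    disjoint if they were distinct. *)
Lemma quad_uniq b x y p c c' : c \in cells T -> c' \in cells T ->
  quad b x y c p -> quad b x y c' p -> c = c'.
Proof.
move=> cT c'T qc qc'; have [l [h W]] := window_ex p.
have [q [_ qx qy]] := move2_ex b x y (proj1 W).
apply: contrapT => /(cells_disjoint tT cT c'T).
rewrite -subset0 => /(_ q); apply; split; apply/rect_int; apply: (@quad_int b) => x' y'.
  by rewrite (quad_move2 x' y' W cT qx qy).
by rewrite (quad_move2 x' y' W c'T qx qy).
Qed.

Lemma domain_quad b p : domain T p <-> exists x y, filled b x y p.
Proof.
split=> [[c /= cT cp]|[x [y [c cT /quad_rect cp]]]]; last by exists c.
have [|x [y q]] := @rect_quad _ b c p _ cp; first by move=> b'; exact: cell_lt.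
by exists x, y, c.
Qed.

(** Points of a window at [p] lie in the cell that fills the quadrant on their side of [p].
    Conversely, a point moved into a quadrant lies in a cell, which then fills this quadrant at
    [p]. *)
Lemma int_filled b p : (domain T)° p <-> forall x y, filled b x y p.
Proof.
split=> [/window_nbhs[l [h [W bD]]] x y|H].
  have [q [qb qx qy]] := move2_ex b x y (proj1 W).
  have /(domain_quad b)[x' [y' [c cT]]] := bD _ qb.
  by rewrite (quad_move2 x' y' W cT qx qy) => Q; exists c.
have [l [h W]] := window_ex p; apply/interior_box; exists l, h; split; first by case: W.
move=> q qb.
have K b' x c : c \in cells T -> side x (clo b' c) (chi b' c) (coord b' p) ->
    x = (coord b' p <= coord b' q) -> clo b' c <= coord b' q <= chi b' c.
  move=> cT sx xE; have Q := qb b'; have P := proj1 W b'.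
  have [lt|ge] := ltP (coord b' p) (coord b' q).
    have ax : aheadb b' true p l h q by rewrite /aheadb /=; order.
    rewrite xE (ltW lt) in sx.
    by have := sideb_move true W cT ax; rewrite sx => /side_le.
  have [E|ne] := eqVneq (coord b' q) (coord b' p); first by rewrite E; exact: side_le sx.
  have lt : coord b' q < coord b' p by rewrite lt_neqAle ne.
  have ax : aheadb b' false p l h q by rewrite /aheadb /=; order.
  rewrite xE leNgt lt in sx.
  by have := sideb_move true W cT ax; rewrite sx => /side_le.
have [c cT /andP[s1 s2]] := H (coord b p <= coord b q) (coord (~~ b) p <= coord (~~ b) q).
by exists c => //=; apply/(rect_setP b); split; [exact: K s1 _|exact: K s2 _].
Qed.

Lemma closed_cells (P : rect R -> Prop) :
  closed [set p | exists c, [/\ c \in cells T, P c & rect_set c p]].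
Proof.
move=> p /closure_box H; have [l [h W]] := window_ex p.
have [q [[c [cT Pc cq]] qb]] := H _ _ (proj1 W); exists c; split => //.
apply/rect_setPb => b; have /rect_setPb/(_ b) := cq; have := qb b; have := proj1 W b.
move=> P' Q C; have Kl := proj2 W _ b (grid_clo b cT); have Kh := proj2 W _ b (grid_chi b cT).
apply/andP; split; rewrite leNgt; apply/negP => lt.
  have E : clo b c = coord b p by apply: Kl; order.
  by rewrite E ltxx in lt.
have E : chi b c = coord b p by apply: Kh; order.
by rewrite E ltxx in lt.
Qed.

Lemma domain_closed : closure (domain T) = domain T.
Proof.
apply/seteqP; split; last exact: subset_closure.
have -> : domain T = [set p | exists c, [/\ c \in cells T, True & rect_set c p]].
  by apply/seteqP; split=> p [c]; [exists c | case=> cT _ cp; exists c].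
exact: closed_cells.
Qed.

Lemma boundary_domain p : boundary (domain T) p <-> domain T p /\ ~ (domain T)° p.
Proof. by rewrite /boundary domain_closed. Qed.

Lemma int_quad b x y c q :
  (forall b, clo b c < coord b q < chi b c) -> quad b x y c q.
Proof.
move=> H; have K b' z : side z (clo b' c) (chi b' c) (coord b' q).
  by have /andP[h1 h2] := H b'; case: z; rewrite /= ?h1 ?h2 ?(ltW h1) ?(ltW h2).
by rewrite /quad !K.
Qed.

Lemma cell_int c c' q : c \in cells T -> c' \in cells T ->
  (forall b, clo b c < coord b q < chi b c) -> rect_set c' q -> c = c'.
Proof.
move=> cT c'T H c'q.
have [|x [y Q]] := @rect_quad _ true c' q _ c'q; first by move=> b; exact: cell_lt.
by apply: quad_uniq cT c'T _ Q; exact: int_quad.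
Qed.

Lemma cell_interior c q : c \in cells T ->
  (forall b, clo b c < coord b q < chi b c) -> (domain T)° q.
Proof.
by move=> cT H; apply/(int_filled true) => x y; exists c => //; exact: int_quad.
Qed.

End Mesh.

(** * Edges and maximal segments *)

Section Edges.
Variables (R : realType) (T : mesh R).
Implicit Types (b x y : bool) (c : rect R) (e : segm R) (p q v : R * R).
Hypothesis rT : reduced T.
Let tT : is_tmesh T := reduced_is_tmesh rT.

(** Counterpart of [quad] for edges: [e] contains the germ at [p] of the half-line along the
    coordinate [b] in direction [x]. *)
Definition egerm b x p e :=
  [/\ e \in edges T, horiz e = b, cor e = coord (~~ b) p &
      side x (lo e) (hi e) (coord b p)].

(* [c] is the cell just above or to the right of [e] if [y = true], and the one
   below or to the left of it if [y = false]. *)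
Definition adj y e c :=
  [/\ c \in cells T, (if y then clo (~~ horiz e) c else chi (~~ horiz e) c) = cor e,
      clo (horiz e) c <= lo e & hi e <= chi (horiz e) c].

Lemma side_ex (l h u : R) : l < h -> l <= u <= h -> exists x, side x l h u.
Proof.
move=> lh /andP[h1 h2]; have [h3|h3] := ltP u h; first by exists true; rewrite /= h1.
by exists false => /=; order.
Qed.

Lemma interior_edges_sub e : e \in interior_edges T -> e \in edges T.
Proof. by rewrite !inE => /andP[]. Qed.

Lemma interior_edgesP e : e \in interior_edges T <->
  e \in edges T /\ exists2 p, seg_set e p & (domain T)° p.
Proof.
rewrite !inE /=; split=> [/andP[-> /asboolP[p [ep Dp]]]|[-> [p ep Dp]]].
  by split => //; exists p.
by apply/asboolP; exists p.
Qed.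

Lemma vertex_on_edge e v : e \in edges T -> v \in vertices T -> seg_set e v ->
  coord (horiz e) v = lo e \/ coord (horiz e) v = hi e.
Proof.
move=> /(edges_consecutive rT)[p _ [_ _ _ H]] vT /seg_setP[/andP[h1 h2] h3].
have [h4|h4] := ltP (lo e) (coord (horiz e) v); last by left; order.
have [h5|h5] := ltP (coord (horiz e) v) (hi e); last by right; order.
have /H : lo e < coord (horiz e) v < hi e by rewrite h4.
by rewrite seg_ptE -h3 mkptK vT.
Qed.

Lemma edges_vertex e e' p : e \in edges T -> e' \in edges T -> e <> e' ->
  seg_set e p -> seg_set e' p -> p \in vertices T.
Proof. by move=> eT e'T ne ep e'p; apply: (edges_meet tT eT e'T ne). Qed.

Lemma start_vertex e : e \in edges T -> seg_start e \in vertices T.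
Proof. by move=> eT; rewrite /vertices inE (in_imfset _ (@seg_start R)). Qed.

Lemma end_vertex e : e \in edges T -> seg_end e \in vertices T.
Proof. by move=> eT; rewrite /vertices inE (in_imfset _ (@seg_end R)) ?orbT. Qed.

(** Distinct edges meet only in vertices, and an open edge contains none. *)
Lemma edge_open_uniq e e' p : e \in edges T -> e' \in edges T ->
  lo e < coord (horiz e) p < hi e -> coord (~~ horiz e) p = cor e ->
  seg_set e' p -> e' = e.
Proof.
move=> eT e'T ep pe e'p; apply: contrapT => ne.
have sp : seg_set e p by apply/seg_setP; split => //; order.
have vT := edges_vertex e'T eT ne e'p sp.
by case: (vertex_on_edge eT vT sp) => E; rewrite E ltxx ?andbF in ep.
Qed.

Lemma germ_seg b x p e : egerm b x p e -> seg_set e p.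
Proof. by move=> [eT <- pe /side_le s]; apply/seg_setP. Qed.

Lemma edge_ahead x p e l h q : e \in edges T -> window T p l h ->
  side x (lo e) (hi e) (coord (horiz e) p) -> aheadb (horiz e) x p l h q ->
  lo e < coord (horiz e) q < hi e.
Proof.
move=> eT [pb W] s qx; have [g1 g2 _] := grid_edge eT.
have K x' := side_ahead x' (W _ _ g1) (W _ _ g2) (pb _) qx.
have : side true (lo e) (hi e) (coord (horiz e) q) by rewrite K.
have : side false (lo e) (hi e) (coord (horiz e) q) by rewrite K.
by move=> /= k1 k2; order.
Qed.

(** The half-line runs along the boundary of [c], which is a union of edges. *)
Lemma cell_side_edge b x y c p : c \in cells T -> quad b x y c p ->
  ~~ quad b x (~~ y) c p -> exists e, egerm b x p e.
Proof.
move=> cT /[dup] Q /andP[sx sy] nQ; have [l [h [pb W]]] := window_ex T p.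
have [q [qb qx qp]] := move_ex b x pb.
have Qq x' : quad b x' y c q by rewrite (quad_move _ _ (conj pb W) cT qx qp).
have : boundary (rect_set c) q.
  apply/boundary_rect; split; first exact: quad_rect (Qq true).
  move=> /(_ (~~ b)); rewrite qp (side_neq sy); last by move: nQ; rewrite /quad sx.
  by case: ifP; rewrite ltxx ?andbF.
have [F [FT ->]] := cell_boundary tT cT; move=> [e /= eF /[dup] eq' /seg_setP[s1 s2]].
have eT := FT _ eF; have [g1 g2 g3] := grid_edge eT.
exists e; have [hb|hb] := eqVneq (horiz e) b.
  rewrite hb in s1 s2; split => //; first by rewrite -s2.
  have [x' s] := side_ex (edges_nondegenerate tT eT) s1.
  by rewrite -(side_ahead x' (W _ b g1) (W _ b g2) (pb _) qx).
(* A transversal edge through [q] would have its coordinate in the grid, hence aligned with [p],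
   whereas [q] has been moved off [p]. *)
have {}hb : horiz e = ~~ b by case: (horiz e) b hb {Q sx sy nQ qx qp Qq s1 s2} => -[].
rewrite hb negbK in s2; have E : cor e = coord b p by apply: W => //; rewrite -s2; exact: qb.
by move: qx; rewrite /aheadb s2 E /ahead; case: (x); rewrite ltxx ?andbF.
Qed.

(** A cell touching an inner point of an edge lies on one side of it and borders all of it. *)
Lemma edge_cell e p x y c : e \in edges T -> c \in cells T ->
  lo e < coord (horiz e) p < hi e -> coord (~~ horiz e) p = cor e ->
  quad (horiz e) x y c p -> adj y e c.
Proof.
move=> eT cT ep pe /[dup] Q /andP[sx sy].
(* The edge is contained in boundaries of cells, so it cannot enter the interior of [c]. *)
have nQ : ~~ quad (horiz e) x (~~ y) c p.
  apply/negP => Q'; have [l [h W]] := window_ex T p.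
  have [q [qb qx qp]] := move_ex (horiz e) x (proj1 W).
  have qI : forall b, clo b c < coord b q < chi b c.
    apply: (@quad_int _ (horiz e)) => x' y'; rewrite (quad_move _ _ W cT qx qp).
    by move: Q Q'; case: y {sy} => Q Q'; case: y'.
  have s : side x (lo e) (hi e) (coord (horiz e) p) by case: (x) => /=; order.
  have qe : seg_set e q.
    by have := edge_ahead eT W s qx => H; apply/seg_setP; rewrite qp; split => //; order.
  have [c' /= c'T /boundary_rect[c'q]] := edges_in_boundaries tT eT qe.
  by rewrite -(cell_int tT cT c'T qI c'q).
have corE : cor e = if y then clo (~~ horiz e) c else chi (~~ horiz e) c.
  by rewrite -pe; apply: side_neq sy _; move: nQ; rewrite /quad sx.
(* If the cell ended at an inner point of the edge, its perpendicular side would carry another edge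
   through this point. *)
have K x' u : side x' (clo (horiz e) c) (chi (horiz e) c) u ->
    ~~ side (~~ x') (clo (horiz e) c) (chi (horiz e) c) u ->
    lo e < u < hi e -> False.
  move=> s1 s2 lu; pose q := mkpt (horiz e) u (cor e).
  have [] := @cell_side_edge (~~ horiz e) y x' c q cT.
  - by rewrite quadC /quad coord_mkpt coordN_mkpt s1 -pe.
  - by rewrite quadC /quad coord_mkpt coordN_mkpt (negPf s2).
  move=> e' g; have [e'T he' _ _] := g.
  have E : e' = e.
    by apply: (@edge_open_uniq _ _ q); rewrite ?coord_mkpt ?coordN_mkpt //; exact: germ_seg g.
  by move: he'; rewrite E; case: (horiz e).
have lt := cell_lt tT (horiz e) cT; have := side_le sx => sle.
split => //; rewrite leNgt; apply/negP => lt'.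
  apply: (K true (clo (horiz e) c)) => /=; last by order.
    by rewrite lexx lt.
  by rewrite ltxx.
apply: (K false (chi (horiz e) c)) => /=; last by order.
  by rewrite lexx lt.
by rewrite ltxx andbF.
Qed.

Lemma adj_quad x y e c p : adj y e c -> side x (lo e) (hi e) (coord (horiz e) p) ->
  coord (~~ horiz e) p = cor e -> quad (horiz e) x y c p.
Proof.
move=> [cT E h1 h2] s pe; rewrite /quad pe; apply/andP; split.
  by case: x s => /= s; order.
by rewrite -E; case: (y) => /=; rewrite lexx ?(cell_lt tT).
Qed.

Lemma adj_sub y e c : e \in edges T -> adj y e c -> seg_set e `<=` rect_set c.
Proof.
move=> eT ec p /seg_setP[h1 h2]; have [x s] := side_ex (edges_nondegenerate tT eT) h1.
by apply: quad_rect; apply: adj_quad ec s h2.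
Qed.

Lemma adj_uniq y e c c' : e \in edges T -> adj y e c -> adj y e c' -> c = c'.
Proof.
move=> eT ec ec'; have [cT _ _ _] := ec; have [c'T _ _ _] := ec'.
have s : side true (lo e) (hi e) (coord (horiz e) (mkpt (horiz e) (lo e) (cor e))).
  by rewrite coord_mkpt /= lexx (edges_nondegenerate tT).
by apply: (quad_uniq tT cT c'T (adj_quad ec s _) (adj_quad ec' s _)); rewrite coordN_mkpt.
Qed.

Lemma adj_neq e c c' : adj true e c -> adj false e c' -> c <> c'.
Proof.
move=> [cT E1 _ _] [_ E2 _ _] E; subst c'.
by have := cell_lt tT (~~ horiz e) cT; rewrite E1 E2 ltxx.
Qed.

Lemma adj_interior e p c c' : adj true e c -> adj false e c' ->
  lo e < coord (horiz e) p < hi e -> coord (~~ horiz e) p = cor e -> (domain T)° p.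
Proof.
move=> ec ec' ep pe; apply/(int_filled tT (horiz e)) => x y.
have s : side x (lo e) (hi e) (coord (horiz e) p) by case: (x) => /=; order.
case: y; [exists c|exists c']; try by [case: ec|case: ec'].
  exact: adj_quad ec s pe.
exact: adj_quad ec' s pe.
Qed.

Lemma edge_mid e : e \in edges T -> exists p,
  lo e < coord (horiz e) p < hi e /\ coord (~~ horiz e) p = cor e.
Proof.
move=> /(edges_nondegenerate tT)/between[u hu].
by exists (mkpt (horiz e) u (cor e)); rewrite coord_mkpt coordN_mkpt.
Qed.

Lemma open_seg e p : lo e < coord (horiz e) p < hi e -> coord (~~ horiz e) p = cor e ->
  seg_set e p.
Proof. by move=> h1 h2; apply/seg_setP; split => //; order. Qed.

Lemma adj_interior_edge e c c' : e \in edges T -> adj true e c -> adj false e c' ->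
  e \in interior_edges T.
Proof.
move=> eT ec ec'; apply/interior_edgesP; split => //; have [p [h1 h2]] := edge_mid eT.
by exists p; [exact: open_seg | exact: adj_interior ec ec' h1 h2].
Qed.

(** The edge is known to meet the interior at one point only, possibly an end. The quadrants there
    are filled, and their cells persist when moving along the edge to an inner point. *)
Lemma interior_edge_adj y e : e \in interior_edges T -> exists c, adj y e c.
Proof.
move=> /interior_edgesP[eT [p /seg_setP[h1 h2] /(int_filled tT (horiz e)) Dp]].
have [x s] := side_ex (edges_nondegenerate tT eT) h1; have [c cT Q] := Dp x y.
have [l [h W]] := window_ex T p; have [q [qb qx qp]] := move_ex (horiz e) x (proj1 W).
exists c; apply: (edge_cell (p := q) (x := x)) => //; first exact: edge_ahead W s qx.
  by rewrite qp.
by rewrite (quad_move _ _ W cT qx qp).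
Qed.

Lemma interior_edge_open e p : e \in interior_edges T ->
  lo e < coord (horiz e) p < hi e -> coord (~~ horiz e) p = cor e -> (domain T)° p.
Proof.
move=> eI; have [c ec] := interior_edge_adj true eI; have [c' ec'] := interior_edge_adj false eI.
exact: adj_interior ec ec'.
Qed.

Lemma seg_in_cell e c : e \in edges T -> c \in cells T ->
  seg_set e `<=` rect_set c -> exists y, adj y e c.
Proof.
move=> eT cT sub; have [p [h1 h2]] := edge_mid eT.
have [|x [y Q]] := @rect_quad _ (horiz e) c p _ (sub _ (open_seg h1 h2)).
  by move=> b; exact: (cell_lt tT).
by exists y; exact: edge_cell h1 h2 Q.
Qed.

(** Since [c0] fills the quadrant on the other side, [c1] does not, and the half-line carries an
    edge; it has cells on both sides and is interior. *)
Lemma germ_neq b x c1 c0 p : c1 \in cells T -> c0 \in cells T ->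
  quad b x true c1 p -> quad b x false c0 p -> c1 <> c0 ->
  exists e, [/\ e \in interior_edges T, egerm b x p e, adj true e c1 & adj false e c0].
Proof.
move=> c1T c0T Q1 Q0 ne.
have [|e g] := cell_side_edge c1T Q1.
  by apply/negP => Q; apply: ne; exact: (@quad_uniq _ _ tT b x false p).
have [eT he pe s] := g; have [l [h W]] := window_ex T p.
have [q [qb qx qp]] := move_ex b x (proj1 W); rewrite -he in qx qp s.
have A y c : c \in cells T -> quad b x y c p -> adj y e c.
  move=> cT Q; apply: (edge_cell (p := q) (x := x)) => //; first exact: edge_ahead W s qx.
    by rewrite qp he.
  by rewrite (quad_move _ _ W cT qx qp) he.
have a1 := A _ _ c1T Q1; have a0 := A _ _ c0T Q0.
by exists e; split => //; exact: adj_interior_edge a1 a0.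
Qed.

Lemma germ_adj b x y c e p : e \in interior_edges T -> c \in cells T ->
  egerm b x p e -> quad b x y c p -> adj y e c.
Proof.
move=> eI cT [eT he pe s] Q; have [c' ec'] := interior_edge_adj y eI.
have [c'T _ _ _] := ec'; rewrite -he in s Q pe.
by rewrite (quad_uniq tT cT c'T Q (adj_quad ec' s (esym pe))).
Qed.

Lemma germ_filled b x y e p : e \in interior_edges T ->
  egerm b x p e -> filled T b x y p.
Proof.
move=> eI [eT he pe s]; have [c' ec'] := interior_edge_adj y eI.
have [c'T _ _ _] := ec'; rewrite -he in s pe *.
by exists c' => //; exact: adj_quad ec' s (esym pe).
Qed.

Lemma germ_uniq b x p e e' : egerm b x p e -> egerm b x p e' -> e = e'.
Proof.
move=> [eT he pe s] [e'T he' pe' s']; have [l [h W]] := window_ex T p.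
have [q [qb qx qp]] := move_ex b x (proj1 W).
have k1 : lo e < coord (horiz e) q < hi e.
  by apply: (edge_ahead (x := x) eT W); rewrite he.
have k2 : lo e' < coord (horiz e') q < hi e'.
  by apply: (edge_ahead (x := x) e'T W); rewrite he'.
apply: (edge_open_uniq e'T eT k2); first by rewrite he' qp.
by apply: open_seg k1 _; rewrite he qp.
Qed.

Lemma germ_int b x p e : egerm b x p e -> (domain T)° p -> e \in interior_edges T.
Proof.
move=> g Dp; apply/interior_edgesP; split; first by case: g.
by exists p => //; exact: germ_seg g.
Qed.

End Edges.

(** * Maximal segments of a reduced mesh *)

Section Segments.
Variables (R : realType) (T : mesh R).
Implicit Types (b x y : bool) (c : rect R) (e p q : segm R) (u v : R * R).
Hypothesis rT : reduced T.
Let tT : is_tmesh T := reduced_is_tmesh rT.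

Lemma seg_sub e p : lo e < hi e -> seg_set e `<=` seg_set p ->
  [/\ horiz e = horiz p, cor e = cor p, lo p <= lo e & hi e <= hi p].
Proof.
move=> lt sub.
have K (u : R) : lo e <= u <= hi e -> seg_set p (mkpt (horiz e) u (cor e)).
  by move=> hu; apply: sub; apply/seg_setP; rewrite coord_mkpt coordN_mkpt.
have /K/seg_setP[l1 l2] : lo e <= lo e <= hi e by order.
have /K/seg_setP[h1 h2] : lo e <= hi e <= hi e by order.
have [E|ne] := eqVneq (horiz p) (horiz e).
  rewrite E !coord_mkpt !coordN_mkpt in l1 l2 h1 h2.
  by split; [rewrite E | rewrite l2 | case/andP: l1 | case/andP: h1].
have E : horiz p = ~~ horiz e by case: (horiz p) (horiz e) ne => -[].
rewrite E negbK !coord_mkpt in l2 h2; rewrite l2 h2 in lt.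
by rewrite ltxx in lt.
Qed.

Section EdgeSet.
Variable E : {fset segm R}.
Hypothesis subE : {subset E <= edges T}.

Lemma seg_edge p u : is_segment E p -> seg_set p u ->
  exists e, [/\ e \in E, seg_set e u & seg_set e `<=` seg_set p].
Proof.
move=> [_ [F [FE ->]]] [e /= eF eu]; exists e; split=> //; first exact: FE.
by move=> w ew; exists e.
Qed.

Lemma edge_in_seg e p : e \in edges T -> is_segment E p -> seg_set e `<=` seg_set p ->
  e \in E.
Proof.
move=> eT sp sub; have [u [h1 h2]] := edge_mid rT eT.
have [f [fE fu _]] := seg_edge sp (sub _ (open_seg h1 h2)).
by rewrite -(edge_open_uniq rT eT (subE fE) h1 h2 fu).
Qed.

(** The union of two collinear segments with a common point is a segment, equal to both by
    maximality. *)
Lemma max_seg_uniq p q u : is_max_segment E p -> is_max_segment E q ->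
  horiz p = horiz q -> seg_set p u -> seg_set q u -> p = q.
Proof.
move=> [[lp [F [FE pF]]] mp] [[lq [G [GE qG]]] mq] hpq pu qu.
have [/andP[p1 p2] p3] := (seg_setP _ _).1 pu.
have [/andP[q1 q2] q3] := (seg_setP _ _).1 qu; rewrite -hpq in q1 q2 q3.
pose s := Segm (horiz p) (cor p) (Num.min (lo p) (lo q)) (Num.max (hi p) (hi q)).
have sE : seg_set s = seg_set p `|` seg_set q.
  apply/seteqP; split=> w; rewrite /setU /=.
    move=> /seg_setP /=; rewrite ge_min le_max => -[/andP[w1 w2] w3].
    have [pw|pw] := boolP (lo p <= coord (horiz p) w <= hi p).
      by left; apply/seg_setP.
    have [qw|qw] := boolP (lo q <= coord (horiz p) w <= hi q).
      by right; apply/seg_setP; rewrite -hpq qw w3 -p3 q3.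
    exfalso; move: pw qw; rewrite !negb_and -!ltNge.
    by case/orP: w1 => w1; case/orP: w2 => w2; case/orP => pw; case/orP => qw; order.
  case=> /seg_setP[w1 w3]; apply/seg_setP => /=; rewrite ge_min le_max.
    by case/andP: w1 => -> ->.
  by rewrite -hpq in w1 w3; case/andP: w1 => -> ->; rewrite !orbT w3 -q3 p3.
have ss : is_segment E s.
  split; first by rewrite /= lt_max gt_min lp.
  exists (F `|` G)%fset; split=> [e|]; first by rewrite inE => /orP[/FE|/GE].
  rewrite sE pF qG; apply/seteqP; split=> w.
    by case=> -[e /= eF ew]; exists e => //=; rewrite inE eF ?orbT.
  by move=> [e /=]; rewrite inE => /orP[eF|eG] ew; [left|right]; exists e.
have sp : s = p by apply: mp ss _; rewrite sE; exact: subsetUl.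
have sq : s = q by apply: mq ss _; rewrite sE; exact: subsetUr.
by rewrite -sp.
Qed.

End EdgeSet.

Lemma boundary_sub : {subset boundary_edges T <= edges T}.
Proof. by move=> e; rewrite inE => /andP[]. Qed.

Lemma boundary_interior e : e \in boundary_edges T -> e \notin interior_edges T.
Proof. by rewrite inE => /andP[]. Qed.

Lemma MSP p : p \in MS T <-> is_max_segment (interior_edges T) p.
Proof.
by apply: mem_max_segments => e /interior_edges_sub /(edges_nondegenerate tT).
Qed.

Lemma BMSP p : p \in BMS T <-> is_max_segment (boundary_edges T) p.
Proof.
by apply: mem_max_segments => e /boundary_sub /(edges_nondegenerate tT).
Qed.

Lemma MS_edge_interior p e : p \in MS T -> e \in edges T ->
  seg_set e `<=` seg_set p -> e \in interior_edges T.
Proof. by move=> /MSP[sp _] eT; exact: edge_in_seg (@interior_edges_sub R T) _ _ eT sp. Qed.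

Lemma BMS_edge_boundary p e : p \in BMS T -> e \in edges T ->
  seg_set e `<=` seg_set p -> e \in boundary_edges T.
Proof. by move=> /BMSP[sp _] eT; exact: edge_in_seg boundary_sub _ _ eT sp. Qed.

Lemma MS_edge p u : p \in MS T -> seg_set p u ->
  exists e, [/\ e \in interior_edges T, seg_set e u & seg_set e `<=` seg_set p].
Proof. by move=> /MSP[sp _]; exact: seg_edge. Qed.

Lemma BMS_edge p u : p \in BMS T -> seg_set p u ->
  exists e, [/\ e \in boundary_edges T, seg_set e u & seg_set e `<=` seg_set p].
Proof. by move=> /BMSP[sp _]; exact: seg_edge. Qed.

Lemma BMS_not_interior p u : p \in BMS T -> seg_set p u -> ~ (domain T)° u.
Proof.
move=> pB /(BMS_edge pB)[e [/[dup] /boundary_sub eT /boundary_interior eI eu _]] uD.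
by case/negP: eI; apply/interior_edgesP; split => //; exists u.
Qed.

Lemma MShat_cases p : p \in MShat T -> p \in MS T \/ p \in BMS T.
Proof.
rewrite /MShat !in_fsetU => /orP[/orP[/orP[]|]|->]; last by right.
all: by rewrite in_fset_cond => /andP[? _]; left.
Qed.

Lemma MShat_lt p : p \in MShat T -> lo p < hi p.
Proof. by move=> /MShat_cases[/MSP|/BMSP] [[]]. Qed.

Lemma seg_lo p : lo p < hi p -> seg_set p (seg_start p).
Proof.
by move=> lt; apply/seg_setP; rewrite /seg_start seg_ptE coord_mkpt coordN_mkpt; split=> //; order.
Qed.

Lemma seg_hi p : lo p < hi p -> seg_set p (seg_end p).
Proof.
by move=> lt; apply/seg_setP; rewrite /seg_end seg_ptE coord_mkpt coordN_mkpt; split=> //; order.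
Qed.

Lemma MS_BMS p : p \in MS T -> p \in BMS T -> False.
Proof.
move=> pM pB; have [[lt _] _] := (MSP p).1 pM.
have [e [eI _ ep]] := MS_edge pM (seg_lo lt).
have := BMS_edge_boundary pB (interior_edges_sub eI) ep.
by move=> /boundary_interior; rewrite eI.
Qed.

Lemma edge_MShat e : e \in edges T -> exists p,
  [/\ p \in MShat T, horiz e = horiz p & seg_set e `<=` seg_set p].
Proof. by move=> /(edges_consecutive rT)[p pM [[h _] sub _ _]]; exists p. Qed.

Lemma edge_MS e : e \in interior_edges T -> exists p,
  [/\ p \in MS T, p \in MShat T & seg_set e `<=` seg_set p].
Proof.
move=> eI; have [p [pM _ sub]] := edge_MShat (interior_edges_sub eI); exists p; split => //.
case: (MShat_cases pM) => // pB.
by have := BMS_edge_boundary pB (interior_edges_sub eI) sub => /boundary_interior; rewrite eI.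
Qed.

(** A priori, a maximal segment touching the boundary only between its ends belongs to none of the
    classes. In a reduced mesh each of its edges lies on a member of [MShat], which coincides with
    it by maximality. *)
Lemma MS_MShat p : p \in MS T -> p \in MShat T.
Proof.
move=> pM; have [[lt _] _] := (MSP p).1 pM.
have [e [eI eu ep]] := MS_edge pM (seg_lo lt); have [q [qM qM' eq]] := edge_MS eI.
have ltE := edges_nondegenerate tT (interior_edges_sub eI).
have [h1 _ _ _] := seg_sub ltE ep; have [h2 _ _ _] := seg_sub ltE eq.
suff -> : p = q by [].
by apply: (max_seg_uniq ((MSP p).1 pM) ((MSP q).1 qM) _ (ep _ eu) (eq _ eu)); rewrite -h1.
Qed.

Lemma MShat_vertex_uniq v p q : v \in vertices T -> p \in MShat T -> q \in MShat T ->
  horiz p = horiz q -> seg_set p v -> seg_set q v -> p = q.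
Proof.
move=> vT pM qM hpq pv qv.
have [s [_ U]] := vertex_on_unique_segments rT (horiz p) vT.
by rewrite -(U p) // -(U q).
Qed.

(** Only one member of [MShat] in the direction [b] passes through the vertex, and its edges are all
    interior or all boundary edges. *)
Lemma germ_kind b x x' v e e' : v \in vertices T -> egerm T b x v e ->
  egerm T b x' v e' -> e \in interior_edges T -> e' \in interior_edges T.
Proof.
move=> vT g g' eI; have [p [pM pM' ep]] := edge_MS eI.
have [e'T he' _ _] := g'; have [_ he _ _] := g.
have [q [qM h' eq]] := edge_MShat e'T.
have [hp _ _ _] := seg_sub (edges_nondegenerate tT (interior_edges_sub eI)) ep.
have E : p = q.
  apply: (MShat_vertex_uniq vT pM' qM); first by rewrite -hp -h' he.
    exact/ep/(germ_seg g).
  exact/eq/(germ_seg g').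
by apply: MS_edge_interior pM e'T _; rewrite E.
Qed.

Lemma germ_neqb b x y c c' v : c \in cells T -> c' \in cells T ->
  quad b x y c v -> quad b x (~~ y) c' v -> c <> c' ->
  exists2 e, e \in interior_edges T & egerm T b x v e.
Proof.
case: y => cT c'T Q Q' ne.
  by have [e [eI g _ _]] := germ_neq rT cT c'T Q Q' ne; exists e.
by have [e [eI g _ _]] := germ_neq rT c'T cT Q' Q (nesym ne); exists e.
Qed.

(* A reentrant corner of the domain would be the end of an interior and of a
   boundary maximal segment of the same direction. *)
Lemma no_reentrant_corner b x y v : filled T b (~~ x) y v -> filled T b x (~~ y) v ->
  filled T b (~~ x) (~~ y) v -> filled T b x y v.
Proof.
move=> [c1 c1T Q1] [c2 c2T Q2] [c0 c0T Q0]; apply: contrapT => nF.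
have nQ c : c \in cells T -> ~~ quad b x y c v by move=> cT; apply/negP => Q; apply: nF; exists c.
(* Both sides of the empty quadrant carry edges; they are not interior, since an interior edge has
   cells on both sides. *)
have [e1 g1] : exists e, egerm T b x v e.
  by apply: (cell_side_edge rT c2T Q2); rewrite negbK nQ.
have [e2 g2] : exists e, egerm T (~~ b) y v e.
  by apply: (@cell_side_edge _ _ rT _ y (~~ x) c1 _ c1T); rewrite ?negbK quadC ?nQ.
have n1 : e1 \notin interior_edges T.
  by apply/negP => eI; apply: nF; exact: germ_filled eI g1.
have n2 : e2 \notin interior_edges T.
  by apply/negP => eI; apply: nF; apply/filledC; exact: germ_filled eI g2.
have vT : v \in vertices T.
  have [e1T h1 _ _] := g1; have [e2T h2 _ _] := g2.
  apply: (edges_vertex rT e1T e2T _ (germ_seg g1) (germ_seg g2)) => E.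
  by move: h2; rewrite -E h1; case: (b).
(* Otherwise an interior edge separating the two cells would be collinear with [e1]. *)
have E1 : c1 = c0.
  apply: contrapT => ne; have [e eI g] := germ_neqb c1T c0T Q1 Q0 ne.
  by case/negP: n1; exact: germ_kind vT g g1 eI.
have E2 : c2 = c0.
  apply: contrapT => ne; rewrite -quadC in Q2; rewrite -quadC in Q0.
  have [e eI g] := germ_neqb c2T c0T Q2 Q0 ne.
  by case/negP: n2; exact: germ_kind vT g g2 eI.
(* A single cell filling three quadrants fills the fourth. *)
subst c1 c2; case/negP: (nQ _ c0T); move: Q1 Q2; rewrite /quad.
by move=> /andP[_ ->] /andP[-> _].
Qed.

End Segments.

(** * Shape of the domain *)

Lemma neqNb (b b' : bool) : b' != b -> b' = ~~ b.
Proof. by case: b b' => -[]. Qed.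

(** Used for inductions that decrease a real coordinate among finitely many values. *)
Lemma card_fset_lt (K : choiceType) (A : {fset K}) (P Q : pred K) c :
  (forall d, P d -> Q d) -> c \in A -> Q c -> ~~ P c ->
  (#|` [fset d in A | P d]%fset| < #|` [fset d in A | Q d]%fset|)%N.
Proof.
move=> PQ cA Qc Pc; apply: fproper_ltn_card; rewrite fproperE; apply/andP; split.
  by apply/fsubsetP => d; rewrite !inE /= => /andP[-> /PQ].
apply/negP => /fsubsetP/(_ c); rewrite !inE /= cA Qc (negPf Pc).
by move=> /(_ isT).
Qed.

Section Domain.
Variables (R : realType) (T : mesh R).
Implicit Types (b x y s : bool) (c : rect R) (e : segm R) (p q v : R * R) (u w : R).
Hypothesis rT : reduced T.
Let tT : is_tmesh T := reduced_is_tmesh rT.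

Lemma cell_center c : c \in cells T -> exists q, forall b, clo b c < coord b q < chi b c.
Proof.
move=> cT; have [u hu] := between (cell_lt tT true cT).
have [w hw] := between (cell_lt tT false cT).
by exists (u, w); case.
Qed.

Section Constant.
Variables (V : Type) (f : rect R -> V).
Hypothesis f_edge : forall e c c', e \in interior_edges T ->
  adj T true e c -> adj T false e c' -> f c = f c'.

Let step b x y y' c c' p : c \in cells T -> c' \in cells T ->
  quad b x y c p -> quad b x y' c' p -> f c = f c'.
Proof.
move=> cT c'T; have [->|/eqP ne] := eqVneq c c'; first by [].
case: y; case: y' => Q Q'.
- by case: ne; exact: (quad_uniq tT cT c'T Q Q').
- by have [e [eI _ a1 a0]] := germ_neq rT cT c'T Q Q' ne; exact: f_edge a1 a0.
- by have [e [eI _ a1 a0]] := germ_neq rT c'T cT Q' Q (nesym ne); rewrite (f_edge eI a1 a0).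
- by case: ne; exact: (quad_uniq tT cT c'T Q Q').
Qed.

(** The intermediate cell [d] fills a quadrant adjacent or equal to those of both cells. *)
Lemma constant_at_interior p c c' : (domain T)° p -> c \in cells T -> c' \in cells T ->
  rect_set c p -> rect_set c' p -> f c = f c'.
Proof.
move=> Dp cT c'T cp c'p.
have nd d : d \in cells T -> forall b, clo b d < chi b d by move=> dT b; exact: (cell_lt tT).
have [x [y Q]] := @rect_quad _ true c p (nd _ cT) cp.
have [x' [y' Q']] := @rect_quad _ true c' p (nd _ c'T) c'p.
have [d dT Qd] := (int_filled tT true p).1 Dp x y'.
rewrite (step cT dT Q Qd); rewrite -quadC in Qd; rewrite -quadC in Q'.
exact: step dT c'T Qd Q'.
Qed.

(** The cells with the value [f c] and the others form two closed sets, which cover the connected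
    interior and are disjoint there. *)
Lemma constant_on_cells c c' : c \in cells T -> c' \in cells T -> f c = f c'.
Proof.
move=> cT c'T.
pose S (P : rect R -> Prop) := [set p | exists c, [/\ c \in cells T, P c & rect_set c p]].
have [q cq] := cell_center cT; have [q' c'q'] := cell_center c'T.
have sub d p : (forall b, clo b d < coord b p < chi b d) -> rect_set d p.
  by move=> H; apply/rect_setPb => b; have := H b; order.
have E : (domain T)° `&` S (fun d => f d = f c) = (domain T)°.
  apply: (domain_interior_connected tT).
  - exists q; split; first exact: cell_interior cT cq.
    by exists c; split => //; exact: sub.
  - exists (~` S (fun d => f d <> f c)); first exact/closed_openC/closed_cells.
    apply/seteqP; split=> p [Dp H]; split => //.
      move=> [d [dT ne dp]]; apply: ne; have [d' [d'T <- d'p]] := H.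
      exact: constant_at_interior Dp _ _ dp d'p.
    have [d /= dT dp] := interior_subset Dp; exists d; split => //.
    by apply: contrapT => ne; apply: H; exists d.
  - by exists (S (fun d => f d = f c)); first exact: closed_cells.
have : (domain T)° q' by exact: cell_interior c'T c'q'.
rewrite -E => -[_ [d [dT <- dq]]].
by rewrite (cell_int tT c'T dT c'q' dq).
Qed.

End Constant.

Lemma cell_min b : exists a, (exists2 c, c \in cells T & clo b c = a) /\
  forall c, c \in cells T -> a <= clo b c.
Proof.
have [[[p [c0 /= c0T _]] _] _] := domain_simply_connected tT.
suff K (L : seq (rect R)) c : exists2 c', c' \in c :: L & forall d, d \in c :: L -> clo b c' <= clo b d.
  have [c cL H] := K (cells T) c0; exists (clo b c); split.
    by exists c => //; move: cL; rewrite inE => /orP[/eqP ->|].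
  by move=> d dT; apply: H; rewrite inE dT orbT.
elim: L c => [|c1 L IH] c.
  by exists c; rewrite ?mem_head // => d; rewrite inE => /eqP ->.
have [c' c'L H] := IH c1; have [le|lt] := leP (clo b c) (clo b c').
  exists c; rewrite ?mem_head // => d; rewrite inE => /orP[/eqP -> //|/H]; exact: le_trans.
exists c'; first by rewrite inE c'L orbT.
by move=> d; rewrite inE => /orP[/eqP ->|/H //]; exact: ltW.
Qed.

Lemma quad_line b x' y' s c p l h q u : window T p l h -> c \in cells T ->
  aheadb (~~ b) s p l h q ->
  quad b x' y' c (mkpt b u (coord (~~ b) q)) = quad b x' s c (mkpt b u (coord (~~ b) p)).
Proof.
by move=> W cT qy; rewrite /quad !coord_mkpt !coordN_mkpt (sideb_move y' W cT qy).
Qed.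

(** A line displaced slightly to the side [s] meets exactly the cells that fill the quadrants on
    this side of the original line. The window constrains only the transversal coordinate, so this
    holds along the whole line. *)
Lemma int_line b s p l h q u : window T p l h -> aheadb (~~ b) s p l h q ->
  (domain T)° (mkpt b u (coord (~~ b) q)) <->
  forall x', filled T b x' s (mkpt b u (coord (~~ b) p)).
Proof.
move=> W qy; rewrite (int_filled tT b); split=> H.
  by move=> x'; have [c cT] := H x' s; rewrite (quad_line _ _ _ W cT qy); exists c.
by move=> x' y'; have [c cT] := H x'; rewrite -(quad_line _ y' _ W cT qy); exists c.
Qed.

Lemma ahead_trichotomy b p l h q : box l h q ->
  coord b q = coord b p \/ exists s, aheadb b s p l h q.
Proof.
move=> /(_ b) qb; rewrite /aheadb; have [lt|lt|->] := ltgtP (coord b q) (coord b p).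
- by right; exists false => /=; order.
- by right; exists true => /=; order.
- by left.
Qed.

Section Lower.
Variables (b : bool) (a : R).
Hypothesis aP : (exists2 c, c \in cells T & clo b c = a) /\
  forall c, c \in cells T -> a <= clo b c.

(* If the side [s] of a line is filled, the absence of reentrant corners
   propagates the other side along cells. *)
Lemma interior_left s w u0 :
  (forall u, a < u <= u0 -> forall x', filled T b x' s (mkpt b u w)) ->
  (domain T)° (mkpt b u0 w) -> forall u, a < u <= u0 -> (domain T)° (mkpt b u w).
Proof.
have [n le] := ubnP #|` [fset c in cells T | clo b c < u0]%fset|.
elim: n u0 le => // n IH u0 le F D0 u /andP[au uu0].
(* With both quadrants on the side [s] filled, one on the other side suffices, by absence of
   reentrant corners. *)
have K x (v : R) : a < v <= u0 -> filled T b x (~~ s) (mkpt b v w) -> (domain T)° (mkpt b v w).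
  move=> av Fx; apply/(int_filled tT b) => x' y'.
  have [->|ne] := eqVneq y' s; first exact: F.
  rewrite (neqNb ne).
  have [->//|ne'] := eqVneq x' x.
  apply: (no_reentrant_corner rT); rewrite ?negbK; try exact: F.
  by rewrite (neqNb ne') negbK.
have [c cT /[dup] Qc /andP[]] := (int_filled tT b _).1 D0 false (~~ s).
rewrite coord_mkpt coordN_mkpt => /= sc sy.
(* Either the cell to the left of [u0] on the missing side reaches beyond [u], or the induction
   restarts from its left end. *)
have [lt|ge] := ltP (clo b c) u.
  apply: (K false); first by rewrite au.
  by exists c => //; rewrite /quad coord_mkpt coordN_mkpt sy andbT /=; order.
have aus : a < clo b c by order.
apply: (IH (clo b c)); last by rewrite au.
- rewrite ltnS in le; apply: leq_trans le.
  by apply: (card_fset_lt (c := c)); rewrite ?ltxx //; [move=> d dc; order | order].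
- by move=> v hv; apply: F; order.
- apply: (K true); first by order.
  exists c => //; rewrite /quad coord_mkpt coordN_mkpt sy andbT /=.
  by rewrite lexx (cell_lt tT).
Qed.

(* The set of the points [p] with this property is open and closed in the
   connected interior of the domain. *)
Lemma interior_lower p u : (domain T)° p -> a < u <= coord b p ->
  (domain T)° (mkpt b u (coord (~~ b) p)).
Proof.
pose B := [set p | (domain T)° p /\ forall u, a < u <= coord b p ->
  (domain T)° (mkpt b u (coord (~~ b) p))].
suff E : (domain T)° = B by rewrite [X in X p -> _]E => -[_ H]; exact: H.
have oD : open (domain T)° by exact: open_interior.
have mkb l h q q' (v : R) : box l h q -> box l h q' -> coord b q < v <= coord b q' ->
    forall w, coord (~~ b) l < w < coord (~~ b) h -> box l h (mkpt b v w).
  move=> /(_ b) qb /(_ b) q'b hv w hw b'.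
  have [->|ne] := eqVneq b' b; first by rewrite coord_mkpt; order.
  by rewrite (neqNb ne) coordN_mkpt.
have [a_ex a_le] := aP.
apply/esym/(domain_interior_connected tT).
- have [c cT ca] := a_ex; have [q cq] := cell_center cT; exists q; split.
    exact: cell_interior cT cq.
  move=> v hv; apply: (cell_interior tT cT) => b'; have := cq b'; have := cq b.
  have [->|ne] := eqVneq b' b; first by rewrite coord_mkpt ca => *; order.
  by rewrite (neqNb ne) coordN_mkpt.
(* Openness: beyond [q] the window is interior; before it, the line through [q] is interior and so
   are the nearby parallel lines. *)
- exists B; last by apply/esym/setIidPr => q [].
  rewrite openE => q [Dq Bq].
  have [l [h [W bD]]] := window_nbhs T (open_nbhs_nbhs (conj oD Dq)).
  apply/interior_box; exists l, h; split; first exact: proj1 W.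
  move=> q' qb'; split=> [|v /andP[av vq']]; first exact: bD.
  have [le|lt] := leP v (coord b q); last first.
    by apply/bD/(mkb _ _ _ _ _ (proj1 W) qb'); [rewrite lt | exact: qb'].
  have Dv : (domain T)° (mkpt b v (coord (~~ b) q)) by apply: Bq; rewrite av.
  have [->//|[s sq]] := ahead_trichotomy (~~ b) q qb'.
  by apply/(int_line _ W sq) => x'; exact: (int_filled tT b _).1 Dv x' s.
(* Closedness: a nearby point [q'] of [B] fills one side of the line through [q], and
   [interior_left] fills the other. *)
- exists (closure B); first exact: closed_closure.
  apply/seteqP; split=> q; first by move=> Bq; split; [case: Bq | exact: subset_closure].
  move=> [Dq /closure_box clq]; split => // v /andP[av vq].
  have [l [h [W bD]]] := window_nbhs T (open_nbhs_nbhs (conj oD Dq)).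
  have [q' [[Dq' Bq'] qb']] := clq _ _ (proj1 W).
  have M z w : a < z <= coord b q -> coord (~~ b) l < w < coord (~~ b) h ->
      coord b q' < z -> (domain T)° (mkpt b z w).
    by move=> hz hw lt; apply/bD/(mkb _ _ _ _ _ qb' (proj1 W)) => //; order.
  have [E|[s sq]] := ahead_trichotomy (~~ b) q qb'.
    have [le|lt] := leP v (coord b q'); first by rewrite -E; apply: Bq'; rewrite av.
    by apply: M lt; [rewrite av | exact: (proj1 W)].
  apply: (@interior_left s _ (coord b q)); last by rewrite av.
    move=> z hz x'; apply: (int_line z W sq).1.
    have [le|lt] := leP z (coord b q'); first by apply: Bq'; order.
    by apply: M lt => //; exact: qb'.
  by rewrite mkptK.
Qed.

End Lower.

(* The lower left corners of the domain are the points [v] satisfying the left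
   hand side. *)
Lemma unique_corner : exists o, forall v,
  (filled T true true true v /\ forall b, ~ filled T b false true v) <-> v = o.
Proof.
have [a1 A1] := cell_min true; have [a2 A2] := cell_min false.
pose a b := if b then a1 else a2.
have A b : (exists2 c, c \in cells T & clo b c = a b) /\
  forall c, c \in cells T -> a b <= clo b c by case: b.
have oE b : coord b (a1, a2) = a b by case: b.
exists (a1, a2) => v; split.
  move=> [[c cT Qc] N].
  suff K b : coord b v = a b by apply: (@coord_inj _ true); rewrite K oE.
  have Qb : quad b true true c v by case: (b) => //; rewrite (quadC true).
  have [sb _] := andP Qb; have lea := (A b).2 _ cT; rewrite /= in sb.
  (* If [v] were not extremal, moving backwards from a point inside [c] to the line through [v]
     would stay in the interior and fill the quadrant behind [v]. *)
  have [lt|le] := ltP (a b) (coord b v); last by order.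
  exfalso; apply: (N b); have [l [h W]] := window_ex T v.
  have [q [qb qx qy]] := move2_ex b true true (proj1 W).
  have Dq : (domain T)° q.
    apply: (cell_interior tT cT); apply: (@quad_int _ b) => x' y'.
    by rewrite (quad_move2 x' y' W cT qx qy).
  have /(int_filled tT b)/(_ false true) : (domain T)° (mkpt b (coord b v) (coord (~~ b) q)).
    by apply: (interior_lower (A b)) => //; rewrite /aheadb /= in qx; order.
  by move=> [d dT]; rewrite (quad_line _ _ _ W dT qy) mkptK; exists d.
move=> ->; split; last first.
  move=> b [c cT /andP[+ _]]; rewrite oE /= => sb.
  by have := (A b).2 _ cT => le; order.
have [[c0 c0T _] _] := A true; have [p cp] := cell_center c0T.
have Dp := cell_interior tT c0T cp; have [l [h W]] := window_ex T (a1, a2).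
(* From the inside of any cell, moving left and then down in the interior reaches the window of the
   point [(a1, a2)]. *)
have K b : exists u, a b < u < coord b h /\ u <= coord b p.
  have [h1 h2] : a b < coord b h /\ a b < coord b p.
    split; first by have := proj1 W b; rewrite oE; order.
    by have := (A b).2 _ c0T; have := cp b; order.
  have [|u] := @between _ (a b) (Num.min (coord b h) (coord b p)).
    by rewrite lt_min h1.
  by rewrite lt_min => /andP[k1 /andP[k2 k3]]; exists u; rewrite k1 k2 ltW.
have [u [u1 u2]] := K true; have [w [w1 w2]] := K false.
have D1 : (domain T)° (mkpt true u p.2).
  by apply: (interior_lower (A true) Dp); order.
have D2 : (domain T)° (mkpt false w u).
  by apply: (interior_lower (A false) D1); order.
have [c cT Q] := (int_filled tT true _).1 D2 true true; exists c => //.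
rewrite -(quad_move2 true true W cT (q := (u, w))) //; rewrite /aheadb /= oE; order.
Qed.

End Domain.

(** * Euler's formula *)

Lemma sum_reindex (I J : eqType) (M : nmodType) (s : seq I) (t : seq J)
    (P : pred I) (Q : pred J) (f : I -> J) (F : I -> M) (G : J -> M) :
  uniq s -> uniq t ->
  (forall i j, i \in s -> j \in s -> P i -> P j -> f i = f j -> i = j) ->
  (forall i, i \in s -> P i -> [/\ f i \in t, Q (f i) & F i = G (f i)]) ->
  (forall j, j \in t -> Q j -> exists i, [/\ i \in s, P i & f i = j]) ->
  \sum_(i <- s | P i) F i = \sum_(j <- t | Q j) G j.
Proof.
move=> us ut fI fP fS; rewrite -[RHS]big_filter -[LHS]big_filter.
transitivity (\sum_(i <- [seq x <- s | P x]) G (f i)).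
  rewrite !big_seq; apply: eq_bigr => i; rewrite mem_filter => /andP[Pi si].
  by have [] := fP _ si Pi.
rewrite -(big_map f xpredT); apply: perm_big; apply: uniq_perm; rewrite ?filter_uniq //.
  rewrite map_inj_in_uniq ?filter_uniq // => i j.
  by rewrite !mem_filter => /andP[Pi si] /andP[Pj sj]; exact: fI.
move=> j; rewrite mem_filter; apply/mapP/andP.
  by move=> [i]; rewrite mem_filter => /andP[Pi si] ->; have [] := fP _ si Pi.
by move=> [Qj tj]; have [i [si Pi <-]] := fS _ tj Qj; exists i; rewrite // mem_filter Pi.
Qed.

Section Count.
Variables (R : realType) (T : mesh R).
Implicit Types (b x y s : bool) (c : rect R) (e : segm R) (p q v : R * R) (u w : R).
Hypothesis rT : reduced T.
Let tT : is_tmesh T := reduced_is_tmesh rT.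

Lemma interior_verticesP v :
  v \in interior_vertices T <-> v \in vertices T /\ (domain T)° v.
Proof.
rewrite /interior_vertices in_fset_cond.
by split=> [/andP[-> /asboolP]|[-> h]] //; exact/asboolP.
Qed.

(** The end from which [e] leaves in direction [x]. *)
Definition tip x e := if x then seg_start e else seg_end e.

Lemma coord_tip x e :
  coord (horiz e) (tip x e) = (if x then lo e else hi e) /\
  coord (~~ horiz e) (tip x e) = cor e.
Proof. by case: x; rewrite /tip /seg_start /seg_end seg_ptE coord_mkpt coordN_mkpt. Qed.

Lemma tip_vertex x e : e \in edges T -> tip x e \in vertices T.
Proof. by case: x; [exact: start_vertex | exact: end_vertex]. Qed.

Lemma tip_seg x e : e \in edges T -> seg_set e (tip x e).
Proof.
by move=> /(edges_nondegenerate tT) lt; case: x; [exact: seg_lo | exact: seg_hi].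
Qed.

Lemma vertex_edge v : v \in vertices T -> exists x e, e \in edges T /\ tip x e = v.
Proof.
rewrite /vertices inE => /orP[] /imfsetP[e /= eT ->]; [exists true|exists false];
  by exists e.
Qed.

Lemma germ_tip b x v e : v \in vertices T ->
  egerm T b x v e <-> [/\ e \in edges T, horiz e = b & tip x e = v].
Proof.
move=> vT; split.
  move=> /[dup] g [eT he ce s]; split => //; have [t1 t2] := coord_tip x e.
  apply: (@coord_inj _ b); rewrite -he ?t1 ?t2 ?he //.
  rewrite -he in s; have [E|E] := vertex_on_edge rT eT vT (germ_seg g);
    rewrite E in s; rewrite -he E; case: (x) s => /=; rewrite ?ltxx ?andbF //.
move=> [eT <- <-]; have [t1 t2] := coord_tip x e; split => //.
rewrite t1; have := edges_nondegenerate tT eT.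
by case: (x) => /= ->; rewrite lexx.
Qed.

Lemma vertex_not_in_cell v c : v \in vertices T -> c \in cells T ->
  ~ forall b, clo b c < coord b v < chi b c.
Proof.
move=> /vertex_edge[x [e [eT <-]]] cT H.
have [c' /= c'T /boundary_rect[c'q]] := edges_in_boundaries tT eT (tip_seg x eT).
by rewrite -(cell_int tT cT c'T H c'q).
Qed.

Definition corner c : R * R := (smin c, tmin c).

Lemma corner_coord b c : coord b (corner c) = clo b c.
Proof. by case: b. Qed.

Lemma corner_quad b c : c \in cells T -> quad b true true c (corner c).
Proof. by move=> cT; rewrite /quad !corner_coord /= !lexx !(cell_lt tT). Qed.

Lemma quad_corner c v : v \in vertices T -> c \in cells T -> quad true true true c v ->
  corner c = v <-> forall b, ~~ quad b true false c v.
Proof.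
move=> vT cT Q; split=> [<- b|H].
  by rewrite /quad !corner_coord /= ltxx andbF.
apply: (@coord_inj _ true); rewrite corner_coord.
  have /andP[_ s] : quad false true true c v by rewrite -quadC in Q.
  by rewrite (side_neq s) //; have := H false; rewrite /quad; rewrite -quadC in Q; case/andP: Q => ->.
have /andP[s1 s] := Q; rewrite (side_neq s) //.
by have := H true; rewrite /quad s1.
Qed.

Lemma corner_vertex c : c \in cells T -> corner c \in vertices T.
Proof.
move=> cT; have K b : exists e, egerm T b true (corner c) e.
  apply: (cell_side_edge rT cT (corner_quad b cT)).
  by rewrite /quad !corner_coord /= ltxx andbF.
have [e g] := K true; have [e' g'] := K false.
apply: (edges_vertex rT _ _ _ (germ_seg g) (germ_seg g')); [by case: g|by case: g'|].
by move=> E; have [_ h _ _] := g; have [_ h' _ _] := g'; rewrite -E h in h'.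
Qed.

Lemma start_germ b v : v \in vertices T ->
  (exists2 e, e \in interior_edges T & horiz e = b /\ seg_start e = v) <->
  (exists2 e, e \in interior_edges T & egerm T b true v e).
Proof.
move=> vT; split=> -[e eI].
  by move=> [he sv]; exists e => //; apply/germ_tip => //; rewrite (interior_edges_sub eI).
by move=> /(germ_tip _ _ _ vT)[_ he sv]; exists e.
Qed.

(* Cells are counted at their lower left corners and edges at their starts. All
   contributions cancel, except at the lower left corner [o] of the domain. *)
Lemma vertex_count o v : v \in vertices T ->
  (filled T true true true v /\ (forall b, ~ filled T b false true v) <-> v = o) ->
  (`[< exists2 c, c \in cells T & corner c = v >] : nat)%:Z
  - (`[< exists2 e, e \in interior_edges T & horiz e = true /\ seg_start e = v >] : nat)%:Z
  - (`[< exists2 e, e \in interior_edges T & horiz e = false /\ seg_start e = v >] : nat)%:Z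
  + (`[< (domain T)° v >] : nat)%:Z = (v == o : nat)%:Z.
Proof.
move=> vT oP; rewrite !(asbool_equiv_eq (start_germ _ vT)).
have [[c cT Q]|nF] := pselect (filled T true true true v); last first.
  rewrite !asboolF.
  - by have [E|//] := eqVneq v o; case: nF; case: (oP.2 E).
  - by move=> /(int_filled tT true) H; apply: nF; exact: H.
  - by move=> [e eI g]; apply: nF; apply/filledC; exact: germ_filled eI g.
  - by move=> [e eI g]; apply: nF; exact: germ_filled eI g.
  - by move=> [d dT E]; apply: nF; exists d; rewrite // -E corner_quad.
have Qb b : quad b true true c v by case: (b) => //; rewrite (quadC true).
(* For the quadrant opposite to that of [c] across the half-line along [b]: [s b] says that [c]
   itself fills it, [f b] that some cell does. *)
pose s b := quad b true false c v; pose f b := `[< filled T b true false v >].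
have sf b : s b ==> f b by apply/implyP => sb; apply/asboolP; exists c.
have ss : ~~ (s true && s false).
  apply/negP => /andP[s1 s2]; apply: (vertex_not_in_cell vT cT).
  apply: (@quad_int _ true) => x y; have := Qb true; move: s1 s2.
  by rewrite /s /quad => /andP[h1 h2] /andP[h3 h4] /andP[h5 h6]; case: x; case: y; apply/andP.
have -> : `[< exists2 c, c \in cells T & corner c = v >] = ~~ s true && ~~ s false.
  apply/asboolP/andP => [[d dT E]|[s1 s2]].
    have Ed : d = c by apply: (quad_uniq tT dT cT _ Q); rewrite -E corner_quad.
    by subst d; have H := (quad_corner vT cT Q).1 E; split; apply: H.
  by exists c => //; apply/(quad_corner vT cT Q); case.
have E b : `[< exists2 e, e \in interior_edges T & egerm T b true v e >] = f b && ~~ s b.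
  apply/asboolP/andP => [[e eI g]|[/asboolP[d dT Qd] sb]].
    split; first by apply/asboolP; exact: germ_filled eI g.
    apply/negP => sb; have a1 := germ_adj rT eI cT g (Qb b).
    by have a0 := germ_adj rT eI cT g sb; have := adj_neq rT a1 a0.
  have [|e [eI g _ _]] := germ_neq rT cT dT (Qb b) Qd; last by exists e.
  by move=> E; move: sb; rewrite /s E Qd.
(* Three filled quadrants suffice, by absence of reentrant corners. *)
have -> : `[< (domain T)° v >] = f true && f false.
  apply/asboolP/andP => [/[dup] /(int_filled tT true) h1 /(int_filled tT false) h2|].
    by split; apply/asboolP; [exact: h1 | exact: h2].
  move=> [/asboolP f1 /asboolP f2]; have {}f2 : filled T true false true v by apply/filledC.
  have f0 : filled T true true true v by exists c.
  apply/(int_filled tT true) => -[] [] //.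
  exact: no_reentrant_corner.
have -> : (v == o) = ~~ f true && ~~ f false.
  apply/eqP/andP => [/oP[_ H]|[/asboolP f1 /asboolP f2]].
    by split; apply/asboolP => h; [apply: (H false) | apply: (H true)]; apply/filledC.
  by apply/oP; split; [exists c | case => h; [apply: f2 | apply: f1]; apply/filledC].
(* What remains is an identity between booleans counted as 0 or 1, under the constraints [sf] and
   [ss]. *)
rewrite !E; move: (sf true) (sf false) ss.
by case: (s true); case: (s false); case: (f true); case: (f false).
Qed.

Lemma sum_fset (K : choiceType) (A : {fset K}) : (#|` A|)%:Z = \sum_(i <- A) (1 : int).
Proof.
rewrite card_fset_sum1; elim: (enum_fset A) => [|a L IH]; first by rewrite !big_nil.
by rewrite !big_cons PoszD IH.
Qed.

(** Sum of [vertex_count] over the vertices: each cell and each interior edge contributes at exactly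
    one vertex, and [o] is itself a vertex. *)
Lemma euler_formula :
  (#|` cells T|)%:Z - (#|` interior_edges T|)%:Z + (#|` interior_vertices T|)%:Z = 1.
Proof.
have [o oP] := unique_corner rT.
have oT : o \in vertices T.
  have [[c cT Q] N] := (oP o).2 erefl.
  suff <- : corner c = o by exact: corner_vertex.
  have K b : coord b o = clo b c.
    have Qb : quad b true true c o by case: (b) => //; rewrite (quadC true).
    have [s _] := andP Qb; apply: (side_neq s); apply/negP => s'; apply: (N b); exists c => //.
    by move: Qb; rewrite /quad s' => /andP[_ ->].
  by apply: (@coord_inj _ true); rewrite corner_coord K.
have ind (I : eqType) (L : seq I) (P : pred I) :
    \sum_(i <- L | P i) (1 : int) = \sum_(i <- L) (P i : nat)%:Z.
  by rewrite big_mkcond; apply: eq_bigr => i _; case: (P i).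
have EV : \sum_(v <- vertices T) (v == o : nat)%:Z = 1.
  by rewrite -ind big_const_seq (_ : count _ _ = 1%N) //= (count_uniq_mem o) ?fset_uniq ?oT.
have EI b : \sum_(e <- interior_edges T | horiz e == b) (1 : int) = \sum_(v <- vertices T)
   (`[< exists2 e, e \in interior_edges T & horiz e = b /\ seg_start e = v >] : nat)%:Z.
  rewrite -ind; apply: (sum_reindex (f := @seg_start R)); rewrite ?fset_uniq //.
  - move=> e e' eI e'I /eqP h /eqP h' E.
    have vT := start_vertex (interior_edges_sub eI).
    apply: (@germ_uniq _ _ rT b true (seg_start e)); apply/germ_tip => //=;
      by split; [exact: interior_edges_sub| | rewrite ?E].
  - move=> e eI /eqP h; split; [exact: start_vertex (interior_edges_sub eI)| |by []].
    by apply/asboolP; exists e.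
  - by move=> v vT /asboolP[e eI [h E]]; exists e; rewrite h.
have EC : \sum_(c <- cells T) (1 : int) = \sum_(v <- vertices T)
   (`[< exists2 c, c \in cells T & corner c = v >] : nat)%:Z.
  rewrite -ind; apply: (sum_reindex (f := corner)); rewrite ?fset_uniq //.
  - move=> c c' cT c'T _ _ E; apply: (quad_uniq tT cT c'T (corner_quad true cT)).
    by rewrite E corner_quad.
  - by move=> c cT _; split; [exact: corner_vertex | apply/asboolP; exists c | ].
  - by move=> v vT /asboolP[c cT E]; exists c.
have EVi : \sum_(v <- interior_vertices T) (1 : int) = \sum_(v <- vertices T)
   (`[< (domain T)° v >] : nat)%:Z.
  rewrite -ind; apply: (sum_reindex (f := id)); rewrite ?fset_uniq //.
  - by move=> v /interior_verticesP[vT Dv] _; split => //; exact/asboolP.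
  - by move=> v vT /asboolP Dv; exists v; split => //; exact/interior_verticesP.
have EN : \sum_(e <- interior_edges T | horiz e != true) (1 : int) =
    \sum_(e <- interior_edges T | horiz e == false) 1.
  by apply: eq_bigl => e; case: (horiz e).
rewrite !sum_fset (bigID (fun e => horiz e == true) _ (fun=> 1)) /= EN.
rewrite EC !EI EVi opprD addrA -!sumrB -big_split /= -EV !big_seq.
by apply: eq_bigr => v vT; exact: vertex_count.
Qed.

Section Cycle.
Variables (V : zmodType) (f : rect R -> V).

Definition adjc y e : rect R := xget (Rect 0 0 0 0) [set c | adj T y e c].

Lemma adjcP y e : e \in interior_edges T -> adj T y e (adjc y e).
Proof. by move=> /(interior_edge_adj rT y)ex; exact: (xgetPex (Rect 0 0 0 0) ex). Qed.

Lemma adjcE y e c : e \in interior_edges T -> adj T y e c -> adjc y e = c.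
Proof.
by move=> eI; apply: (adj_uniq rT (interior_edges_sub eI)); exact: adjcP.
Qed.

Definition jump e : V := f (adjc true e) - f (adjc false e).

(** At most one edge has this germ; it exists if the two cells differ, and all the jumps are zero if
    they agree. *)
Lemma germ_sum b x v c1 c0 : c1 \in cells T -> c0 \in cells T ->
  quad b x true c1 v -> quad b x false c0 v ->
  \sum_(e <- interior_edges T | `[< egerm T b x v e >]) jump e = f c1 - f c0.
Proof.
move=> c1T c0T Q1 Q0.
have J e : e \in interior_edges T -> egerm T b x v e -> adjc true e = c1 /\ adjc false e = c0.
  by move=> eI g; split; apply: adjcE => //; exact: germ_adj g _.
have [E|/eqP ne] := eqVneq c1 c0.
  rewrite E subrr big_seq_cond big1 // => e /andP[eI /asboolP g].
  by rewrite /jump; have [-> ->] := J e eI g; rewrite E subrr.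
have [e [eI g _ _]] := germ_neq rT c1T c0T Q1 Q0 ne.
rewrite big_mkcond (bigD1_seq e) ?fset_uniq //= asboolT // big1 ?addr0.
  by rewrite /jump; have [-> ->] := J e eI g.
move=> e' /eqP ne'; case: asboolP => // g'; case: ne'; exact: (germ_uniq rT g' g).
Qed.

(* [jump] goes from the cell below or to the left of an edge to the other one, so
   that turning around [v] crosses the horizontal and the vertical edges with
   opposite signs. *)
Lemma jump_cycle v : v \in vertices T -> (domain T)° v ->
  \sum_(e <- interior_edges T) (jump e *~ (-1) ^+ horiz e) *~
     ((seg_start e == v)%:Z - (seg_end e == v)%:Z) = 0.
Proof.
move=> vT Dv.
have G b x c1 c0 : c1 \in cells T -> c0 \in cells T -> quad b x true c1 v ->
    quad b x false c0 v ->
    \sum_(e <- interior_edges T) jump e *~ ((horiz e == b) && (tip x e == v)) = f c1 - f c0.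
  move=> c1T c0T Q1 Q0; rewrite -(germ_sum c1T c0T Q1 Q0) [RHS]big_mkcond !big_seq.
  apply: eq_bigr => e eI; rewrite (asbool_equiv_eq (germ_tip _ _ _ vT)).
  have -> : `[< [/\ e \in edges T, horiz e = b & tip x e = v] >] = (horiz e == b) && (tip x e == v).
    apply/asboolP/andP => [[_ -> ->]|[/eqP -> /eqP ->]]; rewrite ?eqxx //.
    by rewrite (interior_edges_sub eI).
  by case: ifP.
have [c1 T1 Q1] := (int_filled tT true v).1 Dv true true.
have [c2 T2 Q2] := (int_filled tT true v).1 Dv true false.
have [c3 T3 Q3] := (int_filled tT true v).1 Dv false true.
have [c4 T4 Q4] := (int_filled tT true v).1 Dv false false.
have g1 := G true true _ _ T1 T2 Q1 Q2; have g2 := G true false _ _ T3 T4 Q3 Q4.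
rewrite -quadC in Q1; rewrite -quadC in Q2; rewrite -quadC in Q3; rewrite -quadC in Q4.
have g3 := G false true _ _ T1 T3 Q1 Q3; have g4 := G false false _ _ T2 T4 Q2 Q4.
(* The contributions of the four half-lines at [v] cancel around the four quadrants. *)
rewrite (_ : \sum_(e <- _) _ = (f c1 - f c3) - (f c2 - f c4) - ((f c1 - f c2) - (f c3 - f c4))).
  apply/eqP; rewrite subr_eq0; apply/eqP; rewrite !opprB addrACA [in RHS]addrACA.
  by congr (_ + _); exact: addrC.
rewrite -g1 -g2 -g3 -g4 -!sumrB; apply: eq_bigr => e _.
rewrite /tip; case: (horiz e); case: eqVneq => _; case: eqVneq => _;
  rewrite ?expr0 ?expr1 ?subrr ?subr0 ?sub0r ?mulr0z ?mulr1z ?mulrN1z ?subr0 ?sub0r ?opprK ?subrr ?oppr0 //.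
Qed.

End Cycle.

End Count.

(** * Vanishing of the cokernel *)

Section Homology.
Variables (R : realType) (T : mesh R).
Implicit Types (b x y s : bool) (c : rect R) (e p q : segm R) (u v : R * R).
Hypothesis rT : reduced T.
Let tT : is_tmesh T := reduced_is_tmesh rT.

Definition height v : R := v.1 + v.2.

Lemma heightE b v : height v = coord b v + coord (~~ b) v.
Proof. by case: b => //=; rewrite addrC. Qed.

(* From any interior vertex an edge leads to the left or downwards. *)
Lemma edge_function_eq0 (V : zmodType) (g : R * R -> V) :
  (forall v, ~ (domain T)° v -> g v = 0) ->
  (forall e, e \in interior_edges T -> g (seg_start e) = g (seg_end e)) ->
  forall v, v \in vertices T -> g v = 0.
Proof.
move=> g0 gE v; have [n] := ubnP #|` [fset w in vertices T | height w < height v]%fset|.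
elim: n v => // n IH v lev vT; have [Dv|] := pselect ((domain T)° v); last exact: g0.
have [c cT Q] := (int_filled tT true v).1 Dv false false.
(* A vertex is not interior to a cell, so [v] is on the right or upper side of [c]; an edge along
   this side leads back from [v]. *)
have [b hb] : exists b, coord b v = chi b c.
  apply: contrapT => H; apply: (vertex_not_in_cell rT vT cT) => b.
  have [s _] : side false (clo b c) (chi b c) (coord b v) /\ True.
    by split; case: (b); case/andP: Q.
  move: s => /andP[-> le] /=; rewrite lt_neqAle le andbT; apply/eqP => E.
  by apply: H; exists b.
have Qb : quad (~~ b) false false c v by case: (b) => //; rewrite -[false]/(~~ true) (quadC true).
have [|e g'] := cell_side_edge rT cT Qb.
  by rewrite /quad negbK hb /= ltxx andbF andbF.
have eI := germ_int g' Dv; have [eT he tv] := (germ_tip rT _ _ _ vT).1 g'.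
rewrite -tv /tip -gE //; apply: IH; last exact: start_vertex eT.
have [h1 h2] := coord_tip true e; have [h3 h4] := coord_tip false e.
have lt : height (seg_start e) < height v.
  rewrite -tv !(heightE (horiz e)) h2 h4 ltrD2r.
  by move: h1 h3 => /= -> ->; exact: (edges_nondegenerate tT).
rewrite ltnS in lev; apply: leq_trans lev; apply: (card_fset_lt (c := seg_start e)).
- by move=> w hw; exact: lt_trans hw lt.
- exact: start_vertex.
- exact: lt.
- by rewrite ltxx.
Qed.

(** No grid value lies strictly between [v] and a point of [p] just before it, so the edge through
    that point reaches [v] and ends there. *)
Lemma MS_pred p v : p \in MS T -> v \in vertices T -> seg_set p v ->
  lo p < coord (horiz p) v -> exists e,
  [/\ e \in interior_edges T, seg_set e `<=` seg_set p & seg_end e = v].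
Proof.
move=> pM vT /seg_setP[/andP[l1 l2] l3] lt; have [l [h W]] := window_ex T v.
have [w hw] : exists w, Num.max (coord (horiz p) l) (lo p) < w < coord (horiz p) v.
  by apply: between; rewrite gt_max lt andbT; have := proj1 W (horiz p); order.
rewrite gt_max in hw; have {hw}[/andP[w1 w2] w3] := andP hw.
pose q := mkpt (horiz p) w (cor p).
have pq : seg_set p q by apply/seg_setP; rewrite /q coord_mkpt coordN_mkpt; split => //; order.
have [e [eI eq ep]] := MS_edge rT pM pq; have eT := interior_edges_sub eI.
have [he ce le ge] := seg_sub (edges_nondegenerate tT eT) ep.
have [/andP[q1 q2] q3] := (seg_setP _ _).1 eq; rewrite he coord_mkpt in q1 q2.
have hv : coord (horiz p) v <= hi e.
  rewrite leNgt; apply/negP => lt'; have [_ g2 _] := grid_edge eT.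
  have E : hi e = coord (horiz p) v.
    by apply: (proj2 W) => //; have := proj1 W (horiz p); order.
  by rewrite E ltxx in lt'.
have ev : seg_set e v by apply/seg_setP; rewrite he ce; split => //; order.
exists e; split => //; have [h3 h4] := coord_tip false e.
apply: (@coord_inj _ (horiz p)); last by rewrite -he h4 he l3 ce.
rewrite -he h3; have [E|->//] := vertex_on_edge rT eT vT ev.
by rewrite he in E; rewrite -E in q1; order.
Qed.

Lemma MS_constant p (V : Type) (g : R * R -> V) : p \in MS T ->
  (forall e, e \in interior_edges T -> seg_set e `<=` seg_set p ->
     g (seg_start e) = g (seg_end e)) ->
  forall v w, v \in vertices T -> w \in vertices T -> seg_set p v -> seg_set p w ->
  g v = g w.
Proof.
move=> pM gE; suff H v : v \in vertices T -> seg_set p v -> g v = g (seg_start p).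
  by move=> v w vT wT pv pw; rewrite H // [RHS]H.
have [n] := ubnP #|` [fset w in vertices T | coord (horiz p) w < coord (horiz p) v]%fset|.
elim: n v => // n IH v lev vT /[dup] pv /seg_setP[/andP[l1 l2] l3].
have [lt|ge] := ltP (lo p) (coord (horiz p) v); last first.
  congr g; have [h3 h4] := coord_tip true p.
  by apply: (@coord_inj _ (horiz p)); rewrite ?h3 ?h4 //=; order.
have [e [eI ep ev]] := MS_pred pM vT pv lt; have eT := interior_edges_sub eI.
have ltE := edges_nondegenerate tT eT; have [he ce le ge] := seg_sub ltE ep.
rewrite -ev -gE //; have [h1 h2] := coord_tip true e; have [h3 h4] := coord_tip false e.
have lt' : coord (horiz p) (seg_start e) < coord (horiz p) v.
  by rewrite -ev -he; move: h1 h3 => /= -> ->.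
apply: IH; [|exact: start_vertex|by apply: ep; exact: seg_lo].
rewrite ltnS in lev; apply: leq_trans lev; apply: (card_fset_lt (c := seg_start e)).
- by move=> w hw; exact: lt_trans hw lt'.
- exact: start_vertex.
- exact: lt'.
- by rewrite ltxx.
Qed.

Lemma MIS_MS p : p \in MIS T -> p \in MS T.
Proof. by rewrite /MIS in_fset_cond => /andP[]. Qed.

Lemma MS_domain p u : p \in MS T -> seg_set p u -> domain T u.
Proof.
move=> pM /(MS_edge rT pM)[e [eI eu _]]; have [c ec] := interior_edge_adj rT true eI.
by exists c; [case: ec | exact: adj_sub (interior_edges_sub eI) ec _ eu].
Qed.

Lemma MIS_interior p u : p \in MIS T -> seg_set p u -> (domain T)° u.
Proof.
move=> pM pu; apply: contrapT => nD; have pMS := MIS_MS pM.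
move: pM; rewrite /MIS in_fset_cond => /andP[_ /asboolP].
move=> E; have : (seg_set p `&` boundary (domain T)) u.
  split => //; apply: (boundary_domain T u).2.
  by split => //; exact: MS_domain pu.
by rewrite E.
Qed.

(** The segment meets the boundary of the domain, and not inside an open interior edge. *)
Lemma MS_boundary_vertex p : p \in MS T -> p \notin MIS T -> exists u,
  [/\ u \in vertices T, seg_set p u & ~ (domain T)° u].
Proof.
move=> pM; rewrite /MIS in_fset_cond pM /= => /asboolP /eqP /set0P[u [pu]].
move=> /(boundary_domain T)[_ nD]; exists u; split => //.
have [e [eI eu _]] := MS_edge rT pM pu; have [/andP[h1 h2] h3] := (seg_setP _ _).1 eu.
have eT := interior_edges_sub eI; have [t1 t2] := coord_tip true e.
have [t3 t4] := coord_tip false e.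
have [lt1|ge1] := ltP (lo e) (coord (horiz e) u); last first.
  suff -> : u = tip true e by exact: tip_vertex.
  by apply: (@coord_inj _ (horiz e)); rewrite ?t1 ?t2 //=; order.
have [lt2|ge2] := ltP (coord (horiz e) u) (hi e); last first.
  suff -> : u = tip false e by exact: tip_vertex.
  by apply: (@coord_inj _ (horiz e)); rewrite ?t3 ?t4 //=; order.
by case: nD; apply: (interior_edge_open rT eI) => //; rewrite lt1.
Qed.

(** Intersection of the lines of two perpendicular segments, whether or not the segments meet. *)
Definition cross p q : R * R := mkpt (horiz p) (cor q) (cor p).

Lemma meet_cross p q v : horiz q = ~~ horiz p -> seg_set p v -> seg_set q v -> v = cross p q.
Proof.
move=> h /seg_setP[_ p2] /seg_setP[_]; rewrite h negbK => q2.
by apply: (@coord_inj _ (horiz p)); rewrite /cross ?coord_mkpt ?coordN_mkpt.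
Qed.

Lemma MShat_edge p u : p \in MShat T -> seg_set p u ->
  exists e, [/\ e \in edges T, horiz e = horiz p, seg_set e u & seg_set e `<=` seg_set p].
Proof.
move=> pM pu; suff [e [eT eu ep]] : exists e, [/\ e \in edges T, seg_set e u & seg_set e `<=` seg_set p].
  by exists e; have [] := seg_sub (edges_nondegenerate tT eT) ep.
case: (MShat_cases pM) => pM'.
  by have [e [eI eu ep]] := MS_edge rT pM' pu; exists e; rewrite (interior_edges_sub eI).
by have [e [eB eu ep]] := BMS_edge rT pM' pu; exists e; rewrite (boundary_sub eB).
Qed.

Lemma meet_vertex p q v : p \in MShat T -> q \in MShat T -> horiz q = ~~ horiz p ->
  seg_set p v -> seg_set q v -> v \in vertices T.
Proof.
move=> pM qM h /(MShat_edge pM)[e [eT he ev _]] /(MShat_edge qM)[f [fT hf fv _]].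
apply: (edges_vertex rT eT fT _ ev fv) => E.
by move: h; rewrite -he -hf E; case: (horiz f).
Qed.

Section Smoothness.
Variable r : segm R -> int.
Hypotheses (sr : smoothness T r) (cr : constant_along T r).

Lemma seg_smoothnessE p e : p \in MS T -> e \in edges T -> seg_set e `<=` seg_set p ->
  seg_smoothness T r p = r e.
Proof.
move=> pM eT ep; rewrite /seg_smoothness.
have [e' [e'T e'p ->]] : [set z | exists e', [/\ e' \in edges T, seg_set e' `<=` seg_set p & z = r e']]
    (xget (-1) [set z | exists e', [/\ e' \in edges T, seg_set e' `<=` seg_set p & z = r e']]).
  by apply: xgetPex; exists (r e), e.
exact: cr e'p ep.
Qed.

Lemma seg_smoothness_ge p : p \in MS T -> -1 <= seg_smoothness T r p.
Proof.
move=> pM; have pu := seg_lo (MShat_lt rT (MS_MShat rT pM)).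
have [e [eI _ ep]] := MS_edge rT pM pu; have eT := interior_edges_sub eI.
by rewrite (seg_smoothnessE pM eT ep); exact: smoothness_ge sr _ eT.
Qed.

Variables m m' : nat.

Definition ms_ideal p := line_ideal m m' (horiz p) (cor p) `|(seg_smoothness T r p + 1)%R|%N.

Lemma edge_ms_ideal p e : p \in MS T -> e \in edges T -> seg_set e `<=` seg_set p ->
  edge_ideal m m' r e = ms_ideal p.
Proof.
move=> pM eT ep; have [he ce _ _] := seg_sub (edges_nondegenerate tT eT) ep.
by rewrite edge_idealE /ms_ideal he ce (seg_smoothnessE pM eT ep).
Qed.

(** The weight [mu_h] or [mu_v] counted on [p] at its crossing with [q], read off from the
    transversal segment [q]. *)
Definition ms_weight p q : int :=
  Num.max ((if horiz p then m%:Z else m'%:Z) - seg_smoothness T r q) 0.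

(* The maximal interior segments removed by the deletion algorithm: the
   transversal segments in [Q] either reach the boundary of the domain, or have
   been removed before. *)
Inductive removable : segm R -> Prop :=
  Removable p (Q : seq (segm R)) : uniq Q ->
    (forall q, q \in Q ->
       [/\ q \in MS T, horiz q = ~~ horiz p & seg_set p `&` seg_set q !=set0]) ->
    (forall q, q \in Q -> q \in MIS T -> removable q) ->
    threshold m m' p <= \sum_(q <- Q) ms_weight p q ->
    removable p.

(** * Functionals on the vertices that annihilate the image of the ideals of the edges *)

Section Functional.
Variable l : R * R -> 'M[R]_(m.+1, m'.+1) -> R.
Hypothesis linl : forall v a P Q, l v (a *: P + Q) = a * l v P + l v Q.
Hypothesis l0 : forall v P, ~ (domain T)° v -> l v P = 0.
Hypothesis lE : forall e P, e \in interior_edges T -> P \in edge_ideal m m' r e ->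
  l (seg_start e) P = l (seg_end e) P.

Lemma functional_MS p v w P : p \in MS T -> v \in vertices T -> w \in vertices T ->
  seg_set p v -> seg_set p w -> P \in ms_ideal p -> l v P = l w P.
Proof.
move=> pM vT wT pv pw PI; apply: (MS_constant (g := l^~ P) pM) => // e eI ep.
by apply: lE => //; rewrite (edge_ms_ideal pM) // interior_edges_sub.
Qed.

Definition kills p := forall v P, v \in vertices T -> seg_set p v -> P \in ms_ideal p -> l v P = 0.

(** On [ms_ideal p] the functional is constant along [p], and it is zero at a boundary vertex. *)
Lemma kills_boundary p : p \in MS T -> p \notin MIS T -> kills p.
Proof.
move=> pM /(MS_boundary_vertex pM)[u [uT pu nD]] v P vT pv PI.
by rewrite (functional_MS pM vT uT pv pu PI); exact: l0.
Qed.

(** As smoothness is at least -1, the positive part of [m - r] is the truncated difference of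
    [m + 1] and the exponent [r + 1], as counted in [ideal_cover]. *)
Lemma ms_weightE p q : q \in MS T -> ms_weight p q =
  ((if horiz p then m else m').+1 - `|(seg_smoothness T r q + 1)%R|)%N%:Z.
Proof.
move=> /seg_smoothness_ge; rewrite /ms_weight; move: (seg_smoothness T r q) => z hz.
by case: (horiz p); lia.
Qed.

Lemma kills_removable p : p \in MS T -> removable p -> kills p.
Proof.
move=> + rp; elim: rp => {}p Q uQ QP _ IH le pM v P vT pv.
have pH := MS_MShat rT pM.
apply: (@ideal_cover R m m' (horiz p) (cor p) _
  [seq (cor q, `|(seg_smoothness T r q + 1)%R|%N) | q <- Q] (l v)); first exact: linl.
(* Transversals with the same coordinate cross [p] at the same vertex, hence coincide. *)
- rewrite -map_comp map_inj_in_uniq // => q q' qQ q'Q /= E.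
  have [qM hq [u [pu qu]]] := QP _ qQ; have [q'M hq' [u' [pu' qu']]] := QP _ q'Q.
  have E' : u' = u by rewrite (meet_cross hq pu qu) (meet_cross hq' pu' qu') /cross E.
  have qH := MS_MShat rT qM; have q'H := MS_MShat rT q'M.
  apply: (MShat_vertex_uniq rT (meet_vertex pH qH hq pu qu) qH q'H _ qu).
    by rewrite hq hq'.
  by rewrite -E'.
- rewrite big_map -lez_nat; apply: le_trans (le_trans _ le) _.
    by rewrite /threshold; case: (horiz p).
  rewrite (big_morph Posz PoszD (erefl _)) !big_seq; apply: ler_sum => q qQ.
  by have [qM _ _] := QP _ qQ; rewrite ms_weightE.
- move=> _ {}P /mapP[q qQ ->] /= P1 P2; have [qM hq [u [pu qu]]] := QP _ qQ.
  have uT := meet_vertex pH (MS_MShat rT qM) hq pu qu.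
  (* The value is carried along [p] to its crossing [u] with [q], where [q] reaches the boundary or
     is removable itself. *)
  rewrite (functional_MS pM vT uT pv pu P1).
  have [qI|nI] := boolP (q \in MIS T); last first.
    by apply: (kills_boundary qM nI uT qu); rewrite /ms_ideal hq.
  by apply: (IH _ qQ qI qM _ _ uT qu); rewrite /ms_ideal hq.
Qed.

Lemma functional_eq0_edge : (forall p, p \in MIS T -> removable p) ->
  forall v e P, v \in vertices T -> e \in interior_edges T -> seg_set e v ->
  P \in edge_ideal m m' r e -> l v P = 0.
Proof.
move=> H v e P vT eI ev; have [p [pM _ ep]] := edge_MS rT eI.
rewrite (edge_ms_ideal pM (interior_edges_sub eI) ep).
have [pI|nI] := boolP (p \in MIS T).
  by apply: (kills_removable pM (H _ pI) vT); exact: ep.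
by apply: (kills_boundary pM nI vT); exact: ep.
Qed.

End Functional.

End Smoothness.

End Homology.

(** * The dimension formula for a single mesh *)

Section Dimension.
Variables (R : realType) (T : mesh R) (m m' : nat).
Hypothesis rT : reduced T.
Let tT : is_tmesh T := reduced_is_tmesh rT.
Local Notation vT := 'M[R]_(m.+1, m'.+1).
Local Notation C := (cells T).
Local Notation E := (interior_edges T).
Local Notation V := (interior_vertices T).

Fact adjc_cell y (e : E) : adjc T y (val e) \in cells T.
Proof. by have [] := adjcP rT y (valP e). Qed.

Definition side_cell y (e : E) : C := [` adjc_cell y e]%fset.

(** Coefficients of the boundary map, with the sign of horizontal edges reversed to fit the
    orientation of [jump]. *)
Definition incidence (v : V) (e : E) : R :=
  ((-1) ^+ horiz (val e) *
   ((seg_start (val e) == val v)%:Z - (seg_end (val e) == val v)%:Z))%:~R.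

(** Extension by zero. For functionals indexed by the interior vertices, the value zero on the
    boundary expresses that the complex is relative to it. *)
Definition extend (K : choiceType) (A : {fset K}) (M : nmodType) (f : A -> M) (i : K) : M :=
  if insub i is Some j then f j else 0.

Lemma extend_val (K : choiceType) (A : {fset K}) (M : nmodType) (f : A -> M) (i : A) :
  extend f (val i) = f i.
Proof. by rewrite /extend valK. Qed.

Lemma extend_out (K : choiceType) (A : {fset K}) (M : nmodType) (f : A -> M) i :
  i \notin A -> extend f i = 0.
Proof. by move=> iA; rewrite /extend insubN. Qed.

Lemma extend_sum (K : choiceType) (A : {fset K}) (f : A -> R) i :
  \sum_(j : A) (i == val j)%:R * f j = extend f i.
Proof.
have [iA|iA] := boolP (i \in A); last first.
  rewrite extend_out // big1 // => j _.
  by case: eqVneq => [ij|_]; rewrite ?mul0r //; case/negP: iA; rewrite ij; exact: fsvalP.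
rewrite -[i]/(val [` iA]%fset) extend_val (bigD1 [` iA]%fset) //= eqxx mul1r.
by rewrite big1 ?addr0 // => j; rewrite -val_eqE /= eq_sym => /negPf ->; rewrite mul0r.
Qed.

Lemma extend_jump (f : {ffun C -> vT}) (e : E) :
  jump T (extend f) (val e) = f (side_cell true e) - f (side_cell false e).
Proof. by rewrite /jump -!(extend_val f). Qed.

Lemma connected_cells (f : {ffun C -> vT}) :
  (forall e, f (side_cell true e) = f (side_cell false e)) -> forall c c', f c = f c'.
Proof.
move=> H c c'; rewrite -!(extend_val f).
apply: (constant_on_cells rT _ (valP c) (valP c')) => e d d' eI a a'.
have := H [` eI]%fset; rewrite -!(extend_val f) /=.
by rewrite (adjcE rT eI a) (adjcE rT eI a').
Qed.

Lemma boundary_jump (f : {ffun C -> vT}) :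
  bd_map incidence (jump_map (side_cell true) (side_cell false) f) = 0.
Proof.
apply/ffunP => v; rewrite !ffunE; have [vT' Dv] := (interior_verticesP T _).1 (valP v).
have := jump_cycle rT (extend f) vT' Dv; rewrite big_seq_fsetE /= => H.
rewrite -[RHS]H; apply: eq_bigr => e _.
by rewrite ffunE extend_jump /incidence scaler_int mulrzA.
Qed.

Lemma incidence_functional (l : V -> vT -> R) (e : E) P :
  \sum_v incidence v e * l v P = 0 ->
  extend (l^~ P) (seg_start (val e)) = extend (l^~ P) (seg_end (val e)).
Proof.
move=> H; apply/eqP; rewrite -subr_eq0 -!extend_sum -sumrB.
have sg : (-1) ^+ horiz (val e) != 0 :> R by rewrite signr_eq0.
apply/eqP; apply: (mulfI sg); rewrite mulr0 -[RHS]H mulr_sumr; apply: eq_bigr => v _.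
by rewrite /incidence rmorphM /= rmorphXn /= rmorphN1 rmorphB /= -mulrBl mulrA.
Qed.

Lemma extend_interior (l : V -> vT -> R) P v :
  ~ (domain T)° v -> extend (l^~ P) v = 0.
Proof.
move=> nD; rewrite extend_out //; apply/negP => /interior_verticesP[_]; exact: nD.
Qed.

(** By duality: a functional vanishing on the image takes equal values at both ends of each edge,
    hence is zero by [edge_function_eq0]. *)
Lemma boundary_surj :
  (linfun (bd_map (vT := vT) incidence) @: fullv)%VS = fullv.
Proof.
rewrite -(prodv_full vT E) -(prodv_full vT V); apply: bd_map_surj => [e P _ v|l linl lE v P _].
  exact: memvf.
rewrite -(extend_val (l^~ P)); apply: (edge_function_eq0 rT (g := extend (l^~ P))).
- exact: extend_interior.
- by move=> e eI; exact: (incidence_functional (e := [` eI]%fset) (lE _ _ (memvf P))).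
- by have /interior_verticesP[] := valP v.
Qed.

Variable r : segm R -> int.
Hypotheses (sr : smoothness T r) (cr : constant_along T r).

Lemma vertex_idealE v : vertex_ideal m m' T r v =
  (\sum_(e : E | `[< seg_set (val e) v >]) edge_ideal m m' r (val e))%VS.
Proof. by rewrite /vertex_ideal big_seq_fsetE. Qed.

Lemma edge_ideal_sub e v : e \in E -> seg_set e v ->
  (edge_ideal m m' r e <= vertex_ideal m m' T r v)%VS.
Proof.
move=> eI ev; rewrite vertex_idealE.
by apply: (sumv_sup [` eI]%fset) => //=; exact/asboolP.
Qed.

(** By duality, the vanishing of the cokernel reduces to [functional_eq0_edge], where removability
    enters. *)
Lemma boundary_ideals : (forall p, p \in MIS T -> removable T r m m' p) ->
  (linfun (bd_map (vT := vT) incidence) @: prodv (fun e : E => edge_ideal m m' r (val e)))%VS =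
  prodv (fun v : V => vertex_ideal m m' T r (val v)).
Proof.
move=> rem; apply: bd_map_surj => [e P PI v|l linl lE v P].
  have sub x : tip x (val e) = val v -> P \in vertex_ideal m m' T r (val v).
    move=> <-; apply: (subvP (edge_ideal_sub (valP e) _)) PI.
    by apply: (tip_seg rT); exact: interior_edges_sub (valP e).
  rewrite /incidence; case: eqVneq => [E1|_]; first by rewrite memvZ // (sub true).
  case: eqVneq => [E2|_]; first by rewrite memvZ // (sub false).
  by rewrite subrr mulr0 scale0r mem0v.
rewrite vertex_idealE => /memv_sumP[P_ P_I ->].
have l0 : l v 0 = 0 by have := linl v (-1) 0 0; rewrite scaler0 addr0 mulN1r addNr.
rewrite (big_morph (l v) (id1 := 0) (op1 := +%R)) //; last first.
  by move=> Q Q'; have := linl v 1 Q Q'; rewrite scale1r mul1r.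
apply: big1 => e /asboolP ev; rewrite -(extend_val (l^~ (P_ e))).
have [vT' _] := (interior_verticesP T _).1 (valP v).
have evI : P_ e \in edge_ideal m m' r (val e) by apply: P_I; exact/asboolP.
apply: (functional_eq0_edge rT sr cr (l := fun v P => extend (l^~ P) v) _ _ _ rem vT' (valP e) ev evI).
- move=> w a Q Q'; rewrite /extend; case: insubP => [w' _ _|_]; first exact: linl.
  by rewrite mulr0 addr0.
- by move=> w Q nD; exact: extend_interior.
- by move=> e' Q eI QI; exact: (@incidence_functional l [` eI]%fset Q (lE [` eI]%fset Q QI)).
Qed.

Lemma bipolyB (P Q : vT) : bipoly (P - Q) = bipoly P - bipoly Q.
Proof. by rewrite addrC -scaleN1r bipolyP !polyCN mulN1r addrC. Qed.

(** An interior edge is contained in exactly two cells, one on each side; exchanging them only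
    changes the sign of the jump. *)
Lemma spline_jumps (f : {ffun C -> vT}) : f \in spline_space m m' T r <->
  forall e : E, f (side_cell true e) - f (side_cell false e) \in edge_ideal m m' r (val e).
Proof.
rewrite mem_spline_space; split=> [H e|H e c c' eI ne ec ec'].
  have eI := valP e; have eT := interior_edges_sub eI.
  have a1 := adjcP rT true eI; have a0 := adjcP rT false eI.
  apply/mem_edge_ideal; rewrite bipolyB; apply: H => //.
  - by move=> /(congr1 val) /= Ecc; exact: (adj_neq rT a1 a0 Ecc).
  - exact: adj_sub a1.
  - exact: adj_sub a0.
have eT := interior_edges_sub eI.
have [y ay] := seg_in_cell rT eT (valP c) ec; have [y' ay'] := seg_in_cell rT eT (valP c') ec'.
have K z (d : C) : adj T z e (val d) -> d = side_cell z [` eI]%fset.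
  by move=> az; apply: val_inj; rewrite /= (adjcE rT eI az).
have /mem_edge_ideal := H [` eI]%fset; rewrite bipolyB /=.
case: y ay => /K E1; case: y' ay' => /K E2; rewrite -?E1 -?E2 //.
- by case: ne; rewrite E1 E2.
- by move=> [Q EQ]; exists (- Q); rewrite mulNr -EQ opprB.
- by case: ne; rewrite E1 E2.
Qed.

Lemma dim_spline_space : (forall p, p \in MIS T -> removable T r m m' p) ->
  (\dim (spline_space m m' T r) + \sum_(v <- V) \dim (vertex_ideal m m' T r v) =
   \dim {: vT} + \sum_(e <- E) \dim (edge_ideal m m' r e))%N.
Proof.
move=> rem; rewrite !big_seq_fsetE /=.
apply: (dim_splines (up := side_cell true) (dn := side_cell false) (d := incidence)).
- have [[[p [c0 /= c0T _]] _] _] := domain_simply_connected tT.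
  by apply/card_gt0P; exists [` c0T]%fset.
- by have := euler_formula rT; rewrite -!cardfE; lia.
- exact: connected_cells.
- exact: boundary_jump.
- exact: boundary_surj.
- exact: boundary_ideals.
- exact: spline_jumps.
Qed.

Lemma euler_charE : euler_char m m' T r = (\dim {: vT})%:Z
  + \sum_(e <- E) (\dim (edge_ideal m m' r e))%:Z
  - \sum_(v <- V) (\dim (vertex_ideal m m' T r v))%:Z.
Proof.
have K (J : choiceType) (A : {fset J}) : \sum_(i <- A) (\dim {: vT})%:Z =
    (\dim {: vT})%:Z * (#|` A|)%:Z.
  by rewrite sum_fset mulr_sumr; apply: eq_bigr => i _; rewrite mulr1.
rewrite /euler_char /quotient_dim !sumrB !K.
have := congr1 (fun z => (\dim {: vT})%:Z * z) (euler_formula rT).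
rewrite mulr1 mulrDr mulrBr; move: (\sum_(e <- E) _) (\sum_(v <- V) _) => se sv.
by move: ((\dim _)%:Z) (_ * (#|` C|)%:Z) (_ * (#|` E|)%:Z) (_ * (#|` V|)%:Z) => *; lia.
Qed.

Lemma dim_spline_euler : (forall p, p \in MIS T -> removable T r m m' p) ->
  (\dim (spline_space m m' T r))%:Z = euler_char m m' T r.
Proof.
move=> /dim_spline_space /(congr1 Posz); rewrite !PoszD euler_charE.
by rewrite !(big_morph Posz PoszD (erefl _)) => <-; rewrite addrK.
Qed.

End Dimension.

(** * The deletion algorithm produces removable segments *)

Section Deletion.
Variables (R : realType) (T : mesh R) (r : segm R -> int) (m m' : nat).
Implicit Types (b x y : bool) (e p q : segm R) (u v : R * R).
Hypothesis rT : reduced T.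
Let tT : is_tmesh T := reduced_is_tmesh rT.

(** Unlike [seg_through], this ranges over [MShat] and thus also serves at boundary vertices. *)
Definition through b v : segm R :=
  xget (Segm b 0 0 0) [set p | [/\ p \in MShat T, horiz p = b & seg_set p v]].

Lemma throughP b v : v \in vertices T ->
  [/\ through b v \in MShat T, horiz (through b v) = b & seg_set (through b v) v].
Proof.
move=> /(vertex_on_unique_segments rT b)[p [Pp _]].
suff : [set s | [/\ s \in MShat T, horiz s = b & seg_set s v]] (through b v) by [].
by apply: xgetPex; exists p.
Qed.

Lemma throughE v p : v \in vertices T -> p \in MShat T -> seg_set p v ->
  through (horiz p) v = p.
Proof.
move=> vT pM pv; have [qM hq qv] := throughP (horiz p) vT.
exact: (MShat_vertex_uniq rT vT).
Qed.

Lemma MShat_interior p v : p \in MShat T -> seg_set p v -> (domain T)° v -> p \in MS T.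
Proof.
move=> pM pv Dv; case: (MShat_cases pM) => // pB.
by case: (BMS_not_interior rT pB pv).
Qed.

Lemma seg_throughE b v : v \in vertices T -> (domain T)° v -> seg_through T b v = through b v.
Proof.
move=> vT Dv; have [pM hp pv] := throughP b vT; have pMS := MShat_interior pM pv Dv.
have [qM hq qv] : [set p | [/\ p \in MS T, horiz p = b & seg_set p v]] (seg_through T b v).
  by apply: xgetPex; exists (through b v).
by apply: (MShat_vertex_uniq rT vT _ pM); rewrite ?hp //; exact: MS_MShat.
Qed.

(** Induction on the passes, with [Q] made of the transversals through the vertices of [mono]. *)
Lemma removable_deleted n p : p \in MIS T ->
  p \notin iter n (deletion_pass m m' T r) (MIS T) -> removable T r m m' p.
Proof.
elim: n p => [|n IH] p pM; first by rewrite /= pM.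
rewrite iterS; set A := iter n _ _; rewrite /deletion_pass in_fsetD negb_and negbK.
case/orP; last exact: IH.
rewrite in_fset_cond => /andP[pA]; rewrite /Defs.diagonalizable /weight => le.
have monoP v : v \in mono T A p -> [/\ v \in vertices T, seg_set p v, (domain T)° v &
    forall q, q \in MIS T -> q \in A -> q <> p -> ~ seg_set q v].
  rewrite /mono in_fset_cond => /andP[vT /asboolP[pv H]]; split => //.
  exact: MIS_interior pv.
have tP v : v \in mono T A p -> [/\ seg_through T (~~ horiz p) v \in MS T,
    horiz (seg_through T (~~ horiz p) v) = ~~ horiz p & seg_set (seg_through T (~~ horiz p) v) v].
  move=> /monoP[vT pv Dv _]; rewrite seg_throughE //.
  by have [qM hq qv] := throughP (~~ horiz p) vT; rewrite (MShat_interior qM qv Dv).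
apply: (@Removable _ _ _ _ _ p [seq seg_through T (~~ horiz p) v | v <- mono T A p]).
- rewrite map_inj_in_uniq ?fset_uniq // => v w vA wA E.
  have [_ hv tv] := tP _ vA; have [_ hw tw] := tP _ wA.
  have [_ pv _ _] := monoP _ vA; have [_ pw _ _] := monoP _ wA.
  by rewrite (meet_cross hv pv tv) (meet_cross hw pw tw) E.
- move=> _ /mapP[v vA ->]; have [tM ht tv] := tP _ vA; split=> //.
  by have [_ pv _ _] := monoP _ vA; exists v.
(* A transversal MIS through a vertex of [mono] is not in [A], so an earlier pass removed it. *)
- move=> _ /mapP[v vA ->] tI; apply: IH => //; apply/negP => tA.
  have [_ ht tv] := tP _ vA; have [_ _ _ H] := monoP _ vA.
  by apply: (H _ tI tA _ tv) => E; move: ht; rewrite E; case: (horiz p).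
- apply: le_trans le _; rewrite big_map; apply: ler_sum => v _.
  by rewrite /ms_weight /mu_h /mu_v /r_h /r_v; case: (horiz p).
Qed.

Lemma removable_CNDC p : CNDC m m' T r = fset0 -> p \in MIS T -> removable T r m m' p.
Proof. by move=> E pM; apply: (@removable_deleted #|` MIS T|) => //; rewrite -/(CNDC m m' T r) E. Qed.

End Deletion.

(** * Dimensions of ideals summed over maximal segments and their crossings *)

Section EdgeSums.
Variables (R : realType) (T : mesh R) (r : segm R -> int) (m m' : nat).
Implicit Types (b x y : bool) (e p q : segm R) (u v : R * R).
Hypothesis rT : reduced T.
Hypothesis cr : constant_along T r.
Let tT : is_tmesh T := reduced_is_tmesh rT.

Definition meets p q := (horiz q == ~~ horiz p) && `[< seg_set p `&` seg_set q !=set0 >].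

Lemma meetsP p q : meets p q -> p \in MShat T -> q \in MShat T -> exists u,
  [/\ horiz q = ~~ horiz p, u \in vertices T, seg_set p u, seg_set q u & u = cross p q].
Proof.
move=> /andP[/eqP h /asboolP[u [pu qu]]] pM qM; exists u; split => //.
  exact: (meet_vertex rT pM qM h pu qu).
exact: (meet_cross h pu qu).
Qed.

Lemma meets_through b v : v \in vertices T -> meets (through T b v) (through T (~~ b) v).
Proof.
move=> vT; have [pM hp pv] := throughP rT b vT; have [qM hq qv] := throughP rT (~~ b) vT.
by rewrite /meets hp hq eqxx; apply/asboolP; exists v.
Qed.

(** Each segment fills both sides of one of its half-lines; together these are three quadrants, and
    there is no reentrant corner. *)
Lemma interior_of_MS p q u : p \in MS T -> q \in MS T -> horiz q = ~~ horiz p ->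
  seg_set p u -> seg_set q u -> (domain T)° u.
Proof.
move=> pM qM h pu qu.
have K s : s \in MS T -> seg_set s u -> exists x e, e \in interior_edges T /\ egerm T (horiz s) x u e.
  move=> sM su; have [e [eI eu es]] := MS_edge rT sM su; have eT := interior_edges_sub eI.
  have lt := edges_nondegenerate tT eT; have [he _ _ _] := seg_sub lt es.
  have [e1 e2] := (seg_setP _ _).1 eu; have [x sx] := side_ex lt e1.
  by exists x, e; split => //; split => //; rewrite -he.
have [x [e [eI ge]]] := K _ pM pu; have [y [f [fI gf]]] := K _ qM qu; rewrite h in gf.
have Fe z : filled T (horiz p) x z u by exact: germ_filled eI ge.
have Ff z : filled T (horiz p) z y u by apply/filledC; exact: germ_filled fI gf.
apply/(int_filled tT (horiz p)) => x' y'.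
have [->|/neqNb ->] := eqVneq x' x; first exact: Fe.
have [->|/neqNb ->] := eqVneq y' y; first exact: Ff.
by apply: (no_reentrant_corner rT); rewrite negbK.
Qed.

(** The line is placed at coordinate 0 because the dimension does not depend on its position. *)
Definition edge_dim p : int :=
  (\dim (line_ideal m m' (horiz p) (0 : R) `|(seg_smoothness T r p + 1)%R|%N))%:Z.

Definition vertex_dim p q : int :=
  (\dim (line_ideal m m' true (0 : R) `|(seg_smoothness T r p + 1)%R|%N +
         line_ideal m m' false (0 : R) `|(seg_smoothness T r q + 1)%R|%N)%VS)%:Z.

(** A maximal segment has one edge fewer than vertices, and its vertices are its crossings with
    members of [MShat]. *)
Lemma sum_edge_dim :
  \sum_(e <- interior_edges T) (\dim (edge_ideal m m' r e))%:Z =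
  \sum_(pq <- (MS T `*` MShat T)%fset | meets pq.1 pq.2) edge_dim pq.1
  - \sum_(p <- MS T) edge_dim p.
Proof.
rewrite [in RHS](bigID (fun pq : segm R * segm R => lo pq.1 < cor pq.2)) /=.
(* The crossings not after [lo] are the starts, one for each segment. *)
have -> : \sum_(p <- MS T) edge_dim p =
    \sum_(pq <- (MS T `*` MShat T)%fset | meets pq.1 pq.2 && ~~ (lo pq.1 < cor pq.2)) edge_dim pq.1.
  have stP p : p \in MS T -> seg_start p \in vertices T /\ seg_set p (seg_start p).
    move=> pM; have ps := seg_lo (MShat_lt rT (MS_MShat rT pM)); split => //.
    have [e [eI es ep]] := MS_edge rT pM ps; have eT := interior_edges_sub eI.
    have [he ce le _] := seg_sub (edges_nondegenerate tT eT) ep.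
    suff -> : seg_start p = seg_start e by exact: start_vertex.
    have [h1 h2] := coord_tip true p; have [h3 h4] := coord_tip true e.
    rewrite /tip in h1 h2 h3 h4.
    apply: (@coord_inj _ (horiz p)); rewrite ?h1 ?h2 -he ?h3 ?h4 //.
    by have [/andP[s1 _] _] := (seg_setP _ _).1 es; rewrite he h1 in s1; order.
  apply: (sum_reindex (f := fun p => (p, through T (~~ horiz p) (seg_start p)))); rewrite ?fset_uniq //.
  - by move=> p q _ _ _ _ [].
  - move=> p pM _; have [sT ps] := stP _ pM; have [qM hq qs] := throughP rT (~~ horiz p) sT.
    split => //=; first by rewrite in_fsetM /= pM.
    have -> : meets p (through T (~~ horiz p) (seg_start p)).
      by have := meets_through (horiz p) sT; rewrite (throughE rT sT (MS_MShat rT pM) ps).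
    have [h1 h2] := coord_tip true p; have [_ q2] := (seg_setP _ _).1 qs.
    by rewrite /= -q2 hq negbK h1 ltxx.
  - move=> [p q]; rewrite in_fsetM /= => /andP[pM qM] /andP[mpq].
    have pH := MS_MShat rT pM; have [u [hq uT pu qu E]] := meetsP mpq pH qM.
    rewrite -leNgt => le; exists p; split => //; congr pair.
    have [/andP[l1 l2] l3] := (seg_setP _ _).1 pu; have [h1 h2] := coord_tip true p.
    have Eu : u = seg_start p.
      apply: (@coord_inj _ (horiz p)); rewrite ?h1 ?h2 //.
      by move: l1; rewrite E /cross coord_mkpt => l1; order.
    by rewrite -Eu -hq; exact: throughE.
rewrite addrK.
(* Every other crossing is the end of exactly one edge of the segment. *)
apply: (sum_reindex (f := fun e => (through T (horiz e) (seg_end e), through T (~~ horiz e) (seg_end e))));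
  rewrite ?fset_uniq //.
- move=> e e' eI e'I _ _ [E1 E2]; have vT := end_vertex (interior_edges_sub eI).
  have vT' := end_vertex (interior_edges_sub e'I).
  have [pM hp pv] := throughP rT (horiz e) vT; have [pM' hp' pv'] := throughP rT (horiz e') vT'.
  have [qM hq qv] := throughP rT (~~ horiz e) vT; have [qM' hq' qv'] := throughP rT (~~ horiz e') vT'.
  have Eh : horiz e = horiz e' by rewrite -hp E1 hp'.
  have Ev : seg_end e = seg_end e'.
    rewrite (meet_cross _ pv qv) ?hq ?hp // (meet_cross _ pv' qv') ?hq' ?hp' //.
    by rewrite -E1 -E2.
  apply: (@germ_uniq _ _ rT (horiz e) false (seg_end e)); apply/(germ_tip rT) => //;
    by split; [exact: interior_edges_sub| |].
- move=> e eI _; have eT := interior_edges_sub eI; have vT := end_vertex eT.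
  have [p [pM pH ep]] := edge_MS rT eI; have ltE := edges_nondegenerate tT eT.
  have [he ce le ge] := seg_sub ltE ep; have pv : seg_set p (seg_end e) by exact/ep/seg_hi.
  have Ep : through T (horiz e) (seg_end e) = p by rewrite he; exact: throughE.
  have [qM hq qv] := throughP rT (~~ horiz e) vT.
  split => /=; first by rewrite in_fsetM /= Ep pM.
    rewrite meets_through //= Ep; have [_ q2] := (seg_setP _ _).1 qv.
    have [h3 _] := coord_tip false e; rewrite hq negbK in q2.
    by rewrite -q2 [coord _ _]h3; order.
  rewrite Ep /edge_dim (edge_ms_ideal rT cr _ _ pM eT ep) /ms_ideal.
  exact: (congr1 Posz (dim_line_ideal m m' (horiz p) (cor p) 0 _)).
- move=> [p q]; rewrite in_fsetM /= => /andP[pM qM] /andP[mpq lt].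
  have pH := MS_MShat rT pM; have [u [hq uT pu qu E]] := meetsP mpq pH qM.
  have [|e [eI ep eu]] := MS_pred rT pM uT pu; first by rewrite E /cross coord_mkpt.
  have [he _ _ _] := seg_sub (edges_nondegenerate tT (interior_edges_sub eI)) ep.
  by exists e; split => //; rewrite eu he -[X in (_, through T X _)]hq; congr pair; exact: (throughE rT).
Qed.

(** Interior vertices are the crossings of a horizontal and a vertical member of [MS]. *)
Lemma sum_vertex_dim :
  \sum_(v <- interior_vertices T) (\dim (vertex_ideal m m' T r v))%:Z =
  \sum_(pq <- (MS T `*` MS T)%fset | meets pq.1 pq.2 && horiz pq.1) vertex_dim pq.1 pq.2.
Proof.
apply: (sum_reindex (f := fun v => (through T true v, through T false v))); rewrite ?fset_uniq //.
- move=> v w /interior_verticesP[vT _] /interior_verticesP[wT _] _ _ [E1 E2].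
  have [pM hp pv] := throughP rT true vT; have [pM' hp' pv'] := throughP rT true wT.
  have [qM hq qv] := throughP rT false vT; have [qM' hq' qv'] := throughP rT false wT.
  rewrite (meet_cross _ pv qv) ?hq ?hp // (meet_cross _ pv' qv') ?hq' ?hp' //.
  by rewrite E1 E2.
- move=> v /interior_verticesP[vT Dv] _.
  have [pM hp pv] := throughP rT true vT; have [qM hq qv] := throughP rT false vT.
  have pMS := MShat_interior rT pM pv Dv; have qMS := MShat_interior rT qM qv Dv.
  split => /=; first by rewrite in_fsetM /= pMS.
    by rewrite hp andbT; exact: (meets_through true vT).
  apply: etrans (congr1 Posz (dim_line_idealD m m' (cor (through T false v)) 0
    (cor (through T true v)) 0 _ _)); congr (Posz (\dim _)).
  have EP := edge_ms_ideal rT cr m m' pMS.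
  have EQ := edge_ms_ideal rT cr m m' qMS.
  rewrite /ms_ideal hp in EP; rewrite /ms_ideal hq in EQ.
  have [e [eI ev ep]] := MS_edge rT pMS pv; have [f [fI fv fq]] := MS_edge rT qMS qv.
  rewrite -(EP _ (interior_edges_sub eI) ep) -(EQ _ (interior_edges_sub fI) fq).
  apply: subv_anti; apply/andP; split; last first.
    by rewrite subv_add !edge_ideal_sub.
  (* Every interior edge through [v] lies on one of the two segments and has its ideal. *)
  rewrite vertex_idealE; apply/subv_sumP => g /asboolP gv; have gI := valP g.
  have gT := interior_edges_sub gI.
  have [s [sM sH gs]] := edge_MS rT gI; have [hs _ _ _] := seg_sub (edges_nondegenerate tT gT) gs.
  have sE : s = through T (horiz (val g)) v by rewrite hs (throughE rT vT sH (gs _ gv)).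
  have [hg|hg] := boolP (horiz (val g)).
    rewrite hg in sE; rewrite sE in gs.
    by apply: subv_trans (addvSl _ _); rewrite (EP _ gT gs) -(EP _ (interior_edges_sub eI) ep).
  rewrite (negPf hg) in sE; rewrite sE in gs.
  by apply: subv_trans (addvSr _ _); rewrite (EQ _ gT gs) -(EQ _ (interior_edges_sub fI) fq).
- move=> [p q]; rewrite in_fsetM /= => /andP[pM qM] /andP[mpq hp].
  have pH := MS_MShat rT pM; have qH := MS_MShat rT qM.
  have [u [hq uT pu qu E]] := meetsP mpq pH qH; have hq' : horiz q = false by rewrite hq hp.
  exists u; split => //; last by rewrite -{1}hp -hq' !throughE.
  by apply/interior_verticesP; split => //; exact: (interior_of_MS pM qM hq pu qu).
Qed.

End EdgeSums.

(** * Structural isomorphisms *)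

Section Transfer.
Variables (R : realType) (T T' : mesh R) (r r' : segm R -> int) (a : segm R -> segm R).
Variables (m m' : nat).
Implicit Types (b x y : bool) (e p q : segm R) (u v w : R * R).
Hypotheses (rT : reduced T) (rT' : reduced T') (cr : constant_along T r).
Hypotheses (iso : structural_iso T T' a) (dir : direction_preserving T a).
Hypothesis rE : forall e, e \in interior_edges T ->
  exists2 e', edge_image T T' a e e' & r' e' = r e.
Let tT : is_tmesh T := reduced_is_tmesh rT.
Let tT' : is_tmesh T' := reduced_is_tmesh rT'.

Lemma iso_MShat p : p \in MShat T -> a p \in MShat T'.
Proof. by case: (iso_bij iso) => h _ _; exact: h. Qed.

Lemma iso_inj p q : p \in MShat T -> q \in MShat T -> a p = a q -> p = q.
Proof.
by case: (iso_bij iso) => _ h _ pM qM; apply: h; apply/mem_set.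
Qed.

Lemma iso_surj p' : p' \in MShat T' -> exists2 p, p \in MShat T & a p = p'.
Proof. by case: (iso_bij iso) => _ _ h /h[p]; exists p. Qed.

Lemma MS_split (S : mesh R) p : reduced S ->
  p \in MS S <-> [\/ p \in CC S, p \in Ray S | p \in MIS S].
Proof.
move=> rS; split=> [pM|[]]; try by rewrite in_fset_cond => /andP[].
have := MS_MShat rS pM; rewrite /MShat !in_fsetU => /orP[/orP[/orP[]|]|] h.
- by constructor 1.
- by constructor 2.
- by constructor 3.
- by case: (MS_BMS rS pM h).
Qed.

Lemma iso_MS p : p \in MS T -> a p \in MS T'.
Proof.
move=> /(MS_split _ rT) H; apply/(MS_split _ rT').
have K (A A' : {fset segm R}) : a @` [set` A] = [set` A'] -> p \in A -> a p \in A'.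
  by move=> E pA; suff : [set` A'] (a p) by []; rewrite -E; exists p.
case: H => H; [constructor 1|constructor 2|constructor 3]; apply: K H.
- exact: iso_CC iso.
- exact: iso_Ray iso.
- exact: iso_MIS iso.
Qed.

Lemma iso_MS_surj p' : p' \in MS T' -> exists2 p, p \in MS T & a p = p'.
Proof.
move=> /(MS_split _ rT') H.
have K (A A' : {fset segm R}) : a @` [set` A] = [set` A'] -> p' \in A' ->
    exists2 p, p \in A & a p = p'.
  move=> E pA; have : [set` A'] p' by [].
  by rewrite -E => -[p pA' <-]; exists p.
case: H => /K; [move=> /(_ _ (iso_CC iso))|move=> /(_ _ (iso_Ray iso))|move=> /(_ _ (iso_MIS iso))];
  move=> [p pA <-]; exists p => //; apply/(MS_split _ rT).
- by constructor 1.
- by constructor 2.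
- by constructor 3.
Qed.

Lemma iso_MIS_inv p : p \in MShat T -> a p \in MIS T' -> p \in MIS T.
Proof.
move=> pM aM; have : [set` MIS T'] (a p) by [].
rewrite -(iso_MIS iso) => -[q qM /iso_inj E].
by rewrite -E //; exact: (MS_MShat rT (MIS_MS qM)).
Qed.

Lemma iso_horiz p q : p \in MShat T -> q \in MShat T ->
  (horiz (a q) == ~~ horiz (a p)) = (horiz q == ~~ horiz p).
Proof. by move=> pM qM; rewrite !dir. Qed.

Lemma iso_meets p q : p \in MShat T -> q \in MShat T -> meets (a p) (a q) = meets p q.
Proof.
move=> pM qM; rewrite /meets iso_horiz //; case: eqP => //= h.
apply: asbool_equiv_eq; apply: iff_sym; apply: (iso_meet iso) => //.
by move=> E; move: h; rewrite E; case: (horiz q).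
Qed.

Lemma iso_cor_lt p q : p \in MShat T -> q \in MShat T -> horiz p = horiz q ->
  cor (a p) < cor (a q) -> cor p < cor q.
Proof. by move=> pM qM h; apply: (iso_cor iso pM qM h).2. Qed.

Lemma cross_vertex p q : p \in MShat T -> q \in MShat T -> meets p q ->
  [/\ horiz q = ~~ horiz p, cross p q \in vertices T, seg_set p (cross p q) &
      seg_set q (cross p q)].
Proof. by move=> pM qM mpq; have [u [? ? ? ? <-]] := meetsP rT mpq pM qM. Qed.

(** The segments chosen in [vertex_image] are [p] and [q] in some order, as only one member of
    [MShat] in each direction passes through a vertex. *)
Lemma vertex_image_cross p q v' : p \in MShat T -> q \in MShat T -> meets p q ->
  vertex_image T a (cross p q) v' -> v' = cross (a p) (a q).
Proof.
move=> pM qM mpq [p1 [q1 [p1M q1M ne E E']]].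
have [hq cT cp cq] := cross_vertex pM qM mpq.
have [c1 c2] : (seg_set p1 `&` seg_set q1) (cross p q) by rewrite E.
have [v1 v2] : (seg_set (a p1) `&` seg_set (a q1)) v' by rewrite E'.
have haq : horiz (a q) = ~~ horiz (a p) by rewrite !dir.
have [h1|h1] := eqVneq (horiz p1) (horiz p).
  have Ep : p1 = p by exact: (MShat_vertex_uniq rT cT).
  have Eq : q1 = q.
    apply: (MShat_vertex_uniq rT cT) => //; rewrite hq; apply/neqNb/eqP => h2.
    by apply: ne; apply: (MShat_vertex_uniq rT cT) => //; rewrite h2.
  by subst p1 q1; exact: meet_cross.
have Ep : p1 = q by apply: (MShat_vertex_uniq rT cT) => //; rewrite hq; exact: neqNb.
have Eq : q1 = p.
  apply: (MShat_vertex_uniq rT cT) => //; rewrite -[RHS]negbK -hq -Ep; apply/neqNb/eqP => h2.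
  by apply: ne; apply: (MShat_vertex_uniq rT cT) => //; rewrite h2.
by subst p1 q1; exact: meet_cross.
Qed.

(** The smoothness is prescribed on images of edges of [T], so each edge of [a p] has to be
    recognized as such an image. *)
Lemma iso_smoothness p e' : p \in MS T -> e' \in edges T' -> seg_set e' `<=` seg_set (a p) ->
  r' e' = seg_smoothness T r p.
Proof.
move=> pM e'T e'p; have pH := MS_MShat rT pM; have apH := iso_MShat pH.
have lt' := edges_nondegenerate tT' e'T; have [he' ce' le' ge'] := seg_sub lt' e'p.
have [t1 t2] := coord_tip true e'; have [t3 t4] := coord_tip false e'.
(* The transversal through each end of [e'] is the image of a transversal of [p]. *)
have trans x : exists h, [/\ h \in MShat T, meets p h & cross (a p) (a h) = tip x e'].
  have vT := tip_vertex x e'T; have pv := e'p _ (tip_seg rT' x e'T).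
  have [qM hq qv] := throughP rT' (~~ horiz (a p)) vT.
  have [h hM hE] := iso_surj qM; exists h; split=> //; last first.
    by rewrite hE; apply/esym/meet_cross.
  by rewrite -iso_meets // hE -{1}(throughE rT' vT apH pv); exact: meets_through.
have [h [hM mh ch]] := trans true; have [k [kM mk ck]] := trans false.
have [hh vT vp vh] := cross_vertex pH hM mh; have [hk wT wp wk] := cross_vertex pH kM mk.
have corh : cor (a h) = lo e' by rewrite -t1 -ch he' /cross coord_mkpt.
have cork : cor (a k) = hi e' by rewrite -t3 -ck he' /cross coord_mkpt.
have lt : cor h < cor k by apply: iso_cor_lt; rewrite ?hh ?hk // corh cork.
(* The preimage of [e']: the part of [p] between these two transversals. *)
pose e := Segm (horiz p) (cor p) (cor h) (cor k).
have sE : seg_start e = cross p h by rewrite /seg_start seg_ptE.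
have eE : seg_end e = cross p k by rewrite /seg_end seg_ptE.
have ep : seg_set e `<=` seg_set p.
  move=> u /seg_setP /= [u1 u2]; apply/seg_setP; split => //.
  have [] := (seg_setP _ _).1 vp; have [] := (seg_setP _ _).1 wp.
  by rewrite /cross !coord_mkpt => *; order.
have eT : e \in edges T.
  apply/(edges_consecutive rT); exists p => //; split => //.
  (* A vertex inside [e] lies on a transversal whose image would cut [e'] at an inner vertex, as [a]
     preserves the order of coordinates. *)
  move=> z hz; apply/negP => zT; set u := seg_pt e z in zT.
  have pu : seg_set p u.
    by apply: ep; apply/seg_setP; rewrite /u seg_ptE coord_mkpt coordN_mkpt; split=> //=; order.
  have [qM hq qu] := throughP rT (~~ horiz p) zT; set q := through _ _ _ in qM hq qu.
  have mq : meets p q by rewrite /meets hq eqxx; apply/asboolP; exists u.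
  have cq : cor q = z.
    by have [_ <-] := (seg_setP _ _).1 qu; rewrite hq negbK /u seg_ptE coord_mkpt.
  have maq : meets (a p) (a q) by rewrite iso_meets.
  have [u' [haq u'T pu' qu' Eu']] := meetsP rT' maq apH (iso_MShat qM).
  have l1 : cor (a h) < cor (a q).
    by apply: (iso_cor iso hM qM _).1; rewrite ?hh ?hq // cq; case/andP: hz.
  have l2 : cor (a q) < cor (a k).
    by apply: (iso_cor iso qM kM _).1; rewrite ?hk ?hq // cq; case/andP: hz.
  have eu' : seg_set e' u'.
    apply/seg_setP; rewrite he' Eu' /cross coord_mkpt coordN_mkpt ce'; split=> //.
    by rewrite -corh -cork; order.
  have := vertex_on_edge rT' e'T u'T eu'; rewrite he' Eu' /cross coord_mkpt -corh -cork.
  by case=> E; rewrite E ltxx in l1 l2.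
have eI := MS_edge_interior rT pM eT ep.
(* The edge that [rE] associates with [e] has the same ends as [e'], hence equals it. *)
have [e'' [p1 [v' [w' [[p1M ep1] [e''T e''p] iv iw EE]]]] re''] := rE eI.
have Ep1 : p1 = p.
  apply: (MShat_vertex_uniq rT (start_vertex eT) p1M pH); [|by apply: ep1; exact: seg_lo|by apply: ep; exact: seg_lo].
  by have [<- _ _ _] := seg_sub (edges_nondegenerate tT eT) ep1.
subst p1; rewrite sE in iv; rewrite eE in iw.
have Ev := vertex_image_cross pH hM mh iv; have Ew := vertex_image_cross pH kM mk iw.
rewrite Ev Ew ch ck in EE.
have lt'' := edges_nondegenerate tT' e''T; have [he'' ce'' _ _] := seg_sub lt'' e''p.
have [s1 s2] := coord_tip true e''; have [s3 s4] := coord_tip false e''.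
have K x : coord (horiz (a p)) (tip x e'') = lo e' \/ coord (horiz (a p)) (tip x e'') = hi e'.
  have : [set seg_start e''; seg_end e''] (tip x e'') by case: x; [left|right].
  by rewrite EE -he' => -[->|->]; rewrite ?t1 ?t3; [left|right].
have E : e'' = e'.
  have [k1 k2] : lo e'' = lo e' /\ hi e'' = hi e'.
    have := K true; have := K false; rewrite -he'' s1 s3 => -[E3|E3] [E1|E1] //;
      by rewrite E1 E3 ?ltxx // in lt''; exfalso; order.
  by move: he'' ce'' he' ce' k1 k2; case: (e'') (e') => [? ? ? ?] [? ? ? ?] /= -> -> -> -> -> ->.
by rewrite -E re'' (seg_smoothnessE cr pM eT ep).
Qed.

Lemma iso_constant_along : constant_along T' r'.
Proof.
move=> p' /iso_MS_surj[p pM <-] e e' eT e'T ep e'p.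
by rewrite (iso_smoothness pM eT ep) (iso_smoothness pM e'T e'p).
Qed.

Lemma iso_seg_smoothness p : p \in MS T ->
  seg_smoothness T' r' (a p) = seg_smoothness T r p.
Proof.
move=> pM; have apM := iso_MS pM.
have [e [eI _ ep]] := MS_edge rT' apM (seg_lo (MShat_lt rT' (MS_MShat rT' apM))).
have eT := interior_edges_sub eI.
by rewrite (seg_smoothnessE iso_constant_along apM eT ep) (iso_smoothness pM eT ep).
Qed.

(** The image under [a] of a family of transversals serves for [a p], since directions, crossings,
    MIS and smoothness are preserved. *)
Lemma iso_removable p : p \in MS T -> removable T r m m' p -> removable T' r' m m' (a p).
Proof.
move=> + rp; elim: rp => {}p Q uQ QP _ IH le pM; have pH := MS_MShat rT pM.
apply: (@Removable _ _ _ _ _ (a p) [seq a q | q <- Q]).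
- rewrite map_inj_in_uniq // => q q' /QP[qM _ _] /QP[q'M _ _].
  by apply: iso_inj; exact: MS_MShat.
- move=> _ /mapP[q qQ ->]; have [qM hq pq] := QP _ qQ; have qH := MS_MShat rT qM.
  split; [exact: iso_MS | by rewrite !dir |].
  have : meets (a p) (a q) by rewrite iso_meets // /meets hq eqxx; apply/asboolP.
  by move=> /andP[_ /asboolP].
- move=> _ /mapP[q qQ ->] aqM; have [qM _ _] := QP _ qQ.
  by apply: IH => //; exact: iso_MIS_inv (MS_MShat rT qM) aqM.
- rewrite big_map /threshold dir //; apply: le_trans le _; rewrite !big_seq.
  apply: ler_sum => q qQ; have [qM _ _] := QP _ qQ.
  by rewrite /ms_weight dir // iso_seg_smoothness.
Qed.

Lemma iso_removable_MIS : (forall p, p \in MIS T -> removable T r m m' p) ->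
  forall p', p' \in MIS T' -> removable T' r' m m' p'.
Proof.
move=> H p' pM'; have [p pM E] := iso_MS_surj (MIS_MS pM'); rewrite -E in pM' *.
by apply: (iso_removable pM); apply: H; exact: iso_MIS_inv (MS_MShat rT pM) pM'.
Qed.

Lemma iso_edge_dim p : p \in MS T -> edge_dim T r m m' p = edge_dim T' r' m m' (a p).
Proof. by move=> pM; rewrite /edge_dim iso_seg_smoothness // dir // MS_MShat. Qed.

Let a2 (pq : segm R * segm R) := (a pq.1, a pq.2).

Lemma iso_MS_inj p q : p \in MS T -> q \in MS T -> a p = a q -> p = q.
Proof. by move=> pM qM; exact: iso_inj (MS_MShat rT pM) (MS_MShat rT qM). Qed.

Lemma iso_sum_edges : \sum_(p <- MS T) edge_dim T r m m' p =
  \sum_(p <- MS T') edge_dim T' r' m m' p.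
Proof.
apply: (sum_reindex (f := a) (fset_uniq _) (fset_uniq _)).
- by move=> p q pM qM _ _; exact: iso_MS_inj.
- by move=> p pM _; split; [exact: iso_MS | | exact: iso_edge_dim].
- by move=> p' /iso_MS_surj[p pM <-] _; exists p.
Qed.

Lemma iso_sum_meets :
  \sum_(pq <- (MS T `*` MShat T)%fset | meets pq.1 pq.2) edge_dim T r m m' pq.1 =
  \sum_(pq <- (MS T' `*` MShat T')%fset | meets pq.1 pq.2) edge_dim T' r' m m' pq.1.
Proof.
apply: (sum_reindex (f := a2) (fset_uniq _) (fset_uniq _)).
- move=> [p q] [p' q']; rewrite !in_fsetM => /andP[/= pM qM] /andP[/= pM' qM'] _ _ [E1 E2].
  by rewrite (iso_MS_inj pM pM' E1) (iso_inj qM qM' E2).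
- move=> [p q]; rewrite in_fsetM => /andP[/= pM qM] mpq; split.
  + by rewrite in_fsetM; apply/andP; split; [exact: iso_MS | exact: iso_MShat].
  + by rewrite /a2 (iso_meets (MS_MShat rT pM) qM).
  + exact: iso_edge_dim.
- move=> [p' q']; rewrite in_fsetM => /andP[/= /iso_MS_surj[p pM <-] /iso_surj[q qM <-]].
  rewrite (iso_meets (MS_MShat rT pM) qM) => mpq; exists (p, q); split => //.
  by rewrite in_fsetM; apply/andP.
Qed.

Lemma iso_sum_vertices :
  \sum_(pq <- (MS T `*` MS T)%fset | meets pq.1 pq.2 && horiz pq.1)
    vertex_dim T r m m' pq.1 pq.2 =
  \sum_(pq <- (MS T' `*` MS T')%fset | meets pq.1 pq.2 && horiz pq.1)
    vertex_dim T' r' m m' pq.1 pq.2.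
Proof.
apply: (sum_reindex (f := a2) (fset_uniq _) (fset_uniq _)).
- move=> [p q] [p' q']; rewrite !in_fsetM => /andP[/= pM qM] /andP[/= pM' qM'] _ _ [E1 E2].
  by rewrite (iso_MS_inj pM pM' E1) (iso_MS_inj qM qM' E2).
- move=> [p q]; rewrite in_fsetM => /andP[/= pM qM] mpq; split.
  + by rewrite in_fsetM; apply/andP; split; exact: iso_MS.
  + by rewrite /a2 (iso_meets (MS_MShat rT pM) (MS_MShat rT qM)) (dir (MS_MShat rT pM)).
  + by rewrite /a2 /vertex_dim (iso_seg_smoothness pM) (iso_seg_smoothness qM).
- move=> [p' q']; rewrite in_fsetM => /andP[/= /iso_MS_surj[p pM <-] /iso_MS_surj[q qM <-]].
  rewrite (iso_meets (MS_MShat rT pM) (MS_MShat rT qM)) (dir (MS_MShat rT pM)) => mpq.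
  by exists (p, q); split => //; rewrite in_fsetM; apply/andP.
Qed.

(** By Euler's formula and the sums over segments and crossings, only data preserved by [a]
    enter. *)
Lemma iso_euler_char : euler_char m m' T' r' = euler_char m m' T r.
Proof.
rewrite (euler_charE m m' rT r) (euler_charE m m' rT' r').
rewrite (sum_edge_dim m m' rT cr) (sum_edge_dim m m' rT' iso_constant_along).
rewrite (sum_vertex_dim m m' rT cr) (sum_vertex_dim m m' rT' iso_constant_along).
by rewrite iso_sum_edges iso_sum_meets iso_sum_vertices.
Qed.

End Transfer.

(** * Dimension formula on the structural class, and dimensional stability *)

Theorem corollary3p26 (R : realType) (T : mesh R) (r : segm R -> int)
    (m m' : nat) :
  reduced T -> smoothness T r -> constant_along T r ->
  CNDC m m' T r = fset0 ->
  (forall (T' : mesh R) (r' : segm R -> int),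
     structural_class T r T' r' ->
     (\dim (spline_space m m' T' r'))%:Z = euler_char m m' T' r') /\
  dimensionally_stable m m' T r.
Proof.
move=> rT sr cr E.
have rem p : p \in MIS T -> removable T r m m' p by exact: removable_CNDC.
have main T' r' : structural_class T r T' r' ->
    (\dim (spline_space m m' T' r'))%:Z = euler_char m m' T' r' /\
    euler_char m m' T' r' = euler_char m m' T r.
  move=> [rT' sr' [a [iso dir rE]]]; split; last exact: (iso_euler_char _ _ rT rT' cr iso dir rE).
  apply: (dim_spline_euler rT' sr' (iso_constant_along rT rT' cr iso dir rE)).
  exact: (iso_removable_MIS rT rT' cr iso dir rE rem).
split=> T' r' /main[dimE chiE] //.
(* Both dimensions equal their Euler characteristics, which agree. *)
by apply/eqP; rewrite -eqz_nat dimE chiE (dim_spline_euler rT sr cr rem).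
Qed.
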